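(* Let $n\ge 4$ be even, let $p\ge n+1$ be an integer, let $c_1$ be a positive integer, and define $a_k=pc_k$, $c_{k+1}=pa_k=p^2c_k$ for $k\ge1$. Let $T$ be an interval exchange transformation of $[0,1)$ with permutation $\pi$ whose right Rauzy induction path is the infinite concatenation $\gamma_{a_1,c_1}\gamma_{a_2,c_2}\gamma_{a_3,c_3}\cdots$ (notation in the context). Then for every $j\in S=\{3,5,\dots,n-1,n\}$ the limit $$L_j=\lim_{m\to\infty}\overline{\Theta_{1}\Theta_{2}\cdots\Theta_{m}e_j}$$ exists, $T$ is not uniquely ergodic, and $T$ possesses $n/2$ pairwise distinct invariant ergodic probability measures $\lambda_j$, $j\in S$, where $\lambda_j$ is the $T$-invariant measure whose vector of values $(\lambda_j(X_1),\dots,\lambda_j(X_n))$ on the initial subintervals is $L_j$.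
   Context: An interval exchange transformation (IET) $T$ of $[0,1)$ is given by a permutation and a length vector: $[0,1)$ is cut into consecutive intervals $X_1,\dots,X_n$ (left to right) which are translated and reordered. Here $\pi$ is the permutation with top row $1,2,3,\dots,n$ and bottom row $n,3,2,5,4,\dots,n-1,n-2,1$ (i.e. $1$ and $n$ are exchanged and $2i\leftrightarrow 2i+1$ for $1\le i\le (n-2)/2$). Right Rauzy induction: compare the rightmost interval of the domain (top) and of the image (bottom); step ''0'' is when the top one is longer, step ''1'' when the bottom one is longer; one induces $T$ on the interval obtained by removing the shorter of the two lengths from the right. For $a,c>0$ set $\dot\gamma_{m,a}=1^{n-1-m}0^a10^2$ and $\gamma_{a,c}=0\,\dot\gamma_{n-2,a}\cdots\dot\gamma_{2,a}\,1^{c(n-1)}$, a closed path in the Rauzy diagram at $\pi$. Its transition matrix (old length vector $=\Theta_{a,c}\cdot$ new length vector) is the $n\times n$ matrix $\Theta_{a,c}$ with: row $1$ equal to $(1,c,c,\dots,c)$; row $n$ equal to $(1,c+1,\dots,c+1)$; for $1\le i\le (n-2)/2$, row $2i$ has $0$ in column $1$, $2$ in columns $2i$ and $2i+1$, and $1$ in all other columns among $2,\dots,n$; row $2i+1$ has $a$ in column $2i$, $a+1$ in column $2i+1$ and $0$ elsewhere. Write $\Theta_k=\Theta_{a_k,c_k}$. For a nonnegative vector $v$, $|v|$ is the sum of its entries and $\overline{v}=v/|v|$; $e_j$ is the $j$-th standard basis vector. *)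

(* Defs.v *)
From HB Require Import structures.
From mathcomp Require Import all_boot all_order all_algebra.
From mathcomp Require Import all_classical all_reals all_analysis.
Import numFieldNormedType.Exports.
Set Implicit Arguments. Unset Strict Implicit. Unset Printing Implicit Defensive.
Import Order.TTheory GRing.Theory Num.Theory.
Local Open Scope classical_set_scope.
Local Open Scope ring_scope.

(* Labels are 0-based: paper label i+1 <-> index i (i < n).
   Rauzy step type "0" is [false], type "1" is [true]. *)

Definition gammadot (n m a : nat) : seq bool :=
  nseq (n - 1 - m)%N true ++ nseq a false ++ [:: true; false; false].

Definition gamma (n a c : nat) : seq bool :=
  false :: flatten [seq gammadot n (n - 2 - 2 * i)%N a | i <- iota 0 (n - 2)./2]
        ++ nseq (c * (n - 1))%N true.

(* 0-based: cseq k = c_{k+1}, aseq k = a_{k+1} *)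
Fixpoint cseq (p c1 k : nat) : nat :=
  match k with 0 => c1 | k'.+1 => (p * (p * cseq p c1 k'))%N end.
Definition aseq (p c1 k : nat) : nat := (p * cseq p c1 k)%N.

Definition Wpre (n p c1 m : nat) : seq bool :=
  flatten [seq gamma n (aseq p c1 k) (cseq p c1 k) | k <- iota 0 m].

Definition top0 (n : nat) : seq nat := iota 0 n.
Definition bot0 (n : nat) : seq nat :=
  (n - 1)%N :: flatten [seq [:: (2 * i)%N; (2 * i - 1)%N] | i <- iota 1 (n - 2)./2]
         ++ [:: 0%N].

Section Rauzy.
Variable R : realType.

Record rstate := RS { rtop : seq nat; rbot : seq nat; rlam : nat -> R }.

Definition drop_last (s : seq nat) : seq nat := take (size s).-1 s.
Definition ins_after (x y : nat) (s : seq nat) : seq nat :=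
  let k := index x s in take k.+1 s ++ y :: drop k.+1 s.
Definition upd (f : nat -> R) (k : nat) (v : R) : nat -> R :=
  fun i => if i == k then v else f i.

Definition rauzy_step (s : rstate) : option (bool * rstate) :=
  let xt := last 0%N (rtop s) in
  let xb := last 0%N (rbot s) in
  let l := rlam s in
  if l xb < l xt then
    Some (false, RS (rtop s) (ins_after xt xb (drop_last (rbot s)))
                    (upd l xt (l xt - l xb)))
  else if l xt < l xb then
    Some (true, RS (ins_after xb xt (drop_last (rtop s))) (rbot s)
                   (upd l xb (l xb - l xt)))
  else None.

Fixpoint rauzy_types (N : nat) (s : rstate) : option (seq bool) :=
  match N with
  | 0 => Some [::]
  | N'.+1 => match rauzy_step s with
             | Some (t, s') => omap (cons t) (rauzy_types N' s')
             | None => None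
             end
  end.

Definition init_state (n : nat) (lam : 'I_n -> R) : rstate :=
  RS (top0 n) (bot0 n) (fun k => oapp lam 0 (insub k)).

Definition Theta (n a c : nat) : 'M[R]_n :=
  \matrix_(r < n, q < n)
    (if (r == 0 :> nat) then (if q == 0 :> nat then 1 else c%:R)
     else if (r == n.-1 :> nat) then (if q == 0 :> nat then 1 else c.+1%:R)
     else if odd r then
       (if q == 0 :> nat then 0
        else if (q == r :> nat) || (q == r.+1 :> nat) then 2%:R else 1)
     else (if (q == r.-1 :> nat) then a%:R
           else if (q == r :> nat) then a.+1%:R else 0)).

Fixpoint thetaprod (n p c1 m : nat) : 'M[R]_n :=
  match m with
  | 0 => 1%:M
  | m'.+1 => thetaprod n p c1 m' *m Theta n (aseq p c1 m') (cseq p c1 m')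
  end.

Definition normv (n : nat) (v : 'cV[R]_n) : 'cV[R]_n := (\sum_i v i 0)^-1 *: v.

(* S = {3,5,...,n-1,n} in 0-based labels: {2,4,...,n-2} U {n-1} *)
Definition inS (n : nat) (j : 'I_n) : bool :=
  ((j : nat) == n.-1) || (~~ odd j && (2 <= j)%N).

Definition left_top (n : nat) (lam : 'I_n -> R) (a : 'I_n) : R :=
  \sum_(b < n | (index (b : nat) (top0 n) < index (a : nat) (top0 n))%N) lam b.
Definition left_bot (n : nat) (lam : 'I_n -> R) (a : 'I_n) : R :=
  \sum_(b < n | (index (b : nat) (bot0 n) < index (a : nat) (bot0 n))%N) lam b.

Definition inX (n : nat) (lam : 'I_n -> R) (a : 'I_n) (x : R) : bool :=
  (left_top lam a <= x) && (x < left_top lam a + lam a).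

Definition Xint (n : nat) (lam : 'I_n -> R) (a : 'I_n) : set R :=
  [set x | inX lam a x].

(* T on [0,1) (identity outside [0,1)) *)
Definition iet (n : nat) (lam : 'I_n -> R) (x : R) : R :=
  x + \sum_(a < n) (if inX lam a x then left_bot lam a - left_top lam a else 0).

Definition inv_prob (T : R -> R) (mu : probability R R) : Prop :=
  mu `[(0:R), (1:R)[%classic = 1%E /\
  forall A : set R, measurable A -> mu (T @^-1` A) = mu A.

Definition ergodic (T : R -> R) (mu : probability R R) : Prop :=
  forall A : set R, measurable A -> T @^-1` A = A -> mu A = 0%E \/ mu A = 1%E.

Definition uniquely_ergodic (T : R -> R) : Prop :=
  exists mu0 : probability R R, inv_prob T mu0 /\
    forall mu : probability R R, inv_prob T mu ->
      forall A : set R, measurable A -> mu A = mu0 A.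

End Rauzy.

(* Main.v *)
(** A finite invariant measure [mu] of the exchange is encoded by its distribution
    function [F x = mu [0, x)], which moves rigidly along the exchanged intervals.
    Rauzy induction restricts [F] to the induced interval and acts on its vector of
    interval masses by the elementary step matrices.  Conversely [F] is recovered from
    the induced interval by copying its increments over the loser's interval onto the
    piece that was cut off, an operation that does not increase sup-distances between
    functions with the same interval masses.  The total mass of the induced interval
    tends to 0, so a vector lying in all the cones [Theta_1 ... Theta_m R_+^n] comes
    from exactly one invariant measure.

    Since [c_k / a_k = 1 / p], we have [Theta_k / a_k = M + N / a_k] with [M], [N] fixed
    and [1 / a_k] summable.  [M] fixes the directions [e_j + (e_1 + e_n) / (p - 1)] for
    [j = 3, 5, ..., n-1] and contracts [e_1 + e_n] by [1 / p]; so the columns [j] in [S]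
    of the normalised products, rescaled by [p^m] when [j = n], increase to a limit, and
    this limit has the direction [L_j].  Writing [L_j = Theta_1 ... Theta_m v], the part
    of the mass carried by the columns other than [j] tends to 0.  An invariant set [D]
    gives an invariant measure [mu_j (. \cap D) <= mu_j], which is therefore asymptotically
    carried by the column [j] as well: its mass vector is [mu_j D] times [L_j], whence
    [mu_j (. \cap D) = mu_j D * mu_j], and evaluating at [D] gives ergodicity.  The same
    concentration shows that the [L_j] are distinct. *)

Require Import Defs.
From HB Require Import structures.
From mathcomp Require Import all_boot all_order all_algebra.
From mathcomp Require Import all_classical all_reals all_analysis.
From mathcomp Require Import measurable_realfun.
From mathcomp Require Import ring lra zify.
Import numFieldNormedType.Exports.
Import Order.TTheory GRing.Theory Num.Theory.
Set Implicit Arguments. Unset Strict Implicit. Unset Printing Implicit Defensive.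
Local Open Scope classical_set_scope.
Local Open Scope ring_scope.

(** * Row positions under a Rauzy move *)

(** At a finite stage only interval masses are known, so the function placed on the induced interval
    is a linear interpolation, which need not be invariant. The construction carries an error that
    lifting leaves unchanged and that is at most twice the remaining mass; invariance becomes exact
    only in the limit. That mass tends to 0 because every column of [Theta_k] dominates the first
    one, [e_1 + e_n], so the least column sum of the products at least doubles at each step.

    Concentration on column [j] is a bound on products, column sum [k] times coordinate [k] of the
    vector, and in general neither factor is small alone: for a middle seed the coordinates at the
    labels 1 and n stay bounded while their columns are smaller by [p^-m], and at the other middle
    labels the columns are large while the coordinates decay. The condition [p >= n + 1] makes [p]
    exceed the number of pairs plus 2, so the perturbation of one step is at most
    [p / a_k = 1 / c_k], which decays like [p^(-2k)]. The numerical constants are not sharp; they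
    only have to reproduce themselves under one step. *)

Section Combinatorics.
Variable R : realType.
Implicit Types (q r : seq nat) (f l v : nat -> R).

Definition pos q f k : R := \sum_(b <- take (index k q) q) f b.
Definition tot q f : R := \sum_(b <- q) f b.

Lemma pos_cat q1 q2 f k : k \notin q1 -> pos (q1 ++ k :: q2) f k = tot q1 f.
Proof.
move=> kq1; rewrite /pos /tot index_cat (negbTE kq1) /= eqxx addn0.
by rewrite take_size_cat.
Qed.

Lemma posP q k : k \in q -> exists q1 q2, [/\ q = q1 ++ k :: q2, k \notin q1 &
  forall f, pos q f k = tot q1 f].
Proof.
move=> kq; exists (take (index k q) q), (drop (index k q).+1 q).
have ki : (index k q < size q)%N by rewrite index_mem.
split=> //; first by rewrite -[in X in _ ++ X :: _](nth_index 0%N kq) -drop_nth // cat_take_drop.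
by rewrite in_take // ltnn.
Qed.

Lemma tot_cat q1 q2 f : tot (q1 ++ q2) f = tot q1 f + tot q2 f.
Proof. exact: big_cat. Qed.

Lemma tot_cons k q f : tot (k :: q) f = f k + tot q f.
Proof. exact: big_cons. Qed.

Lemma tot_rcons k q f : tot (rcons q k) f = tot q f + f k.
Proof. by rewrite -cats1 tot_cat tot_cons /tot big_nil addr0. Qed.

Lemma tot_upd_notin q f w x : w \notin q -> tot q (upd f w x) = tot q f.
Proof.
move=> wq; apply: eq_big_seq => k kq; rewrite /upd.
by case: eqP => // kw; rewrite kw (negbTE wq) in kq.
Qed.

Lemma upd_same f w x : upd f w x w = x. Proof. by rewrite /upd eqxx. Qed.

Lemma upd_other f w x k : k != w -> upd f w x k = f k.
Proof. by rewrite /upd => /negbTE ->. Qed.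

Lemma tot_ge0 q f : {in q, forall k, 0 <= f k} -> 0 <= tot q f.
Proof. by move=> f0; rewrite /tot big_seq; apply: sumr_ge0. Qed.

Lemma tot_perm q r f : perm_eq q r -> tot q f = tot r f.
Proof. exact: perm_big. Qed.

Lemma eq_tot q f g : {in q, f =1 g} -> tot q f = tot q g.
Proof. by move=> fg; apply: eq_big_seq. Qed.

Lemma eq_pos q f g k : {in q, f =1 g} -> pos q f k = pos q g k.
Proof. by move=> fg; apply: eq_big_seq => b /mem_take; exact: fg. Qed.

Lemma pos_ge0 q f k : {in q, forall i, 0 <= f i} -> 0 <= pos q f k.
Proof. by move=> f0; apply: tot_ge0 => i /mem_take; exact: f0. Qed.

Lemma posD_le_tot q f k : k \in q -> {in q, forall i, 0 <= f i} ->
  pos q f k + f k <= tot q f.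
Proof.
move=> /posP[q1 [q2 [qE _ ->]]] f0; rewrite qE tot_cat tot_cons addrA lerDl.
by apply: tot_ge0 => i iq; apply: f0; rewrite qE mem_cat inE iq !orbT.
Qed.

Lemma pos_le_tot q f k : k \in q -> {in q, forall i, 0 <= f i} -> pos q f k <= tot q f.
Proof.
by move=> kq f0; apply: le_trans (posD_le_tot kq f0); rewrite lerDl f0.
Qed.

(* In a Rauzy step [r] is the row ending with the winner [w], [q] the row ending
   with the loser [z], and [q'] is [q] after the move. *)
Record rauzy_move r q q' (w z : nat) : Prop := RauzyMove {
  move_ex : exists r0 A C, [/\ r = rcons r0 w, q = A ++ w :: rcons C z
    & q' = A ++ w :: z :: C];
  move_uniq : uniq r;
  move_perm : perm_eq r q }.

Definition vstep f w z := upd f w (f w - f z).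

Section Move.
Variables (r q q' : seq nat) (w z : nat).
Hypothesis H : rauzy_move r q q' w z.

Lemma move_perm' : perm_eq r q'.
Proof.
have [r0 [A [C [_ qE q'E]]]] := move_ex H.
rewrite (perm_trans (move_perm H)) // qE q'E perm_cat2l perm_cons.
by rewrite perm_rcons.
Qed.

Lemma move_uniqq : uniq q. Proof. by rewrite -(perm_uniq (move_perm H)); exact: move_uniq H. Qed.
Lemma move_memq : q =i r. Proof. by move=> k; rewrite (perm_mem (move_perm H)). Qed.
Lemma move_memq' : q' =i r. Proof. by move=> k; rewrite (perm_mem move_perm'). Qed.

Lemma move_w : w \in r.
Proof. by have [r0 [A [C [-> _ _]]]] := move_ex H; rewrite mem_rcons mem_head. Qed.

Lemma move_z : z \in r.
Proof.
rewrite -move_memq; have [r0 [A [C [_ -> _]]]] := move_ex H.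
by rewrite mem_cat inE mem_rcons mem_head !orbT.
Qed.

Lemma move_neq : z != w.
Proof.
have := move_uniqq; have [r0 [A [C [_ -> _]]]] := move_ex H.
rewrite cat_uniq /= mem_rcons inE => /and4P[_ _]; rewrite negb_or eq_sym.
by case/andP.
Qed.

(** Only the last entry of [r] changes its value, and no partial sum taken strictly before an entry
    of [r] involves it. *)
Lemma pos_winner_row f k : k \in r -> pos r (vstep f w z) k = pos r f k.
Proof.
have := move_uniq H; have [r0 [A [C [-> _ _]]]] := move_ex H.
rewrite rcons_uniq mem_rcons inE => /andP[wr0 ur0] kr.
have [kr0|kr0] := boolP (k \in r0).
  have [r1 [r2 [rE kr1 _]]] := posP kr0.
  have wr1 : w \notin r1 by apply: contra wr0 => wr1; rewrite rE mem_cat wr1.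
  by rewrite rE rcons_cat !pos_cat // tot_upd_notin.
by move: kr; rewrite (negbTE kr0) orbF => /eqP->; rewrite -cats1 !pos_cat // tot_upd_notin.
Qed.

Lemma pos_winner f : pos r f w = tot r f - f w.
Proof.
have := move_uniq H; have [r0 [A [C [-> _ _]]]] := move_ex H.
rewrite rcons_uniq => /andP[wr0 _]; rewrite -cats1 pos_cat // cats1 tot_rcons; ring.
Qed.

Lemma pos_loser f : pos q f z = tot r f - f z.
Proof.
rewrite (tot_perm f (move_perm H)).
have := move_uniqq; have [r0 [A [C [_ -> _]]]] := move_ex H.
rewrite -rcons_cons -rcons_cat rcons_uniq => /andP[wr0 _].
by rewrite -cats1 pos_cat // cats1 tot_rcons; ring.
Qed.

Lemma tot_vstep f : tot r (vstep f w z) = tot r f - f z.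
Proof.
have := move_uniq H; have [r0 [A [C [-> _ _]]]] := move_ex H.
rewrite rcons_uniq => /andP[wr0 _]; rewrite /vstep !tot_rcons tot_upd_notin // upd_same; ring.
Qed.

Lemma move_split : exists A C, [/\ q = A ++ w :: rcons C z, q' = A ++ w :: z :: C,
  w \notin A, z \notin A & w \notin C /\ {in C, forall k, k \notin A}].
Proof.
have := move_uniqq; have [r0 [A [C [_ -> ->]]]] := move_ex H.
rewrite cat_uniq cons_uniq mem_rcons => /and3P[uA /hasPn hA /andP[wC _]].
exists A, C; split=> //.
- by apply: hA; rewrite mem_head.
- by apply: hA; rewrite inE mem_rcons mem_head orbT.
split=> [|k kC]; last by apply: hA; rewrite inE mem_rcons inE kC !orbT.
by apply: contra wC => wC; rewrite inE wC orbT.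
Qed.

(** To the right of [w], the inserted [z] adds exactly the length [f z] that [w] gives up, so all
    other entries keep their left endpoints. *)
Lemma pos_loser_row f k : k \in r -> k != z -> pos q' (vstep f w z) k = pos q f k.
Proof.
rewrite -move_memq => + kz; have [A [C [-> -> wA zA [wC CA]]]] := move_split.
rewrite mem_cat inE mem_rcons inE (negbTE kz) /= => /or3P[kA|/eqP->|kC].
- have [A1 [A2 [AE kA1 _]]] := posP kA; rewrite AE -!catA !cat_cons !pos_cat //.
  by apply: tot_upd_notin; apply: contra wA => wA1; rewrite AE mem_cat wA1.
- by rewrite !pos_cat // tot_upd_notin.
- have kA := CA _ kC; have kw : k != w by apply: contraNneq wC => <-.
  have [C1 [C2 [CE kC1 _]]] := posP kC.
  have wC1 : w \notin C1 by apply: contra wC => wC1; rewrite CE mem_cat wC1.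
  have -> : A ++ [:: w, z & C] = (A ++ [:: w, z & C1]) ++ k :: C2.
    by rewrite CE -catA.
  have -> : A ++ w :: rcons C z = (A ++ w :: C1) ++ k :: rcons C2 z.
    by rewrite CE rcons_cat -catA.
  rewrite !pos_cat ?mem_cat ?inE ?negb_or ?kA ?kw ?kz ?kC1 //.
  have zw := move_neq.
  rewrite /vstep !tot_cat !tot_cons !tot_upd_notin // upd_same upd_other //; ring.
Qed.

Lemma pos_loser_new f : pos q' (vstep f w z) z = pos q f w + vstep f w z w.
Proof.
have zw := move_neq; have [A [C [-> -> wA zA _]]] := move_split.
rewrite pos_cat // -cat_rcons pos_cat ?mem_rcons ?inE ?negb_or ?zw //.
by rewrite tot_rcons tot_upd_notin.
Qed.

End Move.

End Combinatorics.

(** * Distribution functions of invariant measures *)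

Section Functions.
Variable R : realType.
Implicit Types (q r : seq nat) (f l v : nat -> R) (F : R -> R).

(* [F] stands for the distribution function of a measure; the measure is invariant
   under the exchange with top row [r], bottom row [q] and lengths [l]. *)
Definition translation_inv r q l F := {in r, forall k (t : R), 0 <= t <= l k ->
  F (pos r l k + t) - F (pos r l k) = F (pos q l k + t) - F (pos q l k)}.

Definition row_vec r l F k : R := F (pos r l k + l k) - F (pos r l k).

(** Increments are measured from the target partial sums, not from values of [F]: a function
    interpolating [v] on one row need not take the value [pos q v k] at the endpoints of the other
    row. *)
Definition approx_inv r q l F v (e : R) := {in r, forall k (t : R), 0 <= t <= l k ->
  `|F (pos r l k + t) - pos r v k - (F (pos q l k + t) - pos q v k)| <= e}.

Definition interpolates r l F v :=
  [/\ {in r, forall k, F (pos r l k) = pos r v k},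
      {in r, forall k, F (pos r l k + l k) = pos r v k + v k} &
      F (tot r l) = tot r v].

Lemma translation_invC r q l F : r =i q ->
  translation_inv r q l F -> translation_inv q r l F.
Proof. by move=> rq I k kq t tl; rewrite I // rq. Qed.

Lemma approx_invC r q l F v e : r =i q ->
  approx_inv r q l F v e -> approx_inv q r l F v e.
Proof. by move=> rq I k kq t tl; rewrite distrC I // rq. Qed.

Lemma row_vecC r q l F : {in r, forall k, 0 <= l k} -> translation_inv r q l F ->
  {in r, row_vec r l F =1 row_vec q l F}.
Proof. by move=> l0 I k kr; rewrite /row_vec I // l0 // lexx. Qed.

Lemma tot_row_vec r l F A C : r = A ++ C -> uniq r ->
  tot A (row_vec r l F) = F (tot A l) - F 0.
Proof.
elim/last_ind: A C => [|A k IH] C rE ur; first by rewrite /tot !big_nil subrr.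
move: rE; rewrite cat_rcons => rE; rewrite !tot_rcons (IH _ rE ur) /row_vec.
have kA : k \notin A.
  by move: ur; rewrite rE cat_uniq => /and3P[_ /hasPn hA _]; apply: hA; rewrite mem_head.
by rewrite [in pos _ _ _]rE pos_cat //; ring.
Qed.

Lemma pos_row_vec r l F k : uniq r -> k \in r ->
  pos r (row_vec r l F) k = F (pos r l k) - F 0.
Proof. by move=> ur kr; have [A [C [rE _ pE]]] := @posP R _ _ kr; rewrite !pE (tot_row_vec l F rE). Qed.

Lemma exact_row_vec r l F : uniq r -> F 0 = 0 -> interpolates r l F (row_vec r l F).
Proof.
move=> ur F0; have pE k : k \in r -> F (pos r l k) = pos r (row_vec r l F) k.
  by move=> kr; rewrite pos_row_vec // F0 subr0.
split=> // [k kr|]; first by rewrite -pE // /row_vec; ring.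
by rewrite (@tot_row_vec _ _ _ _ [::]) ?cats0 // F0 subr0.
Qed.

Lemma tot_row_vecE r l F : uniq r -> F 0 = 0 -> tot r (row_vec r l F) = F (tot r l).
Proof. by move=> ur F0; have [_ _ ->] := exact_row_vec l ur F0. Qed.

Lemma sub_eq3 (a b c d x y : R) : a - x = c - y -> b - x = d - y -> a - b = c - d.
Proof. by move=> h1 h2; rewrite -[a](subrK x) h1 -[b](subrK x) h2; ring. Qed.

(** * One Rauzy move acting on distribution functions *)

Section Descent.
Variables (r q q' : seq nat) (w z : nat) (l : nat -> R).
Hypothesis H : rauzy_move r q q' w z.
Hypothesis l0 : {in r, forall k, 0 < l k}.
Hypothesis lzw : l z < l w.
Let l' := vstep l w z.

Let wr : w \in r := move_w H.
Let zr : z \in r := move_z H.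
Let zw : z != w := move_neq H.

Lemma vstep_w f : vstep f w z w = f w - f z. Proof. by rewrite /vstep upd_same. Qed.
Lemma vstep_z f : vstep f w z z = f z. Proof. by rewrite /vstep upd_other. Qed.
Lemma vstep_o f k : k != w -> vstep f w z k = f k.
Proof. by move=> kw; rewrite /vstep upd_other. Qed.

Lemma vstep_gt0 : {in r, forall k, 0 < l' k}.
Proof.
move=> k kr; rewrite /l'; have [->|kw] := eqVneq k w; first by rewrite vstep_w subr_gt0.
by rewrite vstep_o ?l0.
Qed.

(** Only the loser's translation changes. Its interval in row [q] is the final stretch of the whole
    interval, which in row [r] is the right end of the winner; composing with the winner's
    translation gives the new one. *)
Lemma translation_inv_step F : translation_inv r q l F -> translation_inv r q' l' F.
Proof.
move=> I k kr t /andP[t0 tl]; rewrite (pos_winner_row H) //.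
have [kz|kz] := eqVneq k z; last first.
  rewrite (pos_loser_row H) //; apply: I => //; rewrite t0 /=; apply: le_trans tl _.
  rewrite /l'; have [->|kw] := eqVneq k w; last by rewrite vstep_o.
  by rewrite vstep_w gerBl ltW // l0.
subst k; rewrite (pos_loser_new H) vstep_w.
move: tl; rewrite /l' vstep_z => tl.
have := I z zr t; rewrite t0 tl => /(_ isT) ->.
rewrite (pos_loser H).
have lz0 : 0 < l z by exact: l0.
have lzw1 := lzw.
have pw := pos_winner H l.
have I1 : 0 <= l w - l z + t <= l w by lra.
have I2 : 0 <= l w - l z <= l w by lra.
have := I w wr _ I1; have := I w wr _ I2; rewrite pw.
have -> : tot r l - l w + (l w - l z + t) = tot r l - l z + t by ring.
have -> : tot r l - l w + (l w - l z) = tot r l - l z by ring.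
have -> : pos q l w + (l w - l z) + t = pos q l w + (l w - l z + t) by ring.
by move=> Ib Ia; exact: sub_eq3 Ia Ib.
Qed.

(** The winner loses the final stretch of row [r]. That stretch is the loser's interval in row [q],
    so by invariance its mass is the loser's. *)
Lemma row_vec_step F : translation_inv r q l F ->
  {in r, row_vec r l' F =1 vstep (row_vec r l F) w z}.
Proof.
move=> I k kr; rewrite /row_vec (pos_winner_row H) //.
have [->|kw] := eqVneq k w; last by rewrite /l' !vstep_o.
rewrite /l' vstep_w [in RHS]vstep_w.
have lz0 : 0 < l z by exact: l0.
have lzw1 := lzw;  have Iz : 0 <= l z <= l z by lra.
have := I z zr _ Iz; rewrite (pos_loser H) (pos_winner H).
have -> : tot r l - l w + (l w - l z) = tot r l - l z by ring.
have -> : tot r l - l z + l z = tot r l by ring.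
have -> : tot r l - l w + l w = tot r l by ring.
by move=> ->; ring.
Qed.

(** An invariant function is determined on the piece cut off by its increments over the loser's
    interval; this identity dictates the formula of [rlift]. *)
Lemma loser_piece F u : translation_inv r q l F -> 0 <= u <= l z ->
  F (tot r l' + u) - F (tot r l') = F (pos r l' z + u) - F (pos r l' z).
Proof.
move=> I ul; rewrite (tot_vstep H) (pos_winner_row H) // -(pos_loser H).
by rewrite I.
Qed.

(* [p] is the left endpoint of the loser in either row after the move, and [P] the
   corresponding partial sum of the target vector. *)
Lemma approx_inv_step F F' v e p P : let v' := vstep v w z in 0 <= e ->
  (p = pos r l' z /\ P = pos r v' z) \/ (p = pos q' l' z /\ P = pos q' v' z) ->
  (forall x, x <= tot r l' -> F x = F' x) ->
  (forall u, 0 <= u <= l z -> F (tot r l' + u) = tot r v' + F' (p + u) - P) ->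
  approx_inv r q' l' F' v' e -> approx_inv r q l F v e.
Proof.
move=> v' e0 pP FF' Fz I k kr t /andP[t0 tl].
have l'0 i : i \in r -> 0 <= l' i by move=> ir; rewrite ltW // vstep_gt0.
have pr i : i \in r -> pos r l' i + l' i <= tot r l' by move=> ir; exact: posD_le_tot.
have pq i : i \in r -> pos q' l' i + l' i <= tot r l'.
  move=> ir; rewrite (tot_perm _ (move_perm' H)); apply: posD_le_tot.
    by rewrite (move_memq' H).
  by move=> j; rewrite (move_memq' H); exact: l'0.
have lz0 : 0 < l z by exact: l0.
have lzw1 := lzw.
have [kz|kz] := eqVneq k z.
  subst k; have prz := pr _ zr; have pqz := pq _ zr.
  have := I z zr t; rewrite {1}/l' vstep_z t0 tl => /(_ isT) Iz.
  rewrite !(pos_winner_row H) // -/v' in Iz prz *.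
  rewrite /l' vstep_z -/l' in prz pqz.
  rewrite (FF' (pos r l z + t)); last by lra.
  rewrite !(pos_loser H) -!(tot_vstep H) -/l' -/v' Fz ?t0 ?tl //.
  move: pP; rewrite !(pos_winner_row H) // => -[[-> ->]|[-> ->]].
    have -> : forall a b c : R, a - b - (c + a - b - c) = 0 by move=> *; ring.
    by rewrite normr0.
  by move: Iz; rewrite (_ : forall a b c d x : R, a - b - (x + c - d - x) = a - b - (c - d)) //
    => *; ring.
have plr : pos q' l' k = pos q l k by exact: (pos_loser_row H).
have plv : pos q' v' k = pos q v k by exact: (pos_loser_row H).
have ppr : pos r l' k = pos r l k by exact: (pos_winner_row H).
have ppv : pos r v' k = pos r v k by exact: (pos_winner_row H).
have [tl'|tl'] := leP t (l' k).
  have prk := pr _ kr; have pqk := pq _ kr.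
  have := I k kr t; rewrite t0 tl' plr plv ppr ppv => /(_ isT).
  by rewrite !FF' //; lra.
(* Only the winner was shortened, so [t >= l' k] with [t <= l k] forces [k = w], and the point lies
   in the piece that was cut off. *)
have kw : k = w.
  by apply/eqP; apply: contraTT tl => kw; rewrite -ltNge -(vstep_o _ kw).
subst k; have l'w : l' w = l w - l z by rewrite /l' vstep_w.
have v'w : v' w = v w - v z by rewrite /v' vstep_w.
have pnew : pos q' l' z = pos q l w + (l w - l z) by rewrite (pos_loser_new H) vstep_w.
have pnewv : pos q' v' z = pos q v w + (v w - v z) by rewrite (pos_loser_new H) vstep_w.
pose u := t - (l w - l z).
have ul : 0 <= u <= l z by rewrite /u; lra.
have -> : pos r l w + t = tot r l' + u.
  by rewrite (pos_winner H) (tot_vstep H) /u; ring.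
have -> : pos q l w + t = pos q' l' z + u by rewrite pnew /u; ring.
have tv' : tot r v' = tot r v - v z by exact: (tot_vstep H).
have pqz := pq _ zr; rewrite {2}/l' vstep_z in pqz.
rewrite Fz // FF'; last by lra.
rewrite (pos_winner H) tv'.
move: pP => -[[-> ->]|[-> ->]]; last first.
  rewrite pnewv.
  set X := (X in `|X|); have -> : X = 0 by rewrite /X; ring.
  by rewrite normr0.
have := I z zr u; rewrite {1}/l' vstep_z ul => /(_ isT).
by apply: le_trans; rewrite le_eqVlt; apply/orP; left; apply/eqP; congr (`|_|); rewrite pnewv; ring.
Qed.

(** Interpolation is tracked on the top row. That row is the winner's for a type 0 move and the
    loser's for a type 1 move, hence this lemma and [exact_step_loser]. *)
Lemma exact_step_winner F F' v : let v' := vstep v w z in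
  (forall x, x <= tot r l' -> F x = F' x) ->
  (forall u, 0 <= u <= l z -> F (tot r l' + u) = tot r v' + F' (pos r l' z + u) - pos r v' z) ->
  interpolates r l' F' v' -> interpolates r l F v.
Proof.
move=> v' FF' Fz [E1 E2 E3].
have l'0 i : i \in r -> 0 <= l' i by move=> ir; rewrite ltW // vstep_gt0.
have pr i : i \in r -> pos r l' i + l' i <= tot r l' by move=> ir; exact: posD_le_tot.
have lz0 : 0 < l z by exact: l0.
have lzw1 := lzw.
have FL : F (tot r l) = tot r v.
  have -> : tot r l = tot r l' + l z by rewrite (tot_vstep H); ring.
  rewrite Fz ?lexx ?ltW //; have := E2 _ zr; rewrite {2}/l' vstep_z => ->.
  by rewrite (tot_vstep H) /v' vstep_z; ring.
split=> // k kr; rewrite -(pos_winner_row H l kr) -(pos_winner_row H v kr) -/l' -/v'.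
  by rewrite FF' ?E1 // (le_trans _ (pr _ kr)) // lerDl l'0.
have [->|kw] := eqVneq k w.
  rewrite (pos_winner_row H l wr) (pos_winner_row H v wr).
  by rewrite (pos_winner H l) (pos_winner H v) !subrK.
have lk : l k = l' k by rewrite /l' vstep_o.
have vk : v k = v' k by rewrite /v' vstep_o.
by rewrite lk vk FF' ?E2 // pr.
Qed.

Lemma exact_step_loser F F' v : let v' := vstep v w z in
  (forall x, x <= tot r l' -> F x = F' x) ->
  (forall u, 0 <= u <= l z -> F (tot r l' + u) = tot r v' + F' (pos q' l' z + u) - pos q' v' z) ->
  interpolates q' l' F' v' -> interpolates q l F v.
Proof.
move=> v' FF' Fz [E1 E2 E3].
have l'0 i : i \in r -> 0 <= l' i by move=> ir; rewrite ltW // vstep_gt0.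
have pq i : i \in r -> pos q' l' i + l' i <= tot r l'.
  move=> ir; rewrite (tot_perm _ (move_perm' H)); apply: posD_le_tot.
    by rewrite (move_memq' H).
  by move=> j; rewrite (move_memq' H); exact: l'0.
have lz0 : 0 < l z by exact: l0.
have lzw1 := lzw;  have zq : z \in q' by rewrite (move_memq' H).
have FL : F (tot r l) = tot r v.
  have -> : tot r l = tot r l' + l z by rewrite (tot_vstep H); ring.
  rewrite Fz ?lexx ?ltW //; have := E2 _ zq; rewrite {2}/l' vstep_z => ->.
  by rewrite (tot_vstep H) /v' vstep_z; ring.
split=> [k|k|]; last by rewrite -(tot_perm l (move_perm H)) -(tot_perm v (move_perm H)).
  rewrite (move_memq H) => kr; have [->|kz] := eqVneq k z.
    rewrite !(pos_loser H) -(tot_vstep H l) -(tot_vstep H v) FF' // -/v' -/l'.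
    by rewrite (tot_perm l' (move_perm' H)) (tot_perm v' (move_perm' H)).
  rewrite -(pos_loser_row H l kr kz) -(pos_loser_row H v kr kz) -/l' -/v' FF' ?E1 ?(move_memq' H) //.
  by rewrite (le_trans _ (pq _ kr)) // lerDl l'0.
rewrite (move_memq H) => kr; have [->|kz] := eqVneq k z.
  by rewrite !(pos_loser H) !subrK.
have [->|kw] := eqVneq k w.
  (* In the loser's row, the old interval of the winner is the new winner followed by the inserted
     loser, so it ends where the latter ends. *)
  have pn f : pos q f w + f w = pos q' (vstep f w z) z + vstep f w z z.
    by rewrite (pos_loser_new H) vstep_w vstep_z; ring.
  by rewrite !pn FF' ?pq // E2.
rewrite -(pos_loser_row H l kr kz) -(pos_loser_row H v kr kz) -/l' -/v'.
have lk : l k = l' k by rewrite /l' vstep_o.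
have vk : v k = v' k by rewrite /v' vstep_o.
by rewrite lk vk FF' ?pq // E2 ?(move_memq' H).
Qed.

End Descent.

End Functions.

(** * Rauzy paths *)

Section States.
Variable R : realType.
Implicit Types (q r : seq nat) (f l v : nat -> R) (F : R -> R) (s : rstate R).

Definition winner (t : bool) s := last 0%N (if t then rbot s else rtop s).
Definition loser (t : bool) s := last 0%N (if t then rtop s else rbot s).

(** Unlike in [rauzy_step], the type is an argument and no lengths are compared, so the move also
    applies to mass vectors. Whether it is the genuine move is recorded separately by [good]. *)
Definition tstep (t : bool) s : rstate R :=
  let w := winner t s in let z := loser t s in
  RS (if t then ins_after w z (drop_last (rtop s)) else rtop s)
     (if t then rbot s else ins_after w z (drop_last (rbot s)))
     (vstep (rlam s) w z).

Definition run (ts : seq bool) s := foldl (fun s t => tstep t s) s ts.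

Definition with_lam s v := RS (rtop s) (rbot s) v.

(* The same Rauzy path applied to another vector. *)
Definition vrun ts s v := rlam (run ts (with_lam s v)).

Definition wf (n : nat) s := [/\ perm_eq (rtop s) (iota 0 n), perm_eq (rbot s) (iota 0 n)
  & forall k, (k < n)%N -> 0 < rlam s k].

Fixpoint good ts s : Prop := if ts is t :: ts' then
  rlam s (loser t s) < rlam s (winner t s) /\ good ts' (tstep t s) else True.

Lemma run_cat ts1 ts2 s : run (ts1 ++ ts2) s = run ts2 (run ts1 s).
Proof. exact: foldl_cat. Qed.

Lemma run_with_lam ts s v : run ts (with_lam s v) = with_lam (run ts s) (vrun ts s v).
Proof.
rewrite /vrun; elim: ts s v => [|t ts IH] s v //=.
rewrite -[tstep t (with_lam s v)]/(with_lam (tstep t s) (vstep v (winner t s) (loser t s))).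
by rewrite IH.
Qed.

Lemma vrun_cons t ts s v :
  vrun (t :: ts) s v = vrun ts (tstep t s) (vstep v (winner t s) (loser t s)).
Proof. by []. Qed.

Lemma vrun_cat ts1 ts2 s v : vrun (ts1 ++ ts2) s v = vrun ts2 (run ts1 s) (vrun ts1 s v).
Proof. by rewrite /vrun run_cat run_with_lam. Qed.

Lemma rauzy_stepE s : rauzy_step s = let t := ~~ (rlam s (last 0%N (rbot s)) < rlam s (last 0%N (rtop s))) in
  if rlam s (loser t s) < rlam s (winner t s) then Some (t, tstep t s) else None.
Proof.
rewrite /rauzy_step /tstep /winner /loser.
by case h : (rlam s (last 0%N (rbot s)) < rlam s (last 0%N (rtop s))); rewrite /= ?h.
Qed.

Lemma rauzy_types_good ts s : rauzy_types (size ts) s = Some ts -> good ts s.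
Proof.
elim: ts s => //= t ts IH s; rewrite rauzy_stepE /=; case: ifP => // h.
case E: (rauzy_types _ _) => [ts'|] //= -[tE tsE]; move: E h; rewrite tE tsE => E ->.
by split=> //; exact: IH.
Qed.

Lemma good_cat ts1 ts2 s : good (ts1 ++ ts2) s <-> good ts1 s /\ good ts2 (run ts1 s).
Proof.
elim: ts1 s => [|t ts IH] s /=; first by split=> [|[]].
by rewrite IH; split=> [[? []]|[[]]].
Qed.

Lemma drop_last_rcons r k : drop_last (rcons r k) = r.
Proof. by rewrite /drop_last size_rcons /= -cats1 take_size_cat. Qed.

Lemma rauzy_move_ins r q : uniq r -> perm_eq r q -> last 0%N q != last 0%N r -> (0 < size r)%N ->
  rauzy_move r q (ins_after (last 0%N r) (last 0%N q) (drop_last q)) (last 0%N r) (last 0%N q).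
Proof.
move=> ur pq; have uq : uniq q by rewrite -(perm_uniq pq).
case/lastP: r ur pq => [//|r0 w] ur pq + _.
case/lastP: q uq pq => [uq /perm_size|q0 z uq pq]; first by rewrite size_rcons.
rewrite !last_rcons drop_last_rcons => zw.
have wq : w \in q0.
  have := perm_mem pq w; rewrite !mem_rcons !inE eqxx /= => /esym/orP[/eqP wz|//].
  by rewrite wz eqxx in zw.
have [A [C [qE wA _]]] := @posP R _ _ wq.
split=> //; exists r0, A, C; rewrite qE rcons_cat; split=> //.
rewrite /ins_after index_cat (negbTE wA) /= eqxx addn0.
have -> : A ++ w :: C = (A ++ [:: w]) ++ C by rewrite -catA.
have sA : (size A).+1 = size (A ++ [:: w]) by rewrite size_cat addn1.
by rewrite sA take_size_cat // drop_size_cat // -catA.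
Qed.

Section Step.
Variables (n : nat) (t : bool) (s : rstate R).
Hypothesis wfs : wf n s.
Hypothesis lt : rlam s (loser t s) < rlam s (winner t s).

Let w := winner t s.
Let z := loser t s.
Let s' := tstep t s.

Lemma tstep_move : if t then rauzy_move (rbot s) (rtop s) (rtop s') w z
  else rauzy_move (rtop s) (rbot s) (rbot s') w z.
Proof.
have [pt pb _] := wfs; have pbt : perm_eq (rbot s) (rtop s).
  by rewrite (perm_trans pb) // perm_sym.
have zw : z != w by apply/negP => /eqP zw; move: lt; rewrite -/w -/z zw ltxx.
have ut : uniq (rtop s) by rewrite (perm_uniq pt) iota_uniq.
have ub : uniq (rbot s) by rewrite (perm_uniq pb) iota_uniq.
move: zw; rewrite /w /z /s' /tstep /winner /loser; case: t => zw /=.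
  apply: rauzy_move_ins => //; rewrite lt0n; apply: contraNneq zw => /size0nil b0.
  by move: pbt; rewrite b0 => /perm_size/esym/size0nil ->.
apply: rauzy_move_ins => //; rewrite 1?perm_sym // lt0n; apply: contraNneq zw => /size0nil b0.
by move: pbt; rewrite b0 => /perm_size/size0nil ->.
Qed.

Lemma wf_mem_top : rtop s =i [pred k | (k < n)%N].
Proof. by have [pt _ _] := wfs => k; rewrite (perm_mem pt) mem_iota. Qed.

Lemma wf_mem_bot : rbot s =i [pred k | (k < n)%N].
Proof. by have [_ pb _] := wfs => k; rewrite (perm_mem pb) mem_iota. Qed.

Lemma wf_uniq_top : uniq (rtop s).
Proof. by have [pt _ _] := wfs; rewrite (perm_uniq pt) iota_uniq. Qed.

Lemma wf_tstep : wf n s'.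
Proof.
have [pt pb l0] := wfs; have := tstep_move.
have lt0 : {in rtop s, forall k, 0 < rlam s k} by move=> k; rewrite wf_mem_top; exact: l0.
have lb0 : {in rbot s, forall k, 0 < rlam s k} by move=> k; rewrite wf_mem_bot; exact: l0.
case tE: t => H; split.
- by rewrite -(permPr pb) perm_sym (move_perm' H).
- by rewrite /s' /tstep tE.
- move=> k kn; have kr : k \in rbot s by rewrite wf_mem_bot.
  exact: (vstep_gt0 lb0 lt kr).
- by rewrite /s' /tstep tE.
- by rewrite -(permPr pt) perm_sym (move_perm' H).
- move=> k kn; have kr : k \in rtop s by rewrite wf_mem_top.
  exact: (vstep_gt0 lt0 lt kr).
Qed.

End Step.

Definition inv_fun s F := translation_inv (rtop s) (rbot s) (rlam s) F.
Definition fun_vec s F := row_vec (rtop s) (rlam s) F.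

Section StepFun.
Variables (n : nat) (t : bool) (s : rstate R).
Hypothesis wfs : wf n s.
Hypothesis lt : rlam s (loser t s) < rlam s (winner t s).
Let w := winner t s.
Let z := loser t s.
Let s' := tstep t s.

Let hmove : if t then rauzy_move (rbot s) (rtop s) (rtop s') w z
  else rauzy_move (rtop s) (rbot s) (rbot s') w z := tstep_move wfs lt.

Lemma wf_top0 : {in rtop s, forall k, 0 < rlam s k}.
Proof. by have [_ _ l0] := wfs => k; rewrite (wf_mem_top wfs); exact: l0. Qed.

Lemma wf_bot0 : {in rbot s, forall k, 0 < rlam s k}.
Proof. by have [_ _ l0] := wfs => k; rewrite (wf_mem_bot wfs); exact: l0. Qed.

Lemma wf_top_bot : rtop s =i rbot s.
Proof. by move=> k; rewrite (wf_mem_bot wfs) (wf_mem_top wfs). Qed.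

Lemma wf_perm : perm_eq (rtop s) (rbot s).
Proof. by have [pt pb _] := wfs; rewrite (perm_trans pt) // perm_sym. Qed.

Lemma wf_loser : (z < n)%N.
Proof.
have := hmove; case tE : t => H.
  by have := move_z H; rewrite (wf_mem_bot wfs).
by have := move_z H; rewrite (wf_mem_top wfs).
Qed.

Lemma wf_winner : (w < n)%N.
Proof.
have := hmove; case tE : t => H.
  by have := move_w H; rewrite (wf_mem_bot wfs).
by have := move_w H; rewrite (wf_mem_top wfs).
Qed.

Lemma tot_tstep v : tot (rtop s') (vstep v w z) = tot (rtop s) v - v z.
Proof.
have := hmove; case tE : t => H.
  rewrite -(tot_perm _ (move_perm' H)) (tot_vstep H).
  by rewrite (tot_perm _ (move_perm H)).
by rewrite /s' /tstep tE /= (tot_vstep H).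
Qed.

Lemma inv_fun_tstep F : inv_fun s F -> inv_fun s' F.
Proof.
rewrite /inv_fun => I; have := hmove; case tE : t => H.
  have bE : rbot s' = rbot s by rewrite /s' /tstep tE.
  rewrite bE; apply: translation_invC; first by move=> k; rewrite (move_memq' H).
  apply: (translation_inv_step H wf_bot0 lt); apply: translation_invC => //.
  exact: wf_top_bot.
have tE' : rtop s' = rtop s by rewrite /s' /tstep tE.
by rewrite tE'; apply: (translation_inv_step H wf_top0 lt).
Qed.

Lemma fun_vec_tstep F : inv_fun s F -> forall k, (k < n)%N ->
  fun_vec s' F k = vstep (fun_vec s F) w z k.
Proof.
move=> I k kn; have I' := inv_fun_tstep I.
have wfs' : wf n s' by exact: wf_tstep.
have kt : k \in rtop s by rewrite (wf_mem_top wfs).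
have kt' : k \in rtop s' by rewrite (wf_mem_top wfs').
move: I I'; rewrite /inv_fun /fun_vec; have := hmove; case tE : t => H I I'.
  have bE : rbot s' = rbot s by rewrite /s' /tstep tE.
  have le0 : {in rtop s, forall k, 0 <= rlam s k} by move=> j /wf_top0/ltW.
  have le0' : {in rtop s', forall k, 0 <= rlam s' k}.
    have [_ _ l0'] := wfs'.
    by move=> j; rewrite (wf_mem_top wfs') => /l0'/ltW.
  rewrite (row_vecC le0' I') // bE.
  rewrite (row_vec_step H wf_bot0 lt); last first.
  - by rewrite -wf_top_bot.
  - by apply: translation_invC I; exact: wf_top_bot.
  have wt : w \in rtop s by rewrite (wf_mem_top wfs); exact: wf_winner.
  have zt : z \in rtop s by rewrite (wf_mem_top wfs); exact: wf_loser.
  by rewrite /vstep /upd !(row_vecC le0 I).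
have tE' : rtop s' = rtop s by rewrite /s' /tstep tE.
by rewrite tE' (row_vec_step H wf_top0 lt).
Qed.

Lemma fun_loser_piece F u : inv_fun s F -> 0 <= u <= rlam s z ->
  F (tot (rtop s') (rlam s') + u) - F (tot (rtop s') (rlam s'))
  = F (pos (rtop s') (rlam s') z + u) - F (pos (rtop s') (rlam s') z).
Proof.
move=> I ul; have I' := inv_fun_tstep I.
have wfs' : wf n s' by exact: wf_tstep.
have zt' : z \in rtop s' by rewrite (wf_mem_top wfs'); exact: wf_loser.
have := hmove; case tE : t => H.
  have bE : rbot s' = rbot s by rewrite /s' /tstep tE.
  have lE : rlam s' = vstep (rlam s) w z by [].
  rewrite -[in LHS](tot_perm _ (move_perm' H)).
  rewrite I' //; last by rewrite lE (vstep_z H).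
  rewrite bE; apply: (loser_piece H) => //.
  by apply: translation_invC I; exact: wf_top_bot.
have tE' : rtop s' = rtop s by rewrite /s' /tstep tE.
by rewrite tE'; apply: (loser_piece H).
Qed.

(* Increments over the loser's interval are copied onto the piece that was cut off. *)
Definition rlift F (x : R) : R :=
  let L' := tot (rtop s') (rlam s') in let p := pos (rtop s') (rlam s') z in
  F (Num.min x L') + (F (p + Num.min (Num.max (x - L') 0) (rlam s z)) - F p).

Lemma lift_le F x : x <= tot (rtop s') (rlam s') -> rlift F x = F x.
Proof.
move=> xL; rewrite /rlift min_l // max_r ?subr_le0 // min_l ?addr0 ?subrr ?addr0 //.
by rewrite ltW // wf_top0 // (wf_mem_top wfs); exact: wf_loser.
Qed.

Lemma lift_gt F v u : interpolates (rtop s') (rlam s') F v -> 0 <= u <= rlam s z ->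
  rlift F (tot (rtop s') (rlam s') + u)
  = tot (rtop s') v + F (pos (rtop s') (rlam s') z + u) - pos (rtop s') v z.
Proof.
move=> [E1 E2 E3] /andP[u0 ul].
have zt' : z \in rtop s' by rewrite (wf_mem_top (wf_tstep wfs lt)); exact: wf_loser.
rewrite /rlift min_r ?lerDl // E1 // -E3.
by rewrite [_ + u - _]addrAC subrr add0r max_l // min_l // addrA.
Qed.

Lemma lift_approx F v e : 0 <= e -> let v' := vstep v w z in
  interpolates (rtop s') (rlam s') F v' ->
  approx_inv (rtop s') (rbot s') (rlam s') F v' e ->
  approx_inv (rtop s) (rbot s) (rlam s) (rlift F) v e.
Proof.
move=> e0 v' E A; have := hmove; case tE : t => H.
  have bE : rbot s' = rbot s by rewrite /s' /tstep tE.
  apply: approx_invC; first by move=> k; rewrite wf_top_bot.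
  apply: (@approx_inv_step _ _ _ _ _ _ _ H wf_bot0 lt (rlift F) F v e
    (pos (rtop s') (rlam s') z) (pos (rtop s') v' z)) => //.
  - by right.
  - by move=> x; rewrite (tot_perm _ (move_perm' H)); exact: lift_le.
  - by move=> u; rewrite !(tot_perm _ (move_perm' H)); exact: lift_gt.
  - move: A; rewrite bE => A; apply: (approx_invC _ A) => k.
    by rewrite (move_memq' H).
have tE' : rtop s' = rtop s by rewrite /s' /tstep tE.
apply: (@approx_inv_step _ _ _ _ _ _ _ H wf_top0 lt (rlift F) F v e
    (pos (rtop s') (rlam s') z) (pos (rtop s') v' z)) => //.
- by left; rewrite tE'.
- by rewrite -tE'; exact: lift_le.
- by rewrite -tE' => u; exact: lift_gt.
- by rewrite -tE'.
Qed.

Lemma lift_exact F v : interpolates (rtop s') (rlam s') F (vstep v w z) ->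
  interpolates (rtop s) (rlam s) (rlift F) v.
Proof.
move=> E; have := hmove; case tE : t => H.
  apply: (exact_step_loser H wf_bot0 lt (F' := F)) => //.
  - by move=> x; rewrite (tot_perm _ (move_perm' H)); exact: lift_le.
  - by move=> u; rewrite !(tot_perm _ (move_perm' H)); exact: (lift_gt E).
have tE' : rtop s' = rtop s by rewrite /s' /tstep tE.
apply: (exact_step_winner H wf_top0 lt (F' := F)); rewrite -tE' //.
- exact: lift_le.
- by move=> u; exact: (lift_gt E).
Qed.

End StepFun.

End States.

(** * Piecewise linear interpolation and lifting along finite paths *)

Section Existence.
Variable R : realType.
Implicit Types (q r : seq nat) (f l v : nat -> R) (F : R -> R) (s : rstate R).

Definition mono_lip (K : R) F := forall x y : R, x <= y -> 0 <= F y - F x <= K * (y - x).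

(** Each entry contributes a clamped ramp of height [v k], which makes the function total on [R]:
    for positive lengths it is 0 on the negatives and constant past the end of the row. *)
Definition interp l v : seq nat -> R -> R :=
  fix interp q x := if q is k :: q' then
    v k * (Num.min (Num.max x 0) (l k) / l k) + interp q' (x - l k) else 0.

Lemma clamp_lip (c x y : R) : 0 <= c -> x <= y ->
  0 <= Num.min (Num.max y 0) c - Num.min (Num.max x 0) c <= y - x.
Proof.
move=> c0 xy.
case: (leP x 0) => x0; case: (leP y 0) => y0;
  case: (leP x c) => h1; case: (leP y c) => h2; case: (leP 0 c) => h3; lra.
Qed.

Lemma interp_le0 l v q x : {in q, forall k, 0 < l k} -> x <= 0 -> interp l v q x = 0.
Proof.
elim: q x => //= k q IH x l0 x0.
have lk0 : 0 < l k by apply: l0; rewrite mem_head.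
rewrite max_r // min_l ?ltW // mul0r mulr0 add0r IH //; last by lra.
by move=> j jq; apply: l0; rewrite inE jq orbT.
Qed.

Lemma interp_ge l v q x : {in q, forall k, 0 < l k} -> tot q l <= x -> interp l v q x = tot q v.
Proof.
elim: q x => [|k q IH] x l0 /=; first by move=> _; rewrite /tot big_nil.
have lk0 : 0 < l k by apply: l0; rewrite mem_head.
have lq0 : {in q, forall k, 0 < l k} by move=> j jq; apply: l0; rewrite inE jq orbT.
have tq0 : 0 <= tot q l by apply: tot_ge0 => j /lq0/ltW.
rewrite !tot_cons => tx; rewrite IH //; last by lra.
by rewrite max_l ?min_r ?divff ?mulr1 ?gt_eqF //; lra.
Qed.

Lemma interp_cat l v q1 q2 x : {in q1, forall k, 0 < l k} -> {in q2, forall k, 0 < l k} -> 0 <= x ->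
  interp l v (q1 ++ q2) (tot q1 l + x) = tot q1 v + interp l v q2 x.
Proof.
elim: q1 x => [|k q IH] x l0 l2 x0 /=; first by rewrite /tot !big_nil !add0r.
have lk0 : 0 < l k by apply: l0; rewrite mem_head.
have lq0 : {in q, forall k, 0 < l k} by move=> j jq; apply: l0; rewrite inE jq orbT.
have tq0 : 0 <= tot q l by apply: tot_ge0 => j /lq0/ltW.
rewrite !tot_cons (_ : _ - l k = tot q l + x); last by ring.
rewrite IH // max_l; last by lra.
rewrite min_r ?divff ?mulr1 ?gt_eqF ?addrA //; lra.
Qed.

Lemma interp_exact l v q : {in q, forall k, 0 < l k} -> interpolates q l (interp l v q) v.
Proof.
move=> l0; split; last by rewrite interp_ge.
  move=> k /(@posP R)[A [C [qE kA pE]]]; rewrite !pE qE -[tot A l]addr0 interp_cat //.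
  - by rewrite interp_le0 ?addr0 // => j jC; apply: l0; rewrite qE mem_cat jC orbT.
  - by move=> j jC; apply: l0; rewrite qE mem_cat jC.
  - by move=> j jC; apply: l0; rewrite qE mem_cat jC orbT.
move=> k kq; have lk0 := l0 k kq; have [A [C [qE kA pE]]] := @posP R _ _ kq.
have h1 : {in A, forall k, 0 < l k}.
  by move=> j jC; apply: l0; rewrite qE mem_cat jC.
have h2 : {in k :: C, forall k, 0 < l k}.
  by move=> j jC; apply: l0; rewrite qE mem_cat jC orbT.
have h3 : {in C, forall k, 0 < l k} by move=> j jC; apply: h2; rewrite inE jC orbT.
rewrite !pE qE interp_cat //= ?(ltW lk0) // max_l ?(ltW lk0) // min_l // divff ?gt_eqF // mulr1.
by rewrite subrr interp_le0 // addr0.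
Qed.

Lemma interp_lip l v q : {in q, forall k, 0 < l k} -> {in q, forall k, 0 <= v k} ->
  exists2 K, 0 <= K & mono_lip K (interp l v q).
Proof.
elim: q => [|k q IH] l0 v0; first by exists 0 => // x y _ /=; lra.
have lk0 : 0 < l k by apply: l0; rewrite mem_head.
have vk0 : 0 <= v k by apply: v0; rewrite mem_head.
have [||K K0 HK] := IH.
- by move=> j jq; apply: l0; rewrite inE jq orbT.
- by move=> j jq; apply: v0; rewrite inE jq orbT.
have c0 : 0 <= v k / l k by rewrite divr_ge0 // ltW.
exists (v k / l k + K) => [|x y xy /=]; first exact: addr_ge0.
have /HK/andP[h1 h2] : x - l k <= y - l k by rewrite lerD2r.
have /andP[h3 h4] := clamp_lip (ltW lk0) xy.
set a := Num.min _ _ in h3 h4 *; set b := Num.min _ _ in h3 h4 *.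
have h5 : 0 <= v k / l k * (a - b) by exact: mulr_ge0.
have h6 : v k / l k * (a - b) <= v k / l k * (y - x) by exact: ler_wpM2l.
rewrite !(mulrCA (v k)) -/(v k / l k); set c := v k / l k in h5 h6 *.
set A := interp _ _ _ _ in h1 h2 *; set B := interp _ _ _ _ in h1 h2 *.
have -> : a * c + A - (b * c + B) = c * (a - b) + (A - B) by ring.
apply/andP; split; first exact: addr_ge0.
rewrite mulrDl lerD // (le_trans h2) //.
by rewrite (_ : y - l k - (x - l k) = y - x) //; ring.
Qed.

Section LiftProps.
Variables (n : nat) (t : bool) (s : rstate R).
Hypothesis wfs : wf n s.
Hypothesis lt : rlam s (loser t s) < rlam s (winner t s).
Let z := loser t s.
Let s' := tstep t s.
Let L' := tot (rtop s') (rlam s').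
Let p := pos (rtop s') (rlam s') z.

Lemma lift_lz : 0 <= rlam s z.
Proof. by rewrite ltW // (wf_top0 wfs) // (wf_mem_top wfs); exact: (wf_loser wfs). Qed.

Lemma lift_zin : z \in rtop s'.
Proof. by rewrite (wf_mem_top (wf_tstep wfs lt)); exact: (wf_loser wfs). Qed.

Lemma lift_L0 : 0 <= L'.
Proof. by apply: tot_ge0 => k /(wf_top0 (wf_tstep wfs lt))/ltW. Qed.

(** The constant doubles because an increment of [rlift] is a sum of two increments of [F]. Nothing
    uniform along the path is sought: continuity of the limit function will come from uniform
    convergence. *)
Lemma lift_lip (K : R) F : 0 <= K -> mono_lip K F -> mono_lip (K + K) (rlift t s F).
Proof.
move=> K0 HF x y xy; rewrite /rlift -/s' -/L' -/z -/p.
have lz0 := lift_lz.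
have xyL : x - L' <= y - L' by rewrite lerD2r.
have /andP[h1 h2] := clamp_lip lz0 xyL.
have mxy : Num.min x L' <= Num.min y L' <= Num.min x L' + (y - x).
  by case: (leP x L') => h3; case: (leP y L') => h4; lra.
case/andP: mxy => m1 m2; have /andP[h3 h4] := HF _ _ m1.
set a := Num.min (Num.max (y - L') 0) _ in h1 h2 *; set b := Num.min (Num.max _ _) _ in h1 h2 *.
have /HF/andP[h5 h6] : p + b <= p + a by lra.
have -> (A B C D E : R) : A + (B - C) - (D + (E - C)) = (A - D) + (B - E) by ring.
rewrite addr_ge0 //= mulrDl lerD //.
  by apply: (le_trans h4); rewrite ler_wpM2l //; lra.
by apply: (le_trans h6); rewrite ler_wpM2l //; lra.
Qed.

Lemma lift_le0 F : (forall x, x <= 0 -> F x = 0) -> forall x, x <= 0 -> rlift t s F x = 0.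
Proof.
by move=> F0 x x0; rewrite (lift_le wfs lt) ?F0 // (le_trans x0) //; exact: lift_L0.
Qed.

Lemma lift_close F1 F2 v e : interpolates (rtop s') (rlam s') F1 v -> interpolates (rtop s') (rlam s') F2 v ->
  (forall x, `|F1 x - F2 x| <= e) -> forall x, `|rlift t s F1 x - rlift t s F2 x| <= e.
Proof.
move=> [E1 _ T1] [E2 _ T2] h x; have [xL|Lx] := leP x L'.
  by rewrite !(lift_le wfs lt).
rewrite /rlift -/s' -/L' -/z -/p min_r ?(ltW Lx) // /L' T1 T2 /p E1 ?E2 ?lift_zin //.
have -> (A B C D : R) : A + (B - C) - (A + (D - C)) = B - D by ring.
exact: h.
Qed.

Lemma lift_ge F v : interpolates (rtop s') (rlam s') F (vstep v (winner t s) z) ->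
  forall x, tot (rtop s) (rlam s) <= x -> rlift t s F x = tot (rtop s) v.
Proof.
move=> E x xL; have [_ _ <-] := lift_exact wfs lt E.
have lz0 := lift_lz; have tl := tot_tstep wfs lt (rlam s).
have TL : tot (rtop s) (rlam s) = L' + rlam s z by rewrite /L' tl /z; ring.
have h1 : L' <= x by lra.
have h2 : L' <= tot (rtop s) (rlam s) by lra.
rewrite /rlift -/s' -/L' -/z -/p !(min_r h1) !(min_r h2) !max_l ?subr_ge0 // !min_r //; lra.
Qed.

End LiftProps.

Fixpoint liftS ts s F := if ts is t :: ts' then rlift t s (liftS ts' (tstep t s) F) else F.

Lemma liftS_cat ts1 ts2 s F : liftS (ts1 ++ ts2) s F = liftS ts1 s (liftS ts2 (run ts1 s) F).
Proof. by elim: ts1 s => //= t ts IH s; rewrite IH. Qed.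

Section List.
Variable n : nat.

Lemma wf_run ts s : wf n s -> good ts s -> wf n (run ts s).
Proof. by elim: ts s => //= t ts IH s w [lt g]; apply: IH => //; exact: wf_tstep. Qed.

Lemma liftS_exact ts s F v : wf n s -> good ts s ->
  interpolates (rtop (run ts s)) (rlam (run ts s)) F (vrun ts s v) ->
  interpolates (rtop s) (rlam s) (liftS ts s F) v.
Proof.
elim: ts s v => //= t ts IH s v w [lt g] E.
by apply: (lift_exact w lt); apply: IH => //; exact: wf_tstep.
Qed.

Lemma liftS_approx ts s F v e : wf n s -> good ts s -> 0 <= e ->
  interpolates (rtop (run ts s)) (rlam (run ts s)) F (vrun ts s v) ->
  approx_inv (rtop (run ts s)) (rbot (run ts s)) (rlam (run ts s)) F (vrun ts s v) e ->
  approx_inv (rtop s) (rbot s) (rlam s) (liftS ts s F) v e.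
Proof.
elim: ts s v => //= t ts IH s v w [lt g] e0 E A.
have w' := wf_tstep w lt.
apply: (lift_approx w lt e0); first exact: liftS_exact.
exact: IH.
Qed.

Lemma liftS_close ts s F1 F2 v e : wf n s -> good ts s ->
  interpolates (rtop (run ts s)) (rlam (run ts s)) F1 (vrun ts s v) ->
  interpolates (rtop (run ts s)) (rlam (run ts s)) F2 (vrun ts s v) ->
  (forall x, `|F1 x - F2 x| <= e) -> forall x, `|liftS ts s F1 x - liftS ts s F2 x| <= e.
Proof.
elim: ts s v => //= t ts IH s v w [lt g] E1 E2 h.
have w' := wf_tstep w lt.
apply: (lift_close w lt (v := vstep v (winner t s) (loser t s))); [exact: liftS_exact..|].
exact: (IH _ (vstep v (winner t s) (loser t s))).
Qed.

Lemma liftS_lip ts s F : wf n s -> good ts s -> (exists2 K, 0 <= K & mono_lip K F) ->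
  exists2 K, 0 <= K & mono_lip K (liftS ts s F).
Proof.
elim: ts s => //= t ts IH s w [lt g] /(IH _ (wf_tstep w lt) g)[K K0 HK].
by exists (K + K); [exact: addr_ge0|exact: (lift_lip w)].
Qed.

Lemma liftS_le0 ts s F : wf n s -> good ts s -> (forall x, x <= 0 -> F x = 0) ->
  forall x, x <= 0 -> liftS ts s F x = 0.
Proof.
elim: ts s => //= t ts IH s w [lt g] F0; apply: (lift_le0 w lt).
by apply: IH => //; exact: wf_tstep.
Qed.

Lemma liftS_ge ts s F v : wf n s -> good ts s ->
  interpolates (rtop (run ts s)) (rlam (run ts s)) F (vrun ts s v) ->
  (forall x, tot (rtop (run ts s)) (rlam (run ts s)) <= x -> F x = tot (rtop (run ts s)) (vrun ts s v)) ->
  forall x, tot (rtop s) (rlam s) <= x -> liftS ts s F x = tot (rtop s) v.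
Proof.
case: ts => //= t ts w [lt g] E _; apply: (lift_ge w lt).
by apply: liftS_exact => //; exact: wf_tstep.
Qed.

(** A point of the piece cut off has a copy in the loser's interval where [F1 - F2] takes the same
    value, so a bound on the last induced interval spreads back to the whole. The bound is a
    conditional premise because invariance and equality of masses at the last stage are only
    produced along the induction. *)
Lemma uniq_run ts s F1 F2 e : wf n s -> good ts s -> inv_fun s F1 -> inv_fun s F2 ->
  F1 0 = 0 -> F2 0 = 0 -> (forall k, (k < n)%N -> fun_vec s F1 k = fun_vec s F2 k) ->
  (inv_fun (run ts s) F1 -> inv_fun (run ts s) F2 ->
   (forall k, (k < n)%N -> fun_vec (run ts s) F1 k = fun_vec (run ts s) F2 k) ->
   forall x, 0 <= x <= tot (rtop (run ts s)) (rlam (run ts s)) -> `|F1 x - F2 x| <= e) ->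
  forall x, 0 <= x <= tot (rtop s) (rlam s) -> `|F1 x - F2 x| <= e.
Proof.
elim: ts s => [|t ts IH] s w /=.
  by move=> _ I1 I2 _ _ V /(_ I1 I2 V).
move=> [lt g] I1 I2 Z1 Z2 V C; have w' := wf_tstep w lt.
have I1' := inv_fun_tstep w lt I1; have I2' := inv_fun_tstep w lt I2.
have V' k : (k < n)%N -> fun_vec (tstep t s) F1 k = fun_vec (tstep t s) F2 k.
  move=> kn; rewrite !(fun_vec_tstep w lt) // /vstep /upd.
  by rewrite !V //; [exact: (wf_loser w lt)|exact: (wf_winner w lt)].
have IHs := IH _ w' g I1' I2' Z1 Z2 V' C.
move=> x /andP[x0 xL].
have [xL'|L'x] := leP x (tot (rtop (tstep t s)) (rlam (tstep t s))).
  by apply: IHs; rewrite x0.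
set L' := tot _ _ in L'x IHs; set z := loser t s.
have ul : 0 <= x - L' <= rlam s z.
  have := tot_tstep w lt (rlam s); rewrite -[tot _ _]/L' -/z => TL.
  by apply/andP; split; lra.
have P1 := fun_loser_piece w lt I1 ul; have P2 := fun_loser_piece w lt I2 ul.
have u' := wf_uniq_top w'.
have [E1 _ T1] := exact_row_vec (rlam (tstep t s)) u' Z1.
have [E2 _ T2] := exact_row_vec (rlam (tstep t s)) u' Z2.
have zt : z \in rtop (tstep t s) by rewrite (wf_mem_top w'); exact: (wf_loser w lt).
have VV : {in rtop (tstep t s), row_vec (rtop (tstep t s)) (rlam (tstep t s)) F1 =1
    row_vec (rtop (tstep t s)) (rlam (tstep t s)) F2}.
  by move=> k; rewrite (wf_mem_top w') => kn; exact: V'.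
move: P1 P2; rewrite -[tot _ _]/L' -/z (_ : L' + (x - L') = x); last by ring.
rewrite {2}/L' T1 {2}/L' T2 E1 // E2 // (eq_tot VV) (eq_pos _ VV).
set A := tot _ _; set B := pos _ (row_vec _ _ _) _ => Q1 Q2.
set q := _ + (x - L') in Q1 Q2.
have -> : F1 x - F2 x = F1 q - F2 q.
  by rewrite -[F1 x](subrK A) Q1 -[F2 x](subrK A) Q2; ring.
apply: IHs; rewrite /q; set p := pos _ _ _.
have l'0 : {in rtop (tstep t s), forall k, 0 <= rlam (tstep t s) k}.
  by move=> k /(wf_top0 w')/ltW.
have p0 : 0 <= p by exact: pos_ge0.
have := posD_le_tot zt l'0; rewrite -/p -[tot _ _]/L'.
have -> : rlam (tstep t s) z = rlam s z.
  by apply: upd_other; apply/eqP => zw; move: lt; rewrite -/z zw ltxx.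
by move=> pL; apply/andP; split; lra.
Qed.

End List.

End Existence.

(** * Uniqueness and existence of the invariant function along an infinite path *)

Section InfinitePath.
Variable R : realType.
Implicit Types (v : nat -> R) (F : R -> R).

Lemma fun_vec_run n ts s F v : wf n s -> good ts s -> inv_fun s F ->
  (forall k, (k < n)%N -> fun_vec s F k = v k) ->
  forall k, (k < n)%N -> fun_vec (run ts s) F k = vrun ts s v k.
Proof.
elim: ts s v => [|t ts IH] s v w /=; first by move=> _ _ V k /V.
move=> [lt g] I V k kn; rewrite vrun_cons; apply: (IH _ _ (wf_tstep w lt) g) kn.
  exact: (inv_fun_tstep w lt).
move=> j jn; rewrite (fun_vec_tstep w lt) // /vstep /upd !V //.
  exact: (wf_loser w lt).
exact: (wf_winner w lt).
Qed.

Lemma norm_sub_range (a b c : R) : 0 <= a <= c -> 0 <= b <= c -> `|a - b| <= c.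
Proof. by rewrite ler_norml; lra. Qed.

Lemma le_small_eq0 (x : R) (K : R) : 0 <= K ->
  (forall e : R, 0 < e -> `|x| <= K * e) -> x = 0.
Proof.
move=> K0 h; apply/eqP; rewrite -normr_le0; apply/ler_addgt0Pl => e e0; rewrite addr0.
have k1 : 0 < K + 1 by lra.
have := h (e / (K + 1)) (divr_gt0 e0 k1).
by move/le_trans; apply; rewrite mulrA ler_pdivrMr //; nra.
Qed.

Variables (n : nat) (s : rstate R) (W : nat -> seq bool).
Hypothesis ws : wf n s.
Hypothesis gW : forall m, good (W m) s.

Let sm m := run (W m) s.
Let mass v m := tot (rtop (sm m)) (vrun (W m) s v).

Let wsm m : wf n (sm m) := wf_run ws (gW m).

(** On a late induced interval both functions lie between 0 and its total mass, which is small;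
    [uniq_run] carries this bound back. *)
Lemma inv_fun_unique F1 F2 : {homo F1 : x y / x <= y} -> {homo F2 : x y / x <= y} ->
  inv_fun s F1 -> inv_fun s F2 -> F1 0 = 0 -> F2 0 = 0 ->
  (forall k, (k < n)%N -> fun_vec s F1 k = fun_vec s F2 k) ->
  (forall e : R, 0 < e -> exists m, mass (fun_vec s F1) m <= e) ->
  forall x, 0 <= x <= tot (rtop s) (rlam s) -> F1 x = F2 x.
Proof.
move=> H1 H2 I1 I2 Z1 Z2 V small x xL; apply: subr0_eq.
apply: (@le_small_eq0 _ 1) => // e e0; rewrite mul1r; have [m cm] := small _ e0.
apply: (uniq_run ws (gW m)) xL => // I1' I2' V' y /andP[y0 yL].
have V1 := fun_vec_run ws (gW m) I1 (v := fun_vec s F1) (fun _ _ => erefl).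
have F1L : F1 (tot (rtop (sm m)) (rlam (sm m))) <= e.
  rewrite -tot_row_vecE // ?(wf_uniq_top (wsm m)) //; apply: le_trans cm.
  rewrite le_eqVlt; apply/orP; left; apply/eqP/eq_tot => k.
  by rewrite (wf_mem_top (wsm m)) => kn; rewrite -V1.
have F2L : F2 (tot (rtop (sm m)) (rlam (sm m))) <= e.
  apply: le_trans F1L; rewrite -!tot_row_vecE // ?(wf_uniq_top (wsm m)) //.
  rewrite le_eqVlt; apply/orP; left; apply/eqP/eq_tot => k.
  by rewrite (wf_mem_top (wsm m)) => kn; rewrite -[LHS]V'.
apply: norm_sub_range; apply/andP; split.
- by rewrite -Z1 H1.
- by rewrite (le_trans _ F1L) // H1.
- by rewrite -Z2 H2.
- by rewrite (le_trans _ F2L) // H2.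
Qed.

Hypothesis Wpre : forall m m', (m <= m')%N -> exists B, W m' = W m ++ B.
Variable v : nat -> R.
Hypothesis v0 : forall m k, (k < n)%N -> 0 <= vrun (W m) s v k.
Hypothesis small : forall e : R, 0 < e -> exists m, mass v m <= e.

Let G m := interp (rlam (sm m)) (vrun (W m) s v) (rtop (sm m)).
Let Fm m := liftS (W m) s (G m).

Let v0t m : {in rtop (sm m), forall k, 0 <= vrun (W m) s v k}.
Proof. by move=> k; rewrite (wf_mem_top (wsm m)); exact: v0. Qed.

Let mass0 m : 0 <= mass v m.
Proof. exact: tot_ge0. Qed.

Let G_exact m : interpolates (rtop (sm m)) (rlam (sm m)) (G m) (vrun (W m) s v).
Proof. by apply: interp_exact; exact: wf_top0 (wsm m). Qed.

Let range F m : (exists2 K : R, 0 <= K & mono_lip K F) -> (forall x : R, x <= 0 -> F x = 0) ->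
  (forall x, tot (rtop (sm m)) (rlam (sm m)) <= x -> F x = mass v m) ->
  forall x, 0 <= F x <= mass v m.
Proof.
move=> [K _ HK] F0 F1 x.
have mono a b : a <= b -> F a <= F b by move=> /HK/andP[]; rewrite subr_ge0.
have [x0|/ltW x0] := leP x 0; first by rewrite F0 // lexx mass0.
have [xL|/ltW xL] := leP x (tot (rtop (sm m)) (rlam (sm m))).
  by rewrite -{1}(F0 0) // mono // -(F1 _ (lexx _)) mono.
by rewrite F1 // lexx mass0.
Qed.

(** Both functions are lifts along [W m] of functions with the same interval masses at stage [m] and
    with values in [[0, mass v m]]. *)
Let Fm_close m m' : (m <= m')%N -> forall x, `|Fm m x - Fm m' x| <= mass v m.
Proof.
move=> /Wpre[B WB]; rewrite /Fm WB liftS_cat.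
have gB : good B (sm m) by have := gW m'; rewrite WB good_cat => -[].
have smE : sm m' = run B (sm m) by rewrite /sm WB run_cat.
have vE : vrun (W m') s v = vrun B (sm m) (vrun (W m) s v) by rewrite WB vrun_cat.
have E' := G_exact m'; rewrite smE vE in E'.
have w' := wsm m; have ww := wsm m'.
have lipG i : exists2 K : R, 0 <= K & mono_lip K (G i).
  by apply: interp_lip => //; exact: wf_top0 (wsm i).
have G0 i x : x <= 0 -> G i x = 0.
  by move=> x0; apply: interp_le0 => //; exact: wf_top0 (wsm i).
have G1 i x : tot (rtop (sm i)) (rlam (sm i)) <= x -> G i x = mass v i.
  by move=> x0; apply: interp_ge => //; exact: wf_top0 (wsm i).
apply: (liftS_close ws (gW m) (v := v) (G_exact m)).
  exact: (liftS_exact w' gB).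
move=> x; apply: norm_sub_range; first exact: (@range _ m (lipG m) (G0 m) (G1 m)).
apply: range; first exact: (liftS_lip w' gB (lipG m')).
  exact: (liftS_le0 w' gB (G0 m')).
move=> y; apply: (liftS_ge w' gB E') => z zL.
have := G1 m' z; rewrite smE => /(_ zL) ->.
by rewrite /mass smE vE.
Qed.

Let close m m' x : `|Fm m x - Fm m' x| <= mass v m + mass v m'.
Proof.
have [mm'|/ltnW mm'] := leqP m m'.
  by rewrite (le_trans (Fm_close mm' x)) // lerDl.
by rewrite distrC (le_trans (Fm_close mm' x)) // lerDr.
Qed.

(** A limit written as an infimum: by [close], every [Fm m' x - mass v m'] is a lower bound of this
    set, so the infimum is within [mass v m] of each [Fm m x], with no convergence argument. *)
Let Flim x := inf [set Fm m x + mass v m | m in setT].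

Let Flim_close m x : `|Flim x - Fm m x| <= mass v m.
Proof.
have lb m' : lbound [set Fm m x + mass v m | m in setT] (Fm m' x - mass v m').
  move=> _ [i _ <-]; have := close m' i x; rewrite ler_norml; lra.
have inF : Flim x <= Fm m x + mass v m.
  by apply: ge_inf; [exists (Fm m x - mass v m); exact: lb|exists m].
have Fin : Fm m x - mass v m <= Flim x.
  by apply: lb_le_inf; [exists (Fm m x + mass v m), m|exact: lb].
by rewrite ler_norml; lra.
Qed.

Theorem inv_fun_exists : exists F, [/\ {homo F : x y / x <= y},
  forall e : R, 0 < e -> exists2 d, 0 < d & forall x y : R, x <= y -> y - x <= d -> F y - F x <= e,
  (forall x : R, x <= 0 -> F x = 0), (forall x, tot (rtop s) (rlam s) <= x -> F x = tot (rtop s) v)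
  & inv_fun s F /\ forall k, (k < n)%N -> fun_vec s F k = v k].
Proof.
exists Flim.
have lipF m : exists2 K : R, 0 <= K & mono_lip K (Fm m).
  apply: (liftS_lip ws (gW m)); apply: interp_lip => //; exact: wf_top0 (wsm m).
have eqF (x y K : R) : 0 <= K -> (forall m, `|x - y| <= K * mass v m) -> x = y.
  move=> K0 h; apply: subr0_eq; apply: (le_small_eq0 K0) => e /small[m me].
  by rewrite (le_trans (h m)) // ler_wpM2l.
have E m : interpolates (rtop s) (rlam s) (Fm m) v by exact: (liftS_exact ws (gW m) (G_exact m)).
(* [G m] and the partial sums both take values in [[0, mass v m]], so each of the two differences is
   at most [mass v m] in absolute value. *)
have A m : approx_inv (rtop s) (rbot s) (rlam s) (Fm m) v (2 * mass v m).
  apply: (liftS_approx ws (gW m)); [by rewrite mulr_ge0|exact: (G_exact m)|].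
  have l0 := wf_top0 (wsm m).
  have Gr : forall x, 0 <= G m x <= mass v m.
    apply: range; first exact: interp_lip.
      by move=> x x0; apply: interp_le0.
    by move=> x x0; apply: interp_ge.
  have tb := wf_top_bot (wsm m).
  have vb : {in rbot (sm m), forall k, 0 <= vrun (W m) s v k}.
    by move=> k; rewrite -tb; exact: v0t.
  move=> k kt t _; have kb : k \in rbot (sm m) by rewrite -tb.
  have := Gr (pos (rtop (sm m)) (rlam (sm m)) k + t).
  have := Gr (pos (rbot (sm m)) (rlam (sm m)) k + t).
  have p1 : pos (rtop (sm m)) (vrun (W m) s v) k <= mass v m by exact: pos_le_tot.
  have p2 : pos (rbot (sm m)) (vrun (W m) s v) k <= mass v m.
    by rewrite /mass (tot_perm _ (wf_perm (wsm m))); exact: pos_le_tot.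
  have p3 := pos_ge0 k (@v0t m); have p4 := pos_ge0 k vb.
  move: p1 p2 p3 p4; rewrite ler_norml -/(sm m).
  set a1 := G m _; set a2 := G m _; set a3 := pos _ _ _; set a4 := pos _ _ _.
  by lra.
split.
- move=> x y xy; apply/ler_addgt0Pl => e e0.
  have e2 : 0 < e / 2 by lra.
  have [m me] := small e2; have [K _ HK] := lipF m.
  have /andP[h _] := HK _ _ xy.
  have := Flim_close m x; have := Flim_close m y; rewrite !ler_norml.
  by set a := Flim x; set b := Flim y; lra.
- move=> e e0; have e3 : 0 < e / 3 by lra.
  have [m me] := small e3; have [K K0 HK] := lipF m.
  have K1 : 0 < K + 1 by lra.
  (* Two thirds of [e] pay for replacing the limit by [Fm m] at [x] and at [y], the last third for
     the variation of [Fm m]. Using [K + 1] keeps the divisor positive. *)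
  exists (e / 3 / (K + 1)); first exact: divr_gt0.
  move=> x y xy yx; have /andP[_ h] := HK _ _ xy.
  have h2 : K * (y - x) <= e / 3.
    move: yx; rewrite ler_pdivlMr //; nra.
  have := Flim_close m x; have := Flim_close m y; rewrite !ler_norml.
  by set a := Flim x in h *; set b := Flim y in h *; lra.
- move=> x x0; apply: (eqF _ _ 1) => // m; rewrite mul1r.
  rewrite -[X in _ - X](_ : Fm m x = 0) //; apply: (liftS_le0 ws (gW m)) => //.
  by move=> y y0; apply: interp_le0 => //; exact: wf_top0 (wsm m).
- move=> x xL; apply: (eqF _ _ 1) => // m; rewrite mul1r.
  rewrite -[X in _ - X](_ : Fm m x = _) //; apply: (liftS_ge ws (gW m) (G_exact m)) => //.
  by move=> y y0; apply: interp_ge => //; exact: wf_top0 (wsm m).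
- have Epos k : k \in rtop s -> Flim (pos (rtop s) (rlam s) k) = pos (rtop s) v k.
    move=> kr; apply: (eqF _ _ 1) => // m; rewrite mul1r; have [<- // _ _] := E m.
  have Epos' k : k \in rtop s -> Flim (pos (rtop s) (rlam s) k + rlam s k) = pos (rtop s) v k + v k.
    move=> kr; apply: (eqF _ _ 1) => // m; rewrite mul1r; have [_ <- // _] := E m.
  split; last first.
    move=> k kn; rewrite /fun_vec /row_vec Epos ?Epos' ?(wf_mem_top ws) //; ring.
  have key k t : k \in rtop s -> 0 <= t <= rlam s k ->
     Flim (pos (rtop s) (rlam s) k + t) - pos (rtop s) v k =
     Flim (pos (rbot s) (rlam s) k + t) - pos (rbot s) v k.
    (* The 4 is the constant 2 of [A] plus 1 for each of the two values of [Fm m] replaced by the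
       limit. *)
    move=> kr tl; apply: (eqF _ _ 4) => // m.
    have := A m k kr t tl.
    have := Flim_close m (pos (rtop s) (rlam s) k + t).
    have := Flim_close m (pos (rbot s) (rlam s) k + t).
    rewrite !ler_norml.
    set a1 := Flim _; set a2 := Fm _ _; set a3 := Flim _; set a4 := Fm _ _.
    set a5 := pos _ _ _; set a6 := pos _ _ _.
    by lra.
  move=> k kr t tl; have l0 : 0 <= rlam s k by apply/ltW/(wf_top0 ws).
  have k1 := key _ _ kr tl.
  have k2 : Flim (pos (rtop s) (rlam s) k) - pos (rtop s) v k =
     Flim (pos (rbot s) (rlam s) k) - pos (rbot s) v k.
    by have := key k 0 kr; rewrite !addr0 lexx => ->.
  exact: sub_eq3 k1 k2.
Qed.

End InfinitePath.

(** * Interval exchanges and invariant measures *)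

Section Rows.
Variable R : realType.
Implicit Types (q : seq nat) (l : nat -> R).

Lemma row_split q l (x : R) : 0 <= x < tot q l ->
    exists A k C, q = A ++ k :: C /\ tot A l <= x < tot A l + l k.
Proof.
elim: q x => [|k q IH] x; first by rewrite /tot big_nil; lra.
rewrite tot_cons => /andP[x0 xl]; have [xk|kx] := ltP x (l k).
  by exists [::], k, q; rewrite /tot big_nil add0r x0.
have [|A [j [C [-> h]]]] := IH (x - l k); first by lra.
by exists (k :: A), j, C; split=> //; rewrite tot_cons; lra.
Qed.

Lemma row_cover q l (x : R) : uniq q -> 0 <= x < tot q l ->
  exists2 k, k \in q & pos q l k <= x < pos q l k + l k.
Proof.
move=> uq /row_split[A [k [C [qE h]]]]; exists k.
  by rewrite qE mem_cat mem_head orbT.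
rewrite {1 2}qE pos_cat //; move: uq; rewrite qE cat_uniq => /and3P[_ /hasPn hA _].
by apply: hA; rewrite mem_head.
Qed.

Lemma row_sep q l k j : uniq q -> {in q, forall i, 0 < l i} -> k \in q -> j \in q -> k != j ->
  pos q l k + l k <= pos q l j \/ pos q l j + l j <= pos q l k.
Proof.
move=> uq l0 kq jq kj; have [A [C [qE kA pE]]] := @posP R _ _ kq.
have [jA|jA] := boolP (j \in A).
  right; have [A1 [A2 [AE jA1 _]]] := @posP R _ _ jA.
  rewrite pE AE tot_cat tot_cons qE AE -!catA cat_cons pos_cat //.
  rewrite addrA lerDl; apply: tot_ge0 => i iA; apply/ltW/l0.
  by rewrite qE AE !mem_cat inE iA !orbT.
left; have jC : j \in C.
  by move: jq; rewrite qE mem_cat inE (negbTE jA) eq_sym (negbTE kj).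
have [C1 [C2 [CE jC1 _]]] := @posP R _ _ jC.
have -> : pos q l j = tot (A ++ k :: C1) l.
  rewrite qE CE -cat_cons catA pos_cat // mem_cat inE negb_or jA negb_or eq_sym kj.
  exact: jC1.
rewrite pE tot_cat tot_cons addrA lerDl; apply: tot_ge0 => i iC; apply/ltW/l0.
by rewrite qE CE mem_cat inE mem_cat iC !orbT.
Qed.

Lemma row_disj q l k j (x : R) : uniq q -> {in q, forall i, 0 < l i} -> k \in q -> j \in q ->
  pos q l k <= x < pos q l k + l k -> pos q l j <= x < pos q l j + l j -> k = j.
Proof.
move=> uq l0 kq jq hk hj; apply/eqP; apply/negPn/negP => kj.
by have [] := row_sep uq l0 kq jq kj; lra.
Qed.

End Rows.

Section IET.
Variables (R : realType) (n : nat) (lam : 'I_n -> R).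
Local Notation s := (init_state lam).
Local Notation l := (rlam (init_state lam)).
Hypothesis ws : wf n s.
Hypothesis lam1 : \sum_i lam i = 1.

Lemma init_lam (i : 'I_n) : l i = lam i.
Proof. by rewrite /= valK. Qed.

Lemma tot_init q : perm_eq q (iota 0 n) -> tot q l = 1.
Proof.
move=> qn; rewrite (tot_perm _ qn) -lam1 /tot.
rewrite (_ : iota 0 n = index_iota 0 n) ?big_mkord; last by rewrite /index_iota subn0.
by apply: eq_bigr => i _; exact: init_lam.
Qed.

Lemma sum_index q (a : 'I_n) : perm_eq q (iota 0 n) ->
  \sum_(b < n | (index (b : nat) q < index (a : nat) q)%N) lam b = pos q l a.
Proof.
move=> qn; have uq : uniq q by rewrite (perm_uniq qn) iota_uniq.
rewrite /pos; set i := index (a : nat) q.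
have p : perm_eq (take i q) [seq k <- iota 0 n | (index k q < i)%N].
  apply: uniq_perm; [exact: take_uniq|by rewrite filter_uniq ?iota_uniq|].
  move=> k; rewrite mem_filter -(perm_mem qn); have [kq|kq] := boolP (k \in q).
    by rewrite in_take // andbT.
  by rewrite andbF; apply/negP => /mem_take; rewrite (negbTE kq).
rewrite (perm_big _ p) big_filter /=.
rewrite (_ : iota 0 n = index_iota 0 n) ?big_mkord; last by rewrite /index_iota subn0.
by apply: eq_bigr => j _; exact/esym/init_lam.
Qed.

Lemma left_topE a : left_top lam a = pos (rtop s) l a.
Proof. by have [pt _ _] := ws; exact: sum_index. Qed.

Lemma left_botE a : left_bot lam a = pos (rbot s) l a.
Proof. by have [_ pb _] := ws; exact: sum_index. Qed.

Local Notation pt a := (pos (rtop s) l (nat_of_ord a)).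
Local Notation pb a := (pos (rbot s) l (nat_of_ord a)).

Let l0t : {in rtop s, forall k, 0 < l k} := wf_top0 ws.
Let l0b : {in rbot s, forall k, 0 < l k} := wf_bot0 ws.
Let ut : uniq (rtop s) := wf_uniq_top ws.
Let ub : uniq (rbot s). Proof. by rewrite -(perm_uniq (wf_perm ws)). Qed.
Let int (a : 'I_n) : (a : nat) \in rtop s. Proof. by rewrite (wf_mem_top ws) inE. Qed.
Let inb (a : 'I_n) : (a : nat) \in rbot s. Proof. by rewrite (wf_mem_bot ws) inE. Qed.
Let tot_t : tot (rtop s) l = 1. Proof. by have [p _ _] := ws; exact: tot_init. Qed.
Let tot_b : tot (rbot s) l = 1. Proof. by have [_ p _] := ws; exact: tot_init. Qed.

Lemma inXE a x : inX lam a x = (pt a <= x < pt a + l a).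
Proof. by rewrite /inX left_topE init_lam. Qed.

Lemma iet_in a x : inX lam a x -> iet lam x = x + (pb a - pt a).
Proof.
move=> ax; rewrite /iet (bigD1 a) //= ax left_topE left_botE big1 ?addr0 // => b ba.
case: ifPn => // bx; rewrite !inXE in ax bx.
have := row_disj ut l0t (int a) (int b) ax bx.
by move/val_inj => ab; rewrite ab eqxx in ba.
Qed.

Lemma top_cover x : 0 <= x < 1 -> exists a, inX lam a x.
Proof.
rewrite -tot_t => /(row_cover ut)[k]; rewrite (wf_mem_top ws) inE => kn h.
by exists (Ordinal kn); rewrite inXE.
Qed.

Lemma bot_cover x : 0 <= x < 1 -> exists a : 'I_n, pb a <= x < pb a + l a.
Proof.
rewrite -tot_b => /(row_cover ub)[k]; rewrite (wf_mem_bot ws) inE => kn h.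
by exists (Ordinal kn).
Qed.

Lemma top_range (a : 'I_n) : 0 <= pt a /\ pt a + l a <= 1.
Proof.
have h : {in rtop s, forall k, 0 <= l k} by move=> k /l0t/ltW.
by split; [exact: pos_ge0|rewrite -tot_t; exact: posD_le_tot].
Qed.

Lemma bot_range (a : 'I_n) : 0 <= pb a /\ pb a + l a <= 1.
Proof.
have h : {in rbot s, forall k, 0 <= l k} by move=> k /l0b/ltW.
by split; [exact: pos_ge0|rewrite -tot_b; exact: posD_le_tot].
Qed.

Lemma iet_out x : ~~ (0 <= x < 1) -> iet lam x = x.
Proof.
move=> x01; rewrite /iet big1 ?addr0 // => a _; case: ifPn => //.
rewrite inXE; have [] := top_range a => h1 h2 ax.
by exfalso; move/negP: x01; apply; lra.
Qed.

Lemma iet_range x : (0 <= iet lam x < 1) = (0 <= x < 1).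
Proof.
have [x01|x01] := boolP (0 <= x < 1); last by rewrite iet_out // (negbTE x01).
have [a ax] := top_cover x01; rewrite (iet_in ax).
by move: ax; rewrite inXE; have [] := bot_range a; lra.
Qed.

(** The bridge between sets and [translation_inv]: testing a measure on these half-open pieces says
    that its distribution function moves rigidly. *)
Lemma preimage_piece (a : 'I_n) (t : R) : 0 <= t <= l a ->
  iet lam @^-1` `[pb a, pb a + t[%classic = `[pt a, pt a + t[%classic.
Proof.
move=> tl; have [b1 b2] := bot_range a; have [t1 t2] := top_range a.
apply/seteqP; split=> x /=; rewrite !in_itv /=.
  move=> Tx; have x01 : 0 <= x < 1 by rewrite -iet_range; lra.
  have [c cx] := top_cover x01.
  move: Tx; rewrite (iet_in cx) => Tx; move: cx; rewrite inXE => cx.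
  have ca : c = a.
    apply/val_inj/(row_disj (x := x + (pb c - pt c)) ub l0b (inb c) (inb a)).
      by rewrite -/(pb c); lra.
    by rewrite -/(pb a); lra.
  by subst c; lra.
move=> xa; have ax : inX lam a x by rewrite inXE; lra.
by rewrite (iet_in ax); lra.
Qed.

Lemma measurable_iet : measurable_fun setT (iet lam : R -> R).
Proof.
apply: measurable_funD => //; apply: measurable_sum => a.
apply: measurable_fun_ifT => //; apply: measurable_and; first exact: measurable_fun_ler.
exact: measurable_fun_ltr.
Qed.

End IET.

(** * The loop gamma and its matrix *)

Section Block.
Variable R : realType.
Implicit Types (A C D E : seq nat) (f g : nat -> R) (s : rstate R).

Lemma ins_after_split w z A C : w \notin A -> ins_after w z (A ++ w :: C) = A ++ w :: z :: C.
Proof.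
move=> wA; rewrite /ins_after index_cat (negbTE wA) /= eqxx addn0 -[A ++ w :: C]cat_rcons.
rewrite -(size_rcons A w).
by rewrite take_size_cat // drop_size_cat // cat_rcons.
Qed.

(** While [w] ends the bottom row it beats the entries of [D] from right to left, and each goes
    right behind [w]; so [D] reappears in its original order. *)
Lemma run_rotate_true w A C D B f : w \notin A -> w \notin D ->
  run (nseq (size D) true) (RS (A ++ w :: C ++ D) (rcons B w) f)
  = RS (A ++ w :: D ++ C) (rcons B w) (upd f w (f w - tot D f)).
Proof.
move=> wA; elim/last_ind: D C f => [|D z IH] C f /=.
  move=> _; rewrite cats0; congr (RS _ _ _).
  by apply/funext => k; rewrite /upd /tot big_nil subr0; case: eqP => // ->.
rewrite mem_rcons inE negb_or => /andP[wz wD]; rewrite size_rcons /=.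
rewrite /tstep /winner /loser /= last_rcons.
have -> : A ++ w :: C ++ rcons D z = rcons (A ++ w :: C ++ D) z.
  by rewrite -!cats1 -!catA /= -catA.
rewrite last_rcons drop_last_rcons ins_after_split //.
rewrite -[z :: C ++ D]/((z :: C) ++ D) IH // cat_rcons; congr (RS _ _ _).
apply/funext => k; rewrite tot_rcons /vstep /upd eqxx; case: eqP => // _.
rewrite -/(upd f w (f w - f z)) tot_upd_notin //; ring.
Qed.

Definition swap_rows s := RS (rbot s) (rtop s) (rlam s).

Lemma run_swap ts s : run (map negb ts) (swap_rows s) = swap_rows (run ts s).
Proof.
elim: ts s => //= t ts IH s; rewrite -IH; congr (run _ _).
by rewrite /tstep /winner /loser; case: t.
Qed.

Lemma run_rotate_false w A C D B f : w \notin A -> w \notin D ->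
  run (nseq (size D) false) (RS (rcons B w) (A ++ w :: C ++ D) f)
  = RS (rcons B w) (A ++ w :: D ++ C) (upd f w (f w - tot D f)).
Proof.
move=> wA wD; have := run_swap (nseq (size D) true) (RS (A ++ w :: C ++ D) (rcons B w) f).
by rewrite map_nseq /= run_rotate_true.
Qed.

Lemma run_cycle_false w z A B a f : w \notin A -> w != z ->
  run (nseq a false) (RS (rcons B w) (A ++ [:: w; z]) f)
  = RS (rcons B w) (A ++ [:: w; z]) (upd f w (f w - a%:R * f z)).
Proof.
move=> wA wz; elim: a f => [|a IH] f.
  by congr RS; apply/funext => k; rewrite mul0r subr0 /upd; case: eqP => // ->.
have wD : w \notin [:: z] by rewrite inE.
have := @run_rotate_false w A [::] [:: z] B f wA wD; rewrite cat0s /= => E.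
rewrite [tstep _ _]E IH; congr RS.
have zw : (z == w) = false by rewrite eq_sym (negbTE wz).
apply/funext => k; rewrite tot_cons /tot big_nil addr0 /upd eqxx zw.
by case: eqP => // _; rewrite -natr1 mulrDl mul1r; ring.
Qed.

Lemma run_cycle_true w D B c f : w \notin D ->
  run (nseq (c * size D) true) (RS (w :: D) (rcons B w) f)
  = RS (w :: D) (rcons B w) (upd f w (f w - c%:R * tot D f)).
Proof.
move=> wD; elim: c f => [|c IH] f.
  by congr RS; apply/funext => k; rewrite mul0r subr0 /upd; case: eqP => // ->.
have := @run_rotate_true w [::] [::] D B f isT wD; rewrite cat0s /= cats0 => E.
rewrite mulSn nseqD run_cat E IH; congr RS.
apply/funext => k; rewrite tot_upd_notin // /upd eqxx.
by case: eqP => // _; rewrite -natr1 mulrDl mul1r; ring.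
Qed.

Lemma notin_iota k m i : (k < m)%N || (m + i <= k)%N -> k \notin iota m i.
Proof. by rewrite mem_iota; lia. Qed.

Definition tail_sum n d f : R := tot (iota d (n - d)) f.

Lemma tail_sum_split n d f : (d < n)%N -> tail_sum n d f = f d + tail_sum n d.+1 f.
Proof. by move=> dn; rewrite /tail_sum (_ : n - d = (n - d.+1).+1)%N ?tot_cons //; lia. Qed.

(** The word splits into four rotations: [m.-1] beats all labels beyond [m]; [m] beats [m.-1] [a]
    times; [m.-1] beats [m], which restores the top row; finally [n.-1] beats [m.-1] and [m], which
    carries this pair to the front of the bottom row. *)
Lemma run_gammadot n m a E f : (0 < m)%N -> (m < n.-1)%N -> m \notin E ->
  exists g, run (gammadot n m a) (RS (top0 n) (n.-1 :: E ++ [:: m; m.-1]) f)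
    = RS (top0 n) [:: n.-1, m, m.-1 & E] g /\
  [/\ f m.-1 = g m.-1 + g m + tail_sum n m.+1 f, f m = g m + a%:R * (g m.-1 + g m),
      f n.-1 = g n.-1 + g m + g m.-1
    & forall k, k != m -> k != m.-1 -> k != n.-1 -> f k = g k].
Proof.
case: m => // m _ mn mE /=.
pose D := iota m.+2 (n - m.+2).
have sD : size D = (n - 1 - m.+1)%N by rewrite size_iota; lia.
have topE : top0 n = iota 0 m ++ m :: [:: m.+1] ++ D.
  rewrite /top0 /D (_ : n = m + (n - m.+2).+2)%N; last by lia.
  by rewrite iotaD /= (_ : m + (n - m.+2).+2 - m.+2 = n - m.+2)%N //; lia.
have topN : top0 n = rcons (iota 0 n.-1) n.-1.
  by rewrite /top0 {1}(_ : n = n.-1 + 1)%N ?iotaD ?cats1 //; lia.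
have m_A : m \notin iota 0 m by apply: notin_iota; lia.
have m_D : m \notin D by apply: notin_iota; lia.
have mm : m.+1 != m by lia.
pose f1 := upd f m (f m - tot D f).
pose f2 := upd f1 m.+1 (f1 m.+1 - a%:R * f1 m).
pose f3 := upd f2 m (f2 m - tot [:: m.+1] f2).
pose f4 := upd f3 n.-1 (f3 n.-1 - tot [:: m.+1; m] f3).
have botE X : n.-1 :: E ++ [:: X; m] = rcons (n.-1 :: E ++ [:: X]) m.
  by rewrite rcons_cons rcons_cat.
have S1 : run (nseq (n - 1 - m.+1) true) (RS (top0 n) (n.-1 :: E ++ [:: m.+1; m]) f)
    = RS (iota 0 m ++ m :: D ++ [:: m.+1]) (n.-1 :: E ++ [:: m.+1; m]) f1.
  by rewrite topE botE -sD run_rotate_true.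
have S2 : run (nseq a false) (RS (iota 0 m ++ m :: D ++ [:: m.+1]) (n.-1 :: E ++ [:: m.+1; m]) f1)
    = RS (iota 0 m ++ m :: D ++ [:: m.+1]) (n.-1 :: E ++ [:: m.+1; m]) f2.
  have -> : iota 0 m ++ m :: D ++ [:: m.+1] = rcons (iota 0 m ++ m :: D) m.+1.
    by rewrite -cats1 -catA.
  by rewrite -cat_cons run_cycle_false // inE negb_or mE andbT; lia.
have S3 : run [:: true] (RS (iota 0 m ++ m :: D ++ [:: m.+1]) (n.-1 :: E ++ [:: m.+1; m]) f2)
    = RS (top0 n) (n.-1 :: E ++ [:: m.+1; m]) f3.
  rewrite botE -[[:: true]]/(nseq (size [:: m.+1]) true) run_rotate_true ?topE //.
  by rewrite inE; lia.
have S4 : run [:: false; false] (RS (top0 n) (n.-1 :: E ++ [:: m.+1; m]) f3)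
    = RS (top0 n) [:: n.-1, m.+1, m & E] f4.
  rewrite topN -[[:: false; false]]/(nseq (size [:: m.+1; m]) false).
  by rewrite (@run_rotate_false n.-1 [::]) // !inE; lia.
exists f4; split.
  rewrite /gammadot run_cat S1 run_cat S2.
  by rewrite -[[:: true; false; false]]/([:: true] ++ [:: false; false]) run_cat S3 S4.
have D_E : tail_sum n m.+2 f = tot D f by [].
have mn1 : (m == n.-1) = false by lia.
have mn2 : (m.+1 == n.-1) = false by lia.
have mn3 : (n.-1 == m) = false by lia.
have mn4 : (n.-1 == m.+1) = false by lia.
have mn5 : (m == m.+1) = false by lia.
rewrite D_E /f4 /f3 /f2 /f1 /upd /tot !big_cons !big_nil !eqxx ?(negbTE mm) ?mn1 ?mn2 ?mn3 ?mn4 ?mn5.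
rewrite ?(negbTE mm) ?mn1 ?mn2 ?mn3 ?mn4 ?mn5 ?eqxx.
set T := \sum_(_ <- D) _; split; [ring|ring|ring|].
by move=> k /negbTE-> /negbTE-> /negbTE->.
Qed.

Definition pairs i j := flatten [seq [:: (2 * k)%N; (2 * k - 1)%N] | k <- iota i j].

Lemma mem_pairs k i j : (k \in pairs i.+1 j) = ((2 * i < k) && (k <= 2 * (i + j)))%N.
Proof.
elim: j i => [|j IH] i /=; first by rewrite in_nil addn0; lia.
by rewrite /pairs /= !inE -/(pairs i.+2 j) IH; lia.
Qed.

(** After [j] blocks the [j] rightmost pairs stand behind [n.-1] and [i] pairs remain in place. All
    moved pairs share one tail sum in their equations, because a block does not change it. *)
Lemma run_gammadots h n a j i f : n = (h.*2.+2)%N -> h = (i + j)%N ->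
  exists g, run (flatten [seq gammadot n (n - 2 - 2 * k) a | k <- iota 0 j])
      (RS (top0 n) (n.-1 :: 0%N :: pairs 1 h) f)
    = RS (top0 n) (n.-1 :: pairs i.+1 j ++ 0%N :: pairs 1 i) g /\
  [/\ forall k, (i <= k < h)%N ->
        f k.*2.+1 = g k.*2.+1 + g k.*2.+2 + tail_sum n i.*2.+1 g /\
        f k.*2.+2 = g k.*2.+2 + a%:R * (g k.*2.+1 + g k.*2.+2),
      f n.-1 = tail_sum n i.*2.+1 g
    & forall k, (k <= i.*2)%N -> f k = g k].
Proof.
move=> nE; elim: j i => [|j IH] i hE.
  exists f; split; first by rewrite hE addn0.
  rewrite addn0 in hE; split=> // [k|]; first lia.
  rewrite /tail_sum (_ : n - i.*2.+1 = 1)%N; last by lia.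
  by rewrite (_ : i.*2.+1 = n.-1) ?tot_cons /tot ?big_nil ?addr0 //; lia.
have [g [Eg [G1 G2 G3]]] := IH i.+1 ltac:(lia).
have mE : (n - 2 - 2 * j = i.*2.+2)%N by lia.
pose E := pairs i.+2 j ++ 0%N :: pairs 1 i.
have EE : n.-1 :: pairs i.+2 j ++ 0%N :: pairs 1 i.+1 = n.-1 :: E ++ [:: i.*2.+2; (i.*2.+2).-1].
  rewrite /E -catA /= /pairs -[i.+1]addn1 iotaD map_cat flatten_cat /= add1n.
  by congr (_ :: _ ++ _ :: _ ++ [:: _; _]); lia.
have m_E : i.*2.+2 \notin E.
  rewrite /E mem_cat inE mem_pairs negb_or /=.
  case: i {IH G1 G2 G3 Eg E EE mE} hE => [|i] hE; first by rewrite in_nil; lia.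
  by rewrite (mem_pairs _ 0); lia.
have [g' [Eg' [G'1 G'2 G'3 G'4]]] := @run_gammadot n i.*2.+2 a E g ltac:(lia) ltac:(lia) m_E.
exists g'; split.
  rewrite -[j.+1]addn1 iotaD map_cat flatten_cat run_cat Eg /= add0n mE cats0 EE Eg'.
  have -> : pairs i.+1 (j + 1) = [:: i.*2.+2, i.*2.+1 & pairs i.+2 j].
    by rewrite addn1 /pairs /=; congr [:: _, _ & _]; lia.
  by [].
have same k : (i.*2.+2 < k < n.-1)%N -> g k = g' k by move=> kk; apply: G'4; lia.
(* What [n.-1] gives up in this block is the length of the pair [i.*2.+1], [i.*2.+2], which now
   joins the tail; the two effects cancel. *)
have Sg' : tail_sum n i.*2.+1 g' = tail_sum n i.*2.+3 g.
  rewrite (@tail_sum_split n i.*2.+1) ?(@tail_sum_split n i.*2.+2); try lia.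
  have ts u : tail_sum n i.*2.+3 u = tot (iota i.*2.+3 (n - i.*2.+4)) u + u n.-1.
    rewrite /tail_sum (_ : n - i.*2.+3 = n - i.*2.+4 + 1)%N; last by lia.
    rewrite iotaD tot_cat tot_cons /tot big_nil addr0.
    by congr (_ + u _); lia.
  rewrite !ts G'3 /=.
  have -> : tot (iota i.*2.+3 (n - i.*2.+4)) g = tot (iota i.*2.+3 (n - i.*2.+4)) g'.
    by apply: eq_tot => k; rewrite mem_iota => kk; apply: same; lia.
  ring.
split.
- move=> k kk; have [ik|ik] := eqVneq k i.
    subst k; rewrite (G3 i.*2.+1) ?(G3 i.*2.+2); try lia.
    by move: G'1 G'2; rewrite Sg' /= => <- <-.
  have [-> ->] := G1 k ltac:(lia).
  by rewrite Sg' -!same //; lia.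
- by rewrite G2 Sg'.
- by move=> k kk; rewrite G3 ?G'4 //; lia.
Qed.

Lemma sum_ord_pick n k (F : nat -> R) : (k < n)%N ->
  \sum_(j < n) (if j == k :> nat then F j else 0) = F k.
Proof.
by move=> kn; rewrite -big_mkcond /= (big_pred1 (Ordinal kn)) //= => j.
Qed.

Lemma tail_sum1E n g : (0 < n)%N ->
  tail_sum n 1 g = \sum_(j < n) (if j == 0%N :> nat then 0 else g j).
Proof.
case: n => // n _; rewrite big_ord_recl /= add0r /tail_sum /tot subn1 /=.
rewrite (_ : iota 1 n = index_iota 1 n.+1) ?big_add1; last by rewrite /index_iota subn1.
rewrite /= big_mkord.
exact: eq_bigr.
Qed.

Lemma Theta_mul n a c g (r : 'I_n) : ~~ odd n ->
  (Theta R n a c *m \col_(i < n) g i) r 0 =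
  if r == 0%N :> nat then g 0%N + c%:R * tail_sum n 1 g
  else if r == n.-1 :> nat then g 0%N + c.+1%:R * tail_sum n 1 g
  else if odd r then tail_sum n 1 g + g r + g r.+1
  else a%:R * (g r.-1 + g r) + g r.
Proof.
move=> no; have n0 : (0 < n)%N by rewrite (leq_ltn_trans _ (ltn_ord r)).
have row1 (b : R) : \sum_(j < n) (if j == 0%N :> nat then 1 else b) * g j
    = g 0%N + b * tail_sum n 1 g.
  rewrite -(sum_ord_pick g n0) tail_sum1E // mulr_sumr -big_split /=.
  by apply: eq_bigr => j _; case: ifP => /= _; ring.
rewrite mxE; under eq_bigr do rewrite !mxE; have rn := ltn_ord r.
case: ifP => [r0|r0]; first exact: row1.
case: ifP => [r1|r1]; first exact: row1.
case: ifP => [ro|ro].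
  have r1n : (r.+1 < n)%N by lia.
  rewrite -(sum_ord_pick g rn) -(sum_ord_pick g r1n) tail_sum1E // -!big_split /=.
  apply: eq_bigr => j _; case: (eqVneq (j : nat) 0%N) => [j0|j0].
    by rewrite j0 eq_sym r0 /=; ring.
  have [jr|jr] := eqVneq (j : nat) r; first by rewrite jr ltn_eqF //=; ring.
  by case: (j == r.+1 :> nat) => /=; ring.
have pr : (r.-1 < n)%N by lia.
have rE : (r == r.-1 :> nat) = false by lia.
transitivity (\sum_(j < n) (if j == r.-1 :> nat then a%:R * g j else 0)
   + \sum_(j < n) (if j == r :> nat then a.+1%:R * g j else 0)).
  rewrite -big_split /=; apply: eq_bigr => j _.
  have [jr|jr] := eqVneq (j : nat) r.-1; first by rewrite jr eq_sym rE; ring.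
  by case: ifP => _; ring.
rewrite (sum_ord_pick (fun j => a%:R * g j) pr) (sum_ord_pick (fun j => a.+1%:R * g j) rn).
by rewrite -natr1; ring.
Qed.

Lemma run_gamma n a c f : (2 <= n)%N -> ~~ odd n ->
  exists g, run (gamma n a c) (RS (top0 n) (bot0 n) f) = RS (top0 n) (bot0 n) g /\
   \col_(i < n) f i = Theta R n a c *m \col_(i < n) g i.
Proof.
move=> n2 no; pose h := n.-2./2; have nE : n = h.*2.+2 by rewrite /h; lia.
have hE : ((n - 2)./2 = h)%N by rewrite /h; lia.
have topN : top0 n = rcons (iota 0 n.-1) n.-1.
  by rewrite /top0 {1}(_ : n = n.-1 + 1)%N ?iotaD ?cats1 //; lia.
have topE : top0 n = 0%N :: iota 1 (n - 1) by rewrite /top0 {1}nE nE subn1.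
have botE : bot0 n = n.-1 :: pairs 1 h ++ [:: 0%N] by rewrite /bot0 hE subn1.
pose f1 := upd f n.-1 (f n.-1 - tot [:: 0%N] f).
have nP : n.-1 \notin pairs 1 h by rewrite (mem_pairs _ 0); lia.
have S1 : run [:: false] (RS (top0 n) (bot0 n) f) = RS (top0 n) (n.-1 :: 0%N :: pairs 1 h) f1.
  rewrite topN botE -[[:: false]]/(nseq (size [:: 0%N]) false).
  by rewrite (@run_rotate_false n.-1 [::]) // !inE; lia.
have [g [Eg [G1 G2 G3]]] := @run_gammadots h n a h 0 f1 nE erefl.
pose g' := upd g 0%N (g 0%N - c%:R * tot (iota 1 (n - 1)) g).
have S3 : run (nseq (c * (n - 1)) true) (RS (top0 n) (bot0 n) g) = RS (top0 n) (bot0 n) g'.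
  have bE : bot0 n = rcons (n.-1 :: pairs 1 h) 0%N by rewrite botE -cats1.
  by rewrite topE bE -[in nseq _ _](size_iota 1 (n - 1)) run_cycle_true // mem_iota.
exists g'; split.
  rewrite /gamma hE -cat1s run_cat S1 run_cat Eg -S3; congr (run _ (RS _ _ _)).
  by rewrite botE.
have tg : tail_sum n 1 g' = tail_sum n 1 g.
  by rewrite /tail_sum tot_upd_notin // mem_iota.
have gg k : (0 < k)%N -> g' k = g k by move=> k0; rewrite /g' upd_other //; lia.
have f10 : f1 0%N = f 0%N by rewrite /f1 upd_other //; lia.
have g0 : f 0%N = g' 0%N + c%:R * tail_sum n 1 g'.
  rewrite -f10 (G3 0%N) // tg /g' upd_same /tail_sum; ring.
apply/matrixP => r q; rewrite ord1 mxE Theta_mul //; have rn := ltn_ord r.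
case: ifP => [/eqP-> //|r0]; case: ifP => [/eqP->|r1].
  have := G2; rewrite /f1 upd_same tot_cons /tot big_nil addr0 double0 -tg => /eqP.
  rewrite subr_eq => /eqP ->; rewrite g0 -natr1; ring.
have fr : f r = f1 r by rewrite /f1 upd_other // r1.
pose k := (r.-1)./2; have kh : (0 <= k < h)%N by rewrite /k; lia.
have [K1 K2] := G1 k kh; rewrite fr; case: ifP => ro.
  have rE : r = k.*2.+1 :> nat by rewrite /k; lia.
  rewrite rE K1 !gg // tg double0; ring.
have rE : r = k.*2.+2 :> nat by rewrite /k; lia.
by rewrite rE K2 !gg //=; ring.
Qed.

(** Rows 0 and [n.-1] differ by the tail sum, which therefore vanishes; then the two rows of each
    pair kill both its coordinates, and the tail sum kills the last one. Injectivity is what allows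
    a later-stage vector to be recovered from its image at stage 0. *)
Lemma Theta_inj n a c g : (4 <= n)%N -> ~~ odd n -> Theta R n a c *m \col_(i < n) g i = 0 ->
  forall k, (k < n)%N -> g k = 0.
Proof.
move=> n4 no T0.
have row k (kn : (k < n)%N) := Theta_mul a c g (Ordinal kn) no.
have {}row k (kn : (k < n)%N) := row k kn; rewrite T0 in row.
have r0 := row 0%N ltac:(lia); have rn := row n.-1 ltac:(lia).
have n1 : (n.-1 == 0)%N = false by lia.
move: r0 rn; rewrite !mxE /= n1 !eqxx => r0 rn.
have t0 : tail_sum n 1 g = 0.
  by rewrite -natr1 in rn; rewrite -[RHS](subrr 0) {1}rn r0; ring.
have g0 : g 0%N = 0 by move: r0; rewrite t0 mulr0 addr0.
have mid k : (k.*2.+2 < n.-1)%N -> g k.*2.+1 = 0 /\ g k.*2.+2 = 0.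
  move=> kn; have kn2 : (k.*2.+2 < n)%N := leq_trans kn (leq_pred n).
  have o := row k.*2.+1 (ltnW kn2); have e := row k.*2.+2 kn2.
  have h1 : (k.*2.+1 == n.-1) = false := ltn_eqF (ltnW kn).
  have h2 : (k.*2.+2 == n.-1) = false := ltn_eqF kn.
  move: o e; rewrite !mxE /= h1 h2 odd_double /= t0 add0r => o e.
  have e' : g k.*2.+2 = 0 by move: e; rewrite -o mulr0 add0r.
  by split=> //; move: o; rewrite e' addr0.
have mid' k : (0 < k < n.-1)%N -> g k = 0.
  move=> kn; have [] := mid (k.-1)./2 ltac:(lia).
  case ko: (odd k).
    by rewrite (_ : _./2.*2.+1 = k) //; lia.
  by rewrite (_ : _./2.*2.+2 = k) //; lia.
move=> k kn; have [->//|k0] := eqVneq k 0%N.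
have [->|kn1] := eqVneq k n.-1; last by apply: mid'; lia.
move: t0; rewrite /tail_sum (_ : n - 1 = n.-2 + 1)%N; last by lia.
rewrite iotaD tot_cat tot_cons (_ : 1 + n.-2 = n.-1)%N; last by lia.
rewrite /tot big_nil addr0 big_seq big1 ?add0r // => i.
by rewrite mem_iota => ii; apply: mid'; lia.
Qed.

End Block.

(** * Left-continuous distribution functions and Lebesgue-Stieltjes measures *)

Section LeftCdf.
Variable R : realType.
Implicit Types m : {measure set R -> \bar R}.

(** The half-line is open at [x] because the exchanged intervals are closed on the left and open on
    the right: increments are then measures of [[x, y)] even in the presence of atoms. *)
Definition lcdf m (x : R) : R := fine (m `]-oo, x[%classic).

Lemma le_meas m A B : measurable A -> measurable B -> A `<=` B -> (m A <= m B)%E.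
Proof. by move=> mA mB AB; apply: le_measure; rewrite ?inE. Qed.

Lemma finite_fin_num m A : (m setT < +oo)%E -> measurable A -> m A \is a fin_num.
Proof.
move=> fm mA; rewrite ge0_fin_numE //; apply: le_lt_trans fm.
by apply: le_measure; rewrite ?inE.
Qed.

Lemma lcdfE m x : (m setT < +oo)%E -> m `]-oo, x[%classic = (lcdf m x)%:E.
Proof. by move=> fm; rewrite /lcdf fineK // finite_fin_num. Qed.

Lemma lcdf_mono m : (m setT < +oo)%E -> {homo lcdf m : x y / x <= y}.
Proof.
move=> fm x y xy; apply: fine_le; [exact: finite_fin_num..|].
by apply: le_measure; rewrite ?inE //; apply: subset_itvl; rewrite bnd_simp.
Qed.

Lemma lcdf_itv m x y : (m setT < +oo)%E -> x <= y ->
  m `[x, y[%classic = (lcdf m y - lcdf m x)%:E.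
Proof.
move=> fm xy; have -> : `[x, y[%classic = `]-oo, y[%classic `\` `]-oo, x[%classic.
  apply/seteqP; split=> z /=; rewrite !in_itv /=; first by move=> /andP[h ->]; split=> //; apply/negP; rewrite -leNgt.
  by move=> [-> /negP]; rewrite -leNgt => ->.
rewrite measureD //=; last by rewrite lcdfE // ltry.
rewrite setIidr; last by apply: subset_itvl; rewrite bnd_simp.
by rewrite EFinB !lcdfE.
Qed.

Lemma eq_lcdf m1 m2 : (m1 setT < +oo)%E -> (m2 setT < +oo)%E -> lcdf m1 =1 lcdf m2 ->
  forall A, measurable A -> m1 A = m2 A.
Proof.
move=> f1 f2 E A mA.
apply: (measure_unique (@RGenInftyO.G R) (fun n => `]-oo, n%:R[%classic)) => //.
- exact: RGenInftyO.measurableE.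
- move=> _ _ [x ->] [y ->]; exists (Num.min x y).
  by apply/seteqP; split=> z /=; rewrite !in_itv /= lt_min => /andP.
- by move=> n; exists n%:R.
- rewrite -subTset => x _; exists (Num.Def.truncn `|x|).+1 => //=.
  rewrite in_itv /= (le_lt_trans (ler_norm x)) //.
  by rewrite truncnS_gt.
- by move=> _ [x ->]; rewrite !lcdfE // E.
- by move=> k; rewrite lcdfE // ltry.
Qed.

End LeftCdf.

Section LS.
Variables (R : realType) (F : R -> R).
Hypothesis F_mono : {homo F : x y / x <= y}.
Hypothesis F_cont : forall e : R, 0 < e -> exists2 d, 0 < d &
  forall x y : R, x <= y -> y - x <= d -> F y - F x <= e.
Hypothesis F_le0 : forall x : R, x <= 0 -> F x = 0.
Hypothesis F_ge1 : forall x : R, 1 <= x -> F x = 1.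

Let F_rc : right_continuous F.
Proof.
move=> x; apply/cvgrPdist_le => e e0; have [d d0 h] := F_cont e0.
near=> y; have xy : x < y by near: y; exact: nbhs_right_gt.
rewrite distrC ger0_norm ?subr_ge0 ?F_mono ?(ltW xy) //; apply: h; first exact: ltW.
by rewrite lerBlDl; near: y; apply: nbhs_right_le; rewrite ltrDl.
Unshelve. all: by end_near. Qed.

#[local] HB.instance Definition _ := isCumulative.Build R _ R F F_mono F_rc.

Let F_Ny : F @ -oo --> (0 : R).
Proof.
apply/cvgrPdist_le => e e0; near=> x.
by rewrite F_le0 ?subrr ?normr0 ?(ltW e0) //.
Unshelve. all: by end_near. Qed.

Let F_y : F @ +oo --> (1 : R).
Proof.
apply/cvgrPdist_le => e e0; near=> x.
by rewrite F_ge1 ?subrr ?normr0 ?(ltW e0) //; near: x; exact: nbhs_pinfty_ge.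
Unshelve. all: by end_near. Qed.

#[local] HB.instance Definition _ := isCumulativeBounded.Build R 0 1 F F_Ny F_y.

(** The identity viewed as a random variable: its law transports the Lebesgue-Stieltjes measure to
    the type [R] itself. *)
Let idTR : measurableTypeR R -> R := idfun.

#[local] HB.instance Definition _ :=
  @isMeasurableFun.Build _ _ _ _ idTR (@measurable_id _ _ setT).

Let lsf := lebesgue_stieltjes_measure F.

(** The Stieltjes measure has [F] as distribution function with closed half-lines; continuity of [F]
    closes the gap with the open half-lines of [lcdf]. *)
Lemma probability_of_cdf : exists mu : probability R R, lcdf mu =1 F.
Proof.
pose mu : probability R R := distribution lsf (idTR : {RV lsf >-> R}).
exists mu => x; have muT : (mu setT < +oo)%E by rewrite probability_setT ltry.
have cE y : mu `]-oo, y]%classic = (F y)%:E by exact: cdf_lebesgue_stieltjes_id.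
have le1 : lcdf mu x <= F x.
  rewrite -lee_fin -lcdfE // -cE; apply: le_measure; rewrite ?inE //.
  by apply: subset_itvl; rewrite bnd_simp.
apply/eqP; rewrite eq_le le1 /=; apply/ler_addgt0Pl => e e0.
have [d d0 h] := F_cont e0.
have := h (x - d) x ltac:(lra) ltac:(lra).
suff : F (x - d) <= lcdf mu x by set a := F _; set b := lcdf _ _; lra.
rewrite -lee_fin -lcdfE // -cE; apply: le_measure; rewrite ?inE //.
by apply: subset_itvl; rewrite bnd_simp; lra.
Qed.

End LS.

(** * Passing between invariant functions and invariant measures *)

Section InvariantMeasures.
Variables (R : realType) (n : nat) (lam : 'I_n -> R).
Local Notation s := (init_state lam).
Local Notation l := (rlam (init_state lam)).
Hypothesis ws : wf n s.
Hypothesis lam1 : \sum_i lam i = 1.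
Local Notation T := (iet lam).

Let tot_t : tot (rtop s) l = 1. Proof. by have [p _ _] := ws; exact: tot_init. Qed.

Lemma ord_mem_top k : k \in rtop s -> exists a : 'I_n, k = a.
Proof. by rewrite (wf_mem_top ws) inE => kn; exists (Ordinal kn). Qed.

Lemma inv_fun_of_measure (m : {measure set R -> \bar R}) : (m setT < +oo)%E ->
  (forall A, measurable A -> m (T @^-1` A) = m A) -> inv_fun s (lcdf m).
Proof.
move=> fm I k /ord_mem_top[a ->{k}] t tl.
have h1 : pos (rtop s) l a <= pos (rtop s) l a + t by lra.
have h2 : pos (rbot s) l a <= pos (rbot s) l a + t by lra.
apply: EFin_inj; rewrite -!lcdf_itv // -[RHS]I; last exact: measurable_itv.
by rewrite (preimage_piece ws lam1).
Qed.

Lemma measure_Xint (m : {measure set R -> \bar R}) (a : 'I_n) : (m setT < +oo)%E ->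
  m (Xint lam a) = (fun_vec s (lcdf m) a)%:E.
Proof.
move=> fm; have l0 : 0 <= l a by apply/ltW/(wf_top0 ws); rewrite (wf_mem_top ws) inE.
rewrite /fun_vec /row_vec -lcdf_itv //; last by rewrite lerDl.
congr (m _); apply/seteqP; split=> x /=; by rewrite /Xint /= (inXE ws) in_itv.
Qed.

(** The image measure [nu] of [mu] under [T] has the increments of [F] along each bottom interval
    and no mass below 0. Hence the two functions agree at the endpoints of the bottom row, and then
    everywhere. *)
Lemma probability_of_inv_fun F : {homo F : x y / x <= y} ->
  (forall e : R, 0 < e -> exists2 d, 0 < d &
    forall x y : R, x <= y -> y - x <= d -> F y - F x <= e) ->
  (forall x : R, x <= 0 -> F x = 0) -> (forall x : R, 1 <= x -> F x = 1) ->
  inv_fun s F -> exists mu : probability R R, inv_prob T mu /\ lcdf mu =1 F.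
Proof.
move=> Fm Fc F0 F1 I; have [mu muE] := probability_of_cdf Fm Fc F0 F1.
exists mu; split=> //; have muT : (mu setT < +oo)%E by rewrite probability_setT ltry.
split; first by rewrite lcdf_itv // !muE F1 // F0 // subr0.
have mT : measurable_fun setT T := measurable_iet lam.
pose X : {mfun R >-> R} := mfun_Sub (mem_set mT).
pose nu : probability R R := distribution mu X.
have nuT : (nu setT < +oo)%E by rewrite probability_setT ltry.
have XE : X =1 T by move=> x; rewrite /X /=.
suff E : lcdf nu =1 lcdf mu by move=> A mA; exact: (eq_lcdf nuT muT E mA).
have nuE A : nu A = mu (T @^-1` A) by [].
(* [T] preserves [[0, 1)] and fixes every other point, so a point sent below 0 was already below
   0. *)
have nu0 : lcdf nu 0 = 0.
  apply/eqP; rewrite eq_le; apply/andP; split; last by rewrite /lcdf fine_ge0.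
  rewrite -lee_fin -(lcdfE _ nuT); apply: (@le_trans _ _ (mu `]-oo, 0[%classic)).
    apply: (@le_meas _ mu (T @^-1` `]-oo, 0[%classic)) => //.
      by rewrite -[X in measurable X]setTI; exact: (measurable_iet lam).
    move=> x /=; rewrite !in_itv /= => Tx; have [x01|x01] := boolP (0 <= x < 1).
      by move: x01; rewrite -(iet_range ws lam1); lra.
    by move: Tx; rewrite (iet_out ws lam1).
  by rewrite lcdfE // muE F0.
have piece (a : 'I_n) t : 0 <= t <= l a ->
    lcdf nu (pos (rbot s) l a + t) - lcdf nu (pos (rbot s) l a)
    = F (pos (rbot s) l a + t) - F (pos (rbot s) l a).
  move=> tl; have h1 : pos (rtop s) l a <= pos (rtop s) l a + t by lra.
  have h2 : pos (rbot s) l a <= pos (rbot s) l a + t by lra.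
  apply: EFin_inj; rewrite -lcdf_itv //.
  transitivity (mu (T @^-1` `[pos (rbot s) l a, pos (rbot s) l a + t[%classic)) => //.
  rewrite (preimage_piece ws lam1) // lcdf_itv // !muE; congr EFin; apply: I => //.
  by rewrite (wf_mem_top ws) inE.
have ub : uniq (rbot s) by rewrite -(perm_uniq (wf_perm ws)) (wf_uniq_top ws).
have VE : {in rbot s, row_vec (rbot s) l (lcdf nu) =1 row_vec (rbot s) l F}.
  move=> k kb; have l0 := ltW (wf_bot0 ws kb).
  have [a ka] : exists a : 'I_n, k = a by apply: ord_mem_top; rewrite (wf_top_bot ws).
  by subst k; apply: piece; rewrite l0 lexx.
have F00 : F 0 = 0 by exact: F0.
have pE k : k \in rbot s -> lcdf nu (pos (rbot s) l k) = F (pos (rbot s) l k).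
  move=> kb; have := eq_pos k VE.
  by rewrite !pos_row_vec // nu0 F00 !subr0.
have nu1 : lcdf nu 1 = 1.
  have := eq_tot VE; rewrite !tot_row_vecE //.
  by have [_ pb _] := ws; rewrite (tot_init lam1 pb) F1.
move=> x; rewrite muE; have [x0|x0] := leP x 0.
  rewrite F0 //; apply/eqP; rewrite eq_le -{1}nu0 lcdf_mono //=.
  by rewrite /lcdf fine_ge0.
have [x1|x1] := leP 1 x.
  rewrite F1 //; apply/eqP; rewrite eq_le -{2}nu1 lcdf_mono // andbT.
  by rewrite -lee_fin -lcdfE // probability_le1.
have [a ax] := bot_cover ws lam1 (x := x) ltac:(lra).
have ab : (a : nat) \in rbot s by rewrite (wf_mem_bot ws) inE.
have := piece a (x - pos (rbot s) l a) ltac:(lra).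
rewrite [_ + (x - _)]addrC subrK pE //; exact: addIr.
Qed.

Lemma measure_eq_of_vec (m1 m2 : {measure set R -> \bar R}) (W : nat -> seq bool) :
  (forall m, good (W m) s) -> (m1 setT < +oo)%E -> (m2 setT < +oo)%E ->
  m1 (~` `[0, 1[%classic) = 0%E -> m2 (~` `[0, 1[%classic) = 0%E ->
  inv_fun s (lcdf m1) -> inv_fun s (lcdf m2) ->
  (forall k, (k < n)%N -> fun_vec s (lcdf m1) k = fun_vec s (lcdf m2) k) ->
  (forall e : R, 0 < e -> exists m,
    tot (rtop (run (W m) s)) (vrun (W m) s (fun_vec s (lcdf m1))) <= e) ->
  forall A, measurable A -> m1 A = m2 A.
Proof.
move=> gW f1 f2 o1 o2 I1 I2 V small; apply: eq_lcdf => // x.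
have m01 : measurable (~` `[0:R, 1[%classic) by apply: measurableC; exact: measurable_itv.
have lcdf0 (m : {measure set R -> \bar R}) y : (m setT < +oo)%E -> m (~` `[0, 1[%classic) = 0%E ->
    y <= 0 -> lcdf m y = 0.
  move=> fm o y0; apply: EFin_inj; rewrite -lcdfE //; apply/eqP.
  rewrite eq_le measure_ge0 andbT -[leRHS]o; apply: le_meas => //.
  by move=> z /=; rewrite !in_itv /= => zy; apply/negP; lra.
have lcdf1 (m : {measure set R -> \bar R}) y : (m setT < +oo)%E -> m (~` `[0, 1[%classic) = 0%E ->
    1 <= y -> lcdf m y = lcdf m 1.
  move=> fm o y1; apply/eqP; rewrite -subr_eq0; apply/eqP/EFin_inj; rewrite -lcdf_itv //.
  apply/eqP; rewrite eq_le measure_ge0 andbT -[leRHS]o; apply: le_meas => //.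
  by move=> z /=; rewrite !in_itv /= => zy; apply/negP; lra.
have U : forall y, 0 <= y <= 1 -> lcdf m1 y = lcdf m2 y.
  move=> y y01; apply: (inv_fun_unique ws gW) => //; try exact: lcdf_mono; try exact: lcdf0.
  by rewrite tot_t.
have [x0|x0] := leP x 0; first by rewrite !lcdf0.
have [x1|x1] := leP 1 x; first by rewrite !(lcdf1 _ x) // U // ler01 lexx.
by apply: U; lra.
Qed.

End InvariantMeasures.

(** * The nested cones *)

Lemma cvg_fin_sum (R : realType) (I : finType) (f : I -> nat -> R) (l : I -> R) :
  (forall i, f i m @[m --> \oo] --> l i) ->
  (\sum_i f i m) @[m --> \oo] --> \sum_i l i.
Proof.
move=> fl; apply: (@cvg_big _ _ +%R) => //; exact: add_continuous.
Qed.

Lemma cvg_scale (R : realType) (b l : R) (f : nat -> R) : f m @[m --> \oo] --> l ->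
  (b * f m) @[m --> \oo] --> b * l.
Proof. by move=> fl; apply: cvgM => //; exact: cvg_cst. Qed.

Lemma cvg_cV (R : realType) n (f : nat -> 'cV[R]_n) (l : 'cV[R]_n) :
  (forall i, f m i 0 @[m --> \oo] --> l i 0) -> f m @[m --> \oo] --> l.
Proof.
move=> fl B [Q Ql QB]; rewrite /nbhs /=.
apply: (filterS (P := fun m => forall i, Q i 0 (f m i 0))).
  by move=> m Qm; apply: QB => i j; rewrite ord1; exact: Qm.
exact: (filter_forall (f := fun i m => Q i 0 (f m i 0)) _ (fun i => fl i _ (Ql i 0))).
Qed.

Lemma normv_scale (R : realType) n (b : R) (v : 'cV[R]_n) : b != 0 -> normv (b *: v) = normv v.
Proof.
move=> b0; rewrite /normv; under eq_bigr do rewrite mxE.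
by rewrite -mulr_sumr scalerA invfM mulrAC mulVf // mul1r.
Qed.

Section Cone.
Variable R : realType.
Variables (n p c1 : nat).
Hypotheses (n4 : (4 <= n)%N) (neven : ~~ odd n) (np : (n.+1 <= p)%N) (c10 : (0 < c1)%N).
Implicit Types (x y : nat -> R).

Local Notation H := ((n.-2)./2).
Local Notation a m := (aseq p c1 m).
Local Notation c m := (cseq p c1 m).
Let P : R := p%:R.
Let A m : R := (a m)%:R.
Let e m : R := (A m)^-1.
Let z m : R := P^-1 ^+ m.

Let P5 : 5 <= P. Proof. by rewrite /P (ler_nat R 5 p); lia. Qed.
Let P0 : 0 < P. Proof. by have := P5; lra. Qed.
Let HP : H%:R + 2 <= P. Proof. by rewrite /P -natrD ler_nat; lia. Qed.
Let Pi0 : 0 < P^-1. Proof. by rewrite invr_gt0. Qed.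
Let Pi5 : P^-1 <= 5^-1. Proof. by rewrite lef_pV2 // posrE. Qed.

Let c_gt0 m : (0 < c m)%N.
Proof. by elim: m => //= m IH; rewrite !muln_gt0 IH; lia. Qed.

Let A_c m : A m = P * (c m)%:R. Proof. by rewrite /A /aseq natrM. Qed.
Let A0 m : 0 < A m. Proof. by rewrite A_c mulr_gt0 // ltr0n. Qed.
Let e0 m : 0 < e m. Proof. by rewrite invr_gt0. Qed.
Let z0 m : 0 < z m. Proof. exact: exprn_gt0. Qed.
Let z1 m : z m <= 1.
Proof. by apply: exprn_ile1; [exact: ltW|apply: le_trans Pi5 _; lra]. Qed.
Let zS m : z m.+1 = z m * P^-1. Proof. by rewrite /z exprSr. Qed.

(** Here [P * e m] is the inverse of [c m]. The square matters: against the weight [P ^+ m] of the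
    last label a perturbation of order [z m ^+ 2] still leaves a factor [z m]. *)
Let Pe m : P * e m <= z m ^+ 2.
Proof.
have cz : forall m, P ^+ m ^+ 2 <= (c m)%:R.
  elim=> [|k IH] /=; first by rewrite expr1n ler1n.
  rewrite !natrM -/P (_ : P ^+ k.+1 ^+ 2 = P * (P * P ^+ k ^+ 2)); last by rewrite [P ^+ k.+1]exprS; ring.
  by rewrite !ler_pM2l.
rewrite /e A_c invfM mulrA divff ?gt_eqF // mul1r /z exprVn exprVn.
by rewrite lef_pV2 // posrE ?ltr0n // !exprn_gt0.
Qed.

Definition thetaf m x r : R :=
  if r == 0%N then x 0%N + (c m)%:R * tail_sum n 1 x
  else if r == n.-1 then x 0%N + (c m).+1%:R * tail_sum n 1 x
  else if odd r then tail_sum n 1 x + x r + x r.+1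
  else (a m)%:R * (x r.-1 + x r) + x r.

Lemma Theta_mul_col m x : Theta R n (a m) (c m) *m \col_(i < n) x i = \col_(i < n) thetaf m x i.
Proof. by apply/matrixP => i j; rewrite ord1 Theta_mul // mxE. Qed.

Definition psi m x r : R := thetaf m x r / A m.

(** [W] and the last coordinate [h] carry the limit dynamics: up to terms in [e m], [psi m]
    preserves each pair sum in [W] and replaces [h] by [P^-1 * (W + h)]. *)
Let W x : R := \sum_(i < H) (x i.*2.+1 + x i.*2.+2).
Let h x : R := x n.-1.

Lemma tail_sumW x : tail_sum n 1 x = W x + h x.
Proof.
have nE : n = H.*2.+2 by lia.
rewrite /tail_sum (_ : n - 1 = H.*2 + 1)%N; last by lia.
rewrite iotaD tot_cat tot_cons (_ : 1 + H.*2 = n.-1)%N; last by lia.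
rewrite /tot big_nil addr0 /W /h; congr (_ + _).
elim: (H) => [|k IH]; first by rewrite big_nil big_ord0.
rewrite (_ : k.+1.*2 = k.*2 + 2)%N; last by lia.
by rewrite iotaD big_cat IH big_ord_recr /= !big_cons big_nil addr0 add1n.
Qed.

Let Ae m : A m * e m = 1. Proof. by rewrite divff // gt_eqF. Qed.

Let ce m : (c m)%:R * e m = P^-1.
Proof. by rewrite /e A_c invfM mulrCA divff ?mulr1 // gt_eqF // ltr0n. Qed.

Lemma psi_first m x : psi m x 0%N = e m * x 0%N + P^-1 * (W x + h x).
Proof. by rewrite /psi /thetaf eqxx tail_sumW -(ce m) -/(e m); ring. Qed.

Lemma psi_last m x : psi m x n.-1 = e m * x 0%N + (P^-1 + e m) * (W x + h x).
Proof.
rewrite /psi /thetaf eqxx (_ : (n.-1 == 0)%N = false); last by lia.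
by rewrite tail_sumW -(ce m) -/(e m) -natr1; ring.
Qed.

Lemma psi_odd m x i : (i < H)%N ->
  psi m x i.*2.+1 = e m * (W x + h x + (x i.*2.+1 + x i.*2.+2)).
Proof.
move=> iH; rewrite /psi /thetaf /= odd_double /= (_ : (i.*2.+1 == n.-1)%N = false); last by lia.
by rewrite tail_sumW -/(e m); ring.
Qed.

Lemma psi_even m x i : (i < H)%N ->
  psi m x i.*2.+2 = x i.*2.+1 + x i.*2.+2 + e m * x i.*2.+2.
Proof.
move=> iH; rewrite /psi /thetaf /= odd_double /= (_ : (i.*2.+2 == n.-1)%N = false); last by lia.
by rewrite -/(A m) -/(e m) mulrDl mulrAC Ae; ring.
Qed.

Lemma odd_lt i : (i < H)%N -> (i.*2.+1 < n)%N. Proof. by lia. Qed.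
Lemma even_lt i : (i < H)%N -> (i.*2.+2 < n)%N. Proof. by lia. Qed.
Lemma odd_last i : (i < H)%N -> (i.*2.+1 == n.-1) = false. Proof. by lia. Qed.
Lemma even_last i : (i < H)%N -> (i.*2.+2 == n.-1) = false. Proof. by lia. Qed.
Lemma last_lt : (n.-1 < n)%N. Proof. by lia. Qed.
Lemma first_lt : (0 < n)%N. Proof. by lia. Qed.
Lemma last_first : (n.-1 == 0%N) = false. Proof. by lia. Qed.
Lemma first_last : (0%N == n.-1) = false. Proof. by lia. Qed.
Lemma end_label k : (k < n)%N -> ~~ (0 < k < n.-1)%N -> k != 0%N -> k = n.-1. Proof. by lia. Qed.

Definition nonneg x := forall k, (k < n)%N -> 0 <= x k.

Lemma label_cases (Q : nat -> Prop) : Q 0%N -> Q n.-1 ->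
  (forall i, (i < H)%N -> Q i.*2.+1) -> (forall i, (i < H)%N -> Q i.*2.+2) ->
  forall k, (k < n)%N -> Q k.
Proof.
move=> q0 qn qo qe k kn; have [->//|k0] := eqVneq k 0%N.
have [->//|kn1] := eqVneq k n.-1; case ko: (odd k).
  by rewrite (_ : k = (k.-1./2).*2.+1)%N; [apply: qo|]; lia.
by rewrite (_ : k = (k.-1./2).*2.+2)%N; [apply: qe|]; lia.
Qed.

Section Step.
Variables (m : nat) (x : nat -> R).
Hypothesis x0 : nonneg x.

Lemma W_ge0 : 0 <= W x.
Proof. by apply: sumr_ge0 => i _; rewrite addr_ge0 // x0 //; have := ltn_ord i; lia. Qed.

Lemma h_ge0 : 0 <= h x. Proof. by apply: x0; lia. Qed.

Lemma pair_ge0 i : (i < H)%N -> 0 <= x i.*2.+1 /\ 0 <= x i.*2.+2.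
Proof. by move=> iH; split; apply: x0; lia. Qed.

Lemma psi_ge0 : nonneg (psi m x).
Proof.
have ee := e0 m; have W0 := W_ge0; have h0 := h_ge0; have x00 : 0 <= x 0%N by apply: x0; lia.
apply: label_cases => [||i iH|i iH]; rewrite ?psi_first ?psi_last ?psi_odd ?psi_even //.
- by rewrite addr_ge0 ?mulr_ge0 ?addr_ge0 // ltW.
- by rewrite addr_ge0 ?mulr_ge0 ?addr_ge0 // ltW.
- by have [? ?] := pair_ge0 iH; rewrite mulr_ge0 ?addr_ge0 // ltW.
- by have [? ?] := pair_ge0 iH; rewrite addr_ge0 ?mulr_ge0 ?addr_ge0 // ltW.
Qed.

(** With this, coordinate 0 of an image of [psi] never needs its own estimate: [W] and [h] control
    the whole vector. *)
Lemma psi_first_last : psi m x 0%N <= psi m x n.-1.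
Proof.
rewrite psi_first psi_last lerD2l mulrDl lerDl mulr_ge0 ?(ltW (e0 m)) //.
by rewrite addr_ge0 ?W_ge0 ?h_ge0.
Qed.

Lemma psi_pair i : (i < H)%N -> x i.*2.+1 + x i.*2.+2 <=
  psi m x i.*2.+1 + psi m x i.*2.+2 <=
  x i.*2.+1 + x i.*2.+2 + e m * (W x + h x + 2 * (x i.*2.+1 + x i.*2.+2)).
Proof.
move=> iH; rewrite psi_odd // psi_even //; have [h1 h2] := pair_ge0 iH.
have W0 := W_ge0; have h0 := h_ge0; have ee := e0 m.
set G := x i.*2.+1 + _; apply/andP; split.
  have -> : forall u v : R, u + (G + v) = G + (u + v) by move=> *; ring.
  by rewrite lerDl addr_ge0 // mulr_ge0 ?(ltW ee) // ?addr_ge0.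
have -> : forall u v w : R, u * v + (G + u * w) = G + u * (v + w) by move=> *; ring.
by rewrite lerD2l ler_wpM2l ?(ltW ee) // /G; lra.
Qed.

Lemma psi_W : W x <= W (psi m x) <= W x + z m ^+ 2 * (W x + h x).
Proof.
have W0 := W_ge0; have h0 := h_ge0; have ee := e0 m; apply/andP; split.
  by apply: ler_sum => i _; have /andP[] := psi_pair (ltn_ord i).
apply: (@le_trans _ _ (\sum_(i < H) (x i.*2.+1 + x i.*2.+2 +
    e m * (W x + h x + 2 * (x i.*2.+1 + x i.*2.+2))))).
  by apply: ler_sum => i _; have /andP[] := psi_pair (ltn_ord i).
rewrite big_split /= -/(W x) -mulr_sumr big_split /= -mulr_sumr -/(W x) lerD2l.
rewrite sumr_const card_ord -[_ *+ H]mulr_natl.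
(* The [H] pairs contribute [H * (W + h)] plus twice their own sum, at most [(H + 2) * (W + h)]; the
   bound [HP], a consequence of [p >= n + 1], absorbs the factor. *)
apply: (@le_trans _ _ (P * e m * (W x + h x))).
  have -> : P * e m * (W x + h x) = e m * (P * (W x + h x)) by ring.
  rewrite ler_wpM2l ?(ltW ee) //.
  have : (H%:R + 2) * (W x + h x) <= P * (W x + h x) by rewrite ler_wpM2r // addr_ge0.
  apply: le_trans; have -> : (H%:R + 2) * (W x + h x) = H%:R * (W x + h x) + 2 * (W x + h x) by ring.
  by rewrite lerD2l; lra.
by rewrite ler_wpM2r ?addr_ge0.
Qed.

Lemma psi_h : x 0%N <= h x ->
  h (psi m x) <= P^-1 * ((1 + z m ^+ 2) * (W x + h x) + z m ^+ 2 * h x).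
Proof.
move=> x0h; rewrite /h psi_last -/(h x).
have W0 := W_ge0; have h0 := h_ge0; have ee := e0 m; have pe := Pe m.
have eP : e m <= P^-1 * z m ^+ 2.
  by rewrite -(ler_pM2l P0) mulrA divff ?gt_eqF // mul1r.
have -> : P^-1 * ((1 + z m ^+ 2) * (W x + h x) + z m ^+ 2 * h x)
  = (P^-1 * z m ^+ 2) * h x + (P^-1 + P^-1 * z m ^+ 2) * (W x + h x) by ring.
apply: lerD; last by rewrite ler_wpM2r ?addr_ge0 // lerD2l.
apply: (@le_trans _ _ (e m * h x)); first by rewrite ler_wpM2l // ltW.
by rewrite ler_wpM2r.
Qed.

End Step.

(** * Bounds and monotone convergence of the normalised products *)

Definition weight j m : R := if j == n.-1 then P ^+ m else 1.

Definition unit_vec j : nat -> R := fun k => (k == j)%:R.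

(* [u j m d] is the normalised product of [Theta_m, ..., Theta_(m+d-1)] applied to [e_j];
   the weight [P ^ m] of the last label compensates the contraction of [e_1 + e_n]. *)
Fixpoint u j m d : nat -> R :=
  if d is d'.+1 then psi m (u j m.+1 d') else fun k => weight j m * unit_vec j k.

Let weight_gt0 j m : 0 < weight j m.
Proof. by rewrite /weight; case: ifP => // _; exact: exprn_gt0. Qed.

Lemma u_ge0 j m d : nonneg (u j m d).
Proof.
elim: d m => [|d IH] m k kn /=; last exact: psi_ge0.
by apply: mulr_ge0; [exact: ltW|exact: ler0n].
Qed.

Lemma u_first_last j m d : j != 0%N -> u j m d 0%N <= h (u j m d).
Proof.
case: d => [|d] j0; last by apply: psi_first_last; exact: u_ge0.
rewrite /h /= /unit_vec eq_sym (negbTE j0) mulr0.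
by apply: mulr_ge0; [exact: ltW|exact: ler0n].
Qed.

Lemma W_unit i : (i < H)%N -> W (unit_vec i.*2.+2) = 1.
Proof.
move=> iH; rewrite /W (bigD1 (Ordinal iH)) //= big1 ?addr0 /unit_vec.
  by rewrite eqxx (_ : (i.*2.+1 == i.*2.+2) = false) ?add0r //; lia.
move=> k; rewrite -val_eqE /= => ki.
have f1 : (k.*2.+1 == i.*2.+2) = false by lia.
have f2 : (k.*2.+2 == i.*2.+2) = false by lia.
by rewrite f1 f2 addr0.
Qed.

(** Induction on the depth with [m] free, because going one level deeper adds a matrix on the left.
    The bounds close thanks to [z m.+1 ^+ 2 <= z m ^+ 2 / 25], which leaves room for the new error
    of order [z m ^+ 2]. *)
Lemma u_even_bound i m d : (i < H)%N ->
  [/\ h (u i.*2.+2 m d) <= 2 * W (u i.*2.+2 m d),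
      W (u i.*2.+2 m d) <= 1 + 6 * z m ^+ 2 &
      forall k, (0 < k < n.-1)%N -> k != i.*2.+2 -> u i.*2.+2 m d k <= 35 * z m ^+ 2].
Proof.
move=> iH; set j := i.*2.+2; have jn : (j == n.-1) = false := even_last iH.
have sufE y m' : nonneg y ->
   (forall i', (i' < H)%N -> i' != i -> y i'.*2.+1 + y i'.*2.+2 <= 35 * z m' ^+ 2) ->
   y i.*2.+1 <= 35 * z m' ^+ 2 ->
   forall k, (0 < k < n.-1)%N -> k != j -> y k <= 35 * z m' ^+ 2.
  move=> y0 yp yo k kn kj; have kn' : (k < n)%N by lia.
  move: k kn' kn kj; apply: label_cases => [//|| i' iH'|i' iH'] kn kj.
  - by move: kn; rewrite ltnn andbF.
  - have [->//|ii] := eqVneq i' i.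
    by apply: le_trans (yp i' iH' ii); rewrite lerDl y0 // even_lt.
  - have ii : i' != i by apply: contraNneq kj => ->.
    by apply: le_trans (yp i' iH' ii); rewrite lerDr y0 // odd_lt.
(* For the other pairs the induction bounds the pair sum, not single coordinates, since the sum is
   what [psi] almost preserves. In pair [i] the sum stays near 1 and only the odd coordinate is
   small. *)
suff key : [/\ h (u j m d) <= 2 * W (u j m d), W (u j m d) <= 1 + 6 * z m ^+ 2,
   (forall i', (i' < H)%N -> i' != i -> u j m d i'.*2.+1 + u j m d i'.*2.+2 <= 35 * z m ^+ 2)
   & u j m d i.*2.+1 <= 35 * z m ^+ 2].
  by have [k1 k2 k3 k4] := key; split=> //; apply: sufE => //; exact: u_ge0.
elim: d m => [|d IH] m.
  have q0 : 0 <= z m ^+ 2 by rewrite sqr_ge0.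
  have uE : u j m 0 = unit_vec j by apply/funext => k /=; rewrite /weight jn mul1r.
  rewrite uE W_unit // /h /unit_vec eq_sym jn (_ : false%:R = 0 :> R) //; split; try lra.
  - move=> i' iH' ii.
    have f1 : (i'.*2.+1 == j) = false by rewrite /j; lia.
    have f2 : (i'.*2.+2 == j) = false by rewrite /j; lia.
    by rewrite f1 f2 (_ : false%:R = 0 :> R) //; lra.
  - have f1 : (i.*2.+1 == j) = false by rewrite /j; lia.
    by rewrite f1 (_ : false%:R = 0 :> R) //; lra.
have [K1 K2 K3 K4] := IH m.+1; have x0 := @u_ge0 j m.+1 d.
have xf := @u_first_last j m.+1 d isT.
rewrite /=; set x := u j m.+1 d in K1 K2 K3 K4 x0 xf *.
have W0 := W_ge0 x0; have h0 := h_ge0 x0.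
have /andP[W1 W2] := psi_W m x0; have H1 := psi_h m x0 xf.
have ee := e0 m; have pe := Pe m; have pi0 := Pi0; have pi5 := Pi5.
have q1 : z m ^+ 2 <= 1 by rewrite expr_le1 // ltW.
have q0 : 0 < z m ^+ 2 by rewrite exprn_gt0.
have qS : z m.+1 ^+ 2 <= 25^-1 * z m ^+ 2.
  rewrite zS exprMn mulrC ler_wpM2r ?(ltW q0) //.
  have -> : (25^-1 : R) = 5^-1 ^+ 2 by rewrite exprVn -natrX.
  by rewrite lerXn2r // nnegrE ?(ltW pi0) // invr_ge0.
have epq : e m <= 5^-1 * z m ^+ 2.
  apply: (@le_trans _ _ (P^-1 * z m ^+ 2)); last by rewrite ler_wpM2r // ltW.
  by rewrite -(ler_pM2l P0) mulrA divff ?gt_eqF // mul1r.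
move: q1 q0 qS epq W2 H1 K2 K3 K4; set q := z m ^+ 2; set q' := z m.+1 ^+ 2.
move=> q1 q0 qS epq W2 H1 K2 K3 K4.
have W7 : W x <= 7 by lra.
have qW : q * (W x + h x) <= 3 * (q * W x) by nra.
split.
- apply: (le_trans H1); apply: (@le_trans _ _ (5^-1 * ((1 + q) * (W x + h x) + q * h x))).
    by rewrite ler_wpM2r // addr_ge0 // mulr_ge0 ?addr_ge0 // ?(ltW q0).
  by nra.
- by apply: (le_trans W2); nra.
- move=> i' iH' ii; have /andP[_] := psi_pair m x0 iH'.
  have := K3 i' iH' ii; have [g1 g2] := pair_ge0 x0 iH'.
  set G := x i'.*2.+1 + x i'.*2.+2 => KG hG; apply: (le_trans hG).
  have : W x + h x + 2 * G <= 35 + 2 * G - 0 by lra.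
  have G35 : G <= 35 / 25 by apply: (le_trans KG); lra.
  by nra.
- rewrite psi_odd //; have [g1 g2] := pair_ge0 x0 iH.
  have GW : x i.*2.+1 + x i.*2.+2 <= W x.
    rewrite /W (bigD1 (Ordinal iH)) //= lerDl; apply: sumr_ge0 => k _.
    by have [? ?] := pair_ge0 x0 (ltn_ord k); rewrite addr_ge0.
  by nra.
Qed.

(** At level [m.+1] the last coordinate has size [P ^+ m.+1], and [z m ^+ 2] times it, namely
    [P * z m], leaks into the middle labels. This explains the factor [P] in the first bound. *)
Lemma u_last_bound m d :
  W (u n.-1 m d) <= 25 * P * z m /\ h (u n.-1 m d) * z m <= 1 + 14 * z m ^+ 2.
Proof.
elim: d m => [|d IH] m.
  have zz := z0 m; have pp := P0.
  have -> : W (u n.-1 m 0) = 0.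
    rewrite /W big1 // => i _ /=; have iH := ltn_ord i; rewrite /unit_vec.
    have f1 := odd_last iH.
    have f2 := even_last iH.
    by rewrite f1 f2 !mulr0 addr0.
  split; first by rewrite !mulr_ge0 // ltW.
  rewrite /h /= /weight /unit_vec eqxx mulr1 /z exprVn divff ?expf_neq0 ?gt_eqF //.
  by rewrite lerDl mulr_ge0 // sqr_ge0.
have [K1 K2] := IH m.+1; have x0 := @u_ge0 n.-1 m.+1 d.
have nn : n.-1 != 0%N by rewrite last_first.
have xf := @u_first_last n.-1 m.+1 d nn.
rewrite /=; set x := u n.-1 m.+1 d in K1 K2 x0 xf *.
have W0 := W_ge0 x0; have h0 := h_ge0 x0.
have /andP[_ W2] := psi_W m x0; have H1 := psi_h m x0 xf.
have pi0 := Pi0; have pi5 := Pi5; have p0 := P0; have p5 := P5.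
have zz0 := z0 m; have zz1 := z1 m.
rewrite zS in K1 K2.
move: zz0 zz1 W2 H1 K1 K2; set y := z m => y0 y1 W2 H1 K1 K2.
have PP : P * P^-1 = 1 by rewrite divff ?gt_eqF.
have {}K1 : W x <= 25 * y.
  by apply: (le_trans K1); rewrite le_eqVlt; apply/orP; left; apply/eqP; rewrite -[RHS]mulr1 -PP; ring.
have {}K2 : h x * y <= P + 14 * (P^-1 * y ^+ 2).
  have := ler_wpM2l (ltW p0) K2.
  have -> : P * (h x * (y * P^-1)) = h x * y * (P * P^-1) by ring.
  have -> : P * (1 + 14 * (y * P^-1) ^+ 2) = P + 14 * (P^-1 * y ^+ 2 * (P * P^-1)) by ring.
  by rewrite PP !mulr1.
have y2 : 0 < y ^+ 2 by rewrite exprn_gt0.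
have y21 : y ^+ 2 <= 1 by rewrite expr_le1 // ltW.
have Py : P^-1 * y ^+ 2 <= 5^-1 * y ^+ 2 by rewrite ler_wpM2r // ltW.
split.
  apply: (le_trans W2).
  have -> : W x + y ^+ 2 * (W x + h x) = W x * (1 + y ^+ 2) + y * (h x * y) by ring.
  apply: (@le_trans _ _ (25 * y * 2 + y * (P + 14))).
    apply: lerD; first by apply: ler_pM => //; lra.
    by rewrite ler_wpM2l ?(ltW y0) //; lra.
  have -> : 25 * y * 2 + y * (P + 14) = (64 + P) * y by ring.
  by rewrite ler_wpM2r ?(ltW y0) //; lra.
apply: (@le_trans _ _ (P^-1 * ((1 + y ^+ 2) * (W x * y) + (1 + 2 * y ^+ 2) * (h x * y)))).
  have := ler_wpM2r (ltW y0) H1; move/le_trans; apply.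
  by rewrite le_eqVlt; apply/orP; left; apply/eqP; ring.
have Wy : W x * y <= 25 * y ^+ 2 by rewrite expr2 mulrA ler_wpM2r // ltW.
apply: (@le_trans _ _ (P^-1 * ((1 + y ^+ 2) * (25 * y ^+ 2)
    + (1 + 2 * y ^+ 2) * (P + 14 * (P^-1 * y ^+ 2))))).
  apply: ler_wpM2l; first exact: ltW.
  by apply: lerD; apply: ler_wpM2l => //; lra.
have -> : P^-1 * ((1 + y ^+ 2) * (25 * y ^+ 2) + (1 + 2 * y ^+ 2) * (P + 14 * (P^-1 * y ^+ 2)))
  = 25 * (P^-1 * y ^+ 2) * (1 + y ^+ 2) + (1 + 2 * y ^+ 2) * (P * P^-1 + 14 * (P^-1 * (P^-1 * y ^+ 2))) by ring.
rewrite PP; have PPy : P^-1 * (P^-1 * y ^+ 2) <= 25^-1 * y ^+ 2.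
  apply: (@le_trans _ _ (5^-1 * (5^-1 * y ^+ 2))); last by lra.
  apply: ler_pM => //; first exact: ltW.
  by apply: mulr_ge0; exact: ltW.
move: y2 y21 Py PPy; set q := y ^+ 2; set b := P^-1 * q; set b' := P^-1 * b.
by move=> *; nra.
Qed.

(** A copy of [inS] on natural numbers; the two are convertible on ordinals, and proofs of [inS j]
    are passed below where [seed j] is expected. *)
Definition seed j := (j == n.-1) || (~~ odd j && (2 <= j)%N).

Lemma seed_cases (Q : nat -> Prop) : Q n.-1 -> (forall i, (i < H)%N -> Q i.*2.+2) ->
  forall j, (j < n)%N -> seed j -> Q j.
Proof.
move=> ql qe j jn /orP[/eqP-> //|/andP[jo j2]].
by rewrite (_ : j = (j.-2./2).*2.+2)%N; [apply: qe|]; lia.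
Qed.

Lemma coord_le_WH x k : nonneg x -> x 0%N <= h x -> (k < n)%N ->
  x k <= W x + h x /\ ((0 < k < n.-1)%N -> x k <= W x).
Proof.
move=> x0 xf kn; have W0 := W_ge0 x0; have h0 := h_ge0 x0.
have pairW i : (i < H)%N -> x i.*2.+1 + x i.*2.+2 <= W x.
  move=> iH; rewrite /W (bigD1 (Ordinal iH)) //= lerDl; apply: sumr_ge0 => i' _.
  by have [? ?] := pair_ge0 x0 (ltn_ord i'); rewrite addr_ge0.
move: k kn; apply: label_cases => [||i iH|i iH].
- by split=> //; lra.
- by split; [rewrite -/(h x); lra|rewrite ltnn andbF].
- by have := pairW _ iH; have [g1 g2] := pair_ge0 x0 iH; split=> [|_]; lra.
- by have := pairW _ iH; have [g1 g2] := pair_ge0 x0 iH; split=> [|_]; lra.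
Qed.

Lemma sum_WH x : \sum_(i < n) x i = x 0%N + (W x + h x).
Proof.
have nn : (0 < n)%N by lia.
rewrite -tail_sumW tail_sum1E // -(sum_ord_pick x nn) -big_split /=.
by apply: eq_bigr => i _; case: ifP => _; ring.
Qed.

Lemma W_le x y : (forall k, (k < n)%N -> x k <= y k) -> W x <= W y.
Proof. by move=> xy; apply: ler_sum => i _; have iH := ltn_ord i; apply: lerD; apply: xy; [exact: odd_lt|exact: even_lt]. Qed.

Lemma psi_le m x y : (forall k, (k < n)%N -> x k <= y k) ->
  forall k, (k < n)%N -> psi m x k <= psi m y k.
Proof.
move=> xy; have Wxy := W_le xy; have hxy : h x <= h y := xy _ last_lt.
have x0 : x 0%N <= y 0%N := xy _ first_lt.
have E := e0 m; have PP := Pi0.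
apply: label_cases => [||i iH|i iH].
- rewrite !psi_first; apply: lerD; first by rewrite ler_pM2l.
  by rewrite ler_pM2l //; lra.
- rewrite !psi_last; apply: lerD; first by rewrite ler_pM2l.
  by rewrite ler_pM2l //; lra.
- have := xy _ (odd_lt iH); have := xy _ (even_lt iH).
  by move=> h1 h2; rewrite !psi_odd // ler_pM2l //; lra.
- have := xy _ (odd_lt iH); have := xy _ (even_lt iH).
  move=> h1 h2; rewrite !psi_even //; apply: lerD; first by lra.
  by rewrite ler_pM2l.
Qed.

(** By [psi_le] it suffices to treat depth 0, where the single nonzero coordinate must not drop: the
    factor is [1 + e m] at a middle seed, and at the last label the factor [P^-1 + e m] is offset by
    the weight. At the labels outside [seed] that coordinate would fall to order [e m]. *)
Lemma u_mono j m d k : (j < n)%N -> seed j -> (k < n)%N -> u j m d k <= u j m d.+1 k.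
Proof.
move=> jn js; elim: d m k => [|d IH] m k kn; last first.
  by apply: psi_le => // i iH; exact: IH.
have [->{k kn}|kj] := eqVneq k j; last first.
  rewrite [leLHS]/= /unit_vec (negbTE kj) mulr0.
  exact: (@u_ge0 j m 1).
rewrite [leLHS]/= [leRHS]/= {1}/unit_vec eqxx mulr1.
have E := e0 m; have PP := Pi0.
move: j jn js; apply: seed_cases => [|i iH].
  rewrite psi_last /weight eqxx /h /unit_vec eqxx mulr1.
  rewrite (_ : (0%N == n.-1) = false) ?mulr0 ?add0r; last by lia.
  rewrite mulrDl; apply: (@le_trans _ _ (P^-1 * (P ^+ m.+1))).
    by rewrite exprS mulrA mulVf ?mul1r // gt_eqF.
  have W0 : 0 <= W (fun k => P ^+ m.+1 * (k == n.-1)%:R).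
    by apply: sumr_ge0 => i _; rewrite addr_ge0 // mulr_ge0 ?ler0n // exprn_ge0 // ltW.
  have P0' : 0 <= P ^+ m.+1 by rewrite exprn_ge0 // ltW.
  apply: (@le_trans _ _ (P^-1 * (W (fun k => P ^+ m.+1 * (k == n.-1)%:R) + P ^+ m.+1))).
    by rewrite ler_pM2l //; lra.
  by rewrite lerDl mulr_ge0 ?(ltW E) // addr_ge0.
rewrite psi_even // /weight (even_last iH) /unit_vec ?eqxx.
rewrite (_ : (i.*2.+1 == i.*2.+2) = false) ?mulr0 ?mulr1 ?add0r ?mul1r; last by lia.
by rewrite lerDl ltW.
Qed.

Definition mass_bound j : R := if j == n.-1 then 25 * P + 30 else 35.

Lemma weight_last m : weight n.-1 m * z m = 1.
Proof. by rewrite /weight eqxx /z exprVn divff // expf_neq0 // gt_eqF. Qed.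

Lemma u_last_h m d : h (u n.-1 m d) <= 15 * weight n.-1 m.
Proof.
have [_ hz] := u_last_bound m d; have zz := z0 m; have zz1 := z1 m.
rewrite -(ler_pM2r zz) -mulrA weight_last mulr1; apply: (le_trans hz).
have : z m ^+ 2 <= 1 by rewrite expr_le1 // ltW.
lra.
Qed.

Lemma u_mass j m d : (j < n)%N -> seed j -> \sum_(i < n) u j m d i <= mass_bound j * weight j m.
Proof.
move=> jn js; have x0 := @u_ge0 j m d.
have j0 : j != 0%N by move: js; rewrite /seed; lia.
have xf := @u_first_last j m d j0; rewrite sum_WH; have zz1 := z1 m; have zz := z0 m.
move: j jn js x0 xf {j0}; apply: seed_cases => [|i iH] x0 xf.
  have [W1 _] := u_last_bound m d; have H1 := u_last_h m d.
  rewrite /mass_bound eqxx mulrDl.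
  apply: (@le_trans _ _ (W (u n.-1 m d) + 30 * weight n.-1 m)); first by lra.
  rewrite lerD2r; apply: (le_trans W1); rewrite ler_wpM2l //; first by rewrite mulr_ge0 // ltW.
  rewrite /weight eqxx (le_trans zz1) // exprn_ege1 //; have := P5; lra.
have [h1 h2 _] := u_even_bound m d iH.
rewrite /mass_bound /weight (even_last iH) mulr1.
have : z m ^+ 2 <= 1 by rewrite expr_le1 // ltW.
lra.
Qed.

Definition ulim j m k : R := sup (range (fun d => u j m d k)).

Lemma u_bounded j m d k : (j < n)%N -> seed j -> (k < n)%N ->
  u j m d k <= mass_bound j * weight j m.
Proof.
move=> jn js kn; apply: le_trans (u_mass m d jn js).
rewrite (bigD1 (Ordinal kn)) //= lerDl; apply: sumr_ge0 => i _.
exact: (@u_ge0 j m d).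
Qed.

Lemma cvg_u j m k : (j < n)%N -> seed j -> (k < n)%N ->
  u j m d k @[d --> \oo] --> ulim j m k.
Proof.
move=> jn js kn; apply: nondecreasing_cvgn.
  by apply/nondecreasing_seqP => d; exact: u_mono.
by exists (mass_bound j * weight j m) => _ [d _ <-]; exact: u_bounded.
Qed.

Lemma ulim_le j m k b : (j < n)%N -> seed j -> (k < n)%N ->
  (forall d, u j m d k <= b) -> ulim j m k <= b.
Proof.
move=> jn js kn ub; apply: sup_le_ub; first by exists (u j m 0 k), 0%N.
by move=> _ [d _ <-].
Qed.

Lemma ulim_ge j m d k : (j < n)%N -> seed j -> (k < n)%N -> u j m d k <= ulim j m k.
Proof.
move=> jn js kn; apply: ub_le_sup; last by exists d.
by exists (mass_bound j * weight j m) => _ [i _ <-]; exact: u_bounded.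
Qed.

Lemma ulim_ge0 j m k : (j < n)%N -> seed j -> (k < n)%N -> 0 <= ulim j m k.
Proof.
move=> jn js kn; apply: le_trans (@ulim_ge j m 0 k jn js kn); exact: (@u_ge0 j m 0).
Qed.

Lemma ulim_psi j m k : (j < n)%N -> seed j -> (k < n)%N ->
  ulim j m k = psi m (ulim j m.+1) k.
Proof.
move=> jn js kn.
have c1' i : (i < n)%N -> u j m.+1 d i @[d --> \oo] --> ulim j m.+1 i by move=> iH; exact: cvg_u.
have cpsi : psi m (u j m.+1 d) k @[d --> \oo] --> psi m (ulim j m.+1) k.
  have cW : W (u j m.+1 d) @[d --> \oo] --> W (ulim j m.+1).
    apply: cvg_fin_sum => i; have iH := ltn_ord i.
    by apply: cvgD; apply: c1'; [exact: odd_lt|exact: even_lt].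
  have ch : h (u j m.+1 d) @[d --> \oo] --> h (ulim j m.+1) by apply: c1'; exact: last_lt.
  have c0 : u j m.+1 d 0%N @[d --> \oo] --> ulim j m.+1 0%N by apply: c1'; exact: first_lt.
  move: k kn; apply: label_cases => [||i iH|i iH].
  - under eq_fun do rewrite psi_first; rewrite psi_first.
    by apply: cvgD; apply: cvg_scale => //; exact: cvgD.
  - under eq_fun do rewrite psi_last; rewrite psi_last.
    by apply: cvgD; apply: cvg_scale => //; exact: cvgD.
  - under eq_fun do rewrite psi_odd //; rewrite psi_odd //.
    apply: cvg_scale; apply: cvgD; first exact: cvgD.
    by apply: cvgD; apply: c1'; [exact: odd_lt|exact: even_lt].
  - under eq_fun do rewrite psi_even //; rewrite psi_even //.
    apply: cvgD; first by apply: cvgD; apply: c1'; [exact: odd_lt|exact: even_lt].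
    by apply: cvg_scale; apply: c1'; exact: even_lt.
have cS : u j m d.+1 k @[d --> \oo] --> ulim j m k.
  by have := @cvg_u j m k jn js kn; rewrite -(cvg_shiftS (fun d => u j m d k)).
exact: (cvg_unique _ cS cpsi).
Qed.

Lemma ulim_even_bound i m k : (i < H)%N -> (k < n)%N -> k != i.*2.+2 ->
  ulim i.*2.+2 m k <= if (0 < k < n.-1)%N then 35 * z m ^+ 2 else 14.
Proof.
move=> iH kn ki; apply: ulim_le => // [||d]; rewrite /seed; try lia.
have [h1 h2 h3] := u_even_bound m d iH; case: ifP => [kk|kk]; first exact: h3.
have h14 : h (u i.*2.+2 m d) <= 14.
  have : z m ^+ 2 <= 1 by rewrite expr_le1 // ltW.
  lra.
have [->|k0] := eqVneq k 0%N; first exact: le_trans (u_first_last _ _ _) h14.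
by rewrite (end_label kn (negbT kk) k0).
Qed.

Lemma ulim_last_bound m k : (k < n.-1)%N ->
  ulim n.-1 m k <= if (0 < k)%N then 25 * P * z m else 15 * weight n.-1 m.
Proof.
move=> kn; apply: ulim_le => [|||d]; rewrite /seed ?eqxx //; try lia.
have nn : n.-1 != 0%N by rewrite last_first.
have xf := @u_first_last n.-1 m d nn.
have [W1 _] := u_last_bound m d; case: ifP => k0.
  apply: le_trans W1; have kn' : (k < n)%N by lia.
  by have [_ hk] := coord_le_WH (@u_ge0 n.-1 m d) xf kn'; apply: hk; lia.
by rewrite (_ : k = 0%N); [exact: le_trans xf (u_last_h m d)|lia].
Qed.

(** * Column sums of the products and concentration on one column *)

Local Notation E := (thetaprod R n p c1).
Definition vcol x : 'cV[R]_n := \col_(i < n) x i.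

Definition rho m x : R := \sum_i (E m *m vcol x) i 0.
(** The [k]-th column sum of [E m], written as [rho] of a basis vector so that [rhoS] yields its
    recursion in [m]. *)
Definition csum m k : R := rho m (unit_vec k).
Let pA m : R := \prod_(i < m) A i.

Let pA0 m : 0 < pA m. Proof. by apply: prodr_gt0 => i _; exact: A0. Qed.
Let pAS m : pA m.+1 = pA m * A m. Proof. exact: big_ord_recr. Qed.

Lemma Theta_psi m x : Theta R n (a m) (c m) *m vcol x = A m *: vcol (psi m x).
Proof.
rewrite Theta_mul_col; apply/matrixP => i j.
by rewrite !mxE /psi mulrCA divff ?mulr1 // gt_eqF.
Qed.

Lemma thetaprod_ge0 m (i k : 'I_n) : 0 <= E m i k.
Proof.
elim: m i k => [|m IH] i k /=; first by rewrite mxE ler0n.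
rewrite mxE; apply: sumr_ge0 => l _; rewrite mulr_ge0 // mxE.
by do !case: ifP => _; rewrite ?ler0n.
Qed.

Lemma rhoE m x : rho m x = \sum_(k < n) (\sum_i E m i k) * x k.
Proof.
rewrite /rho; under eq_bigr do rewrite mxE; rewrite exchange_big /=.
by apply: eq_bigr => k _; rewrite mulr_suml; apply: eq_bigr => i _; rewrite mxE.
Qed.

Lemma csumE m (k : 'I_n) : csum m k = \sum_i E m i k.
Proof.
rewrite /csum rhoE (bigD1 k) //= /unit_vec eqxx mulr1 [X in _ + X]big1 ?addr0 // => j jk.
by rewrite val_eqE (negbTE jk) mulr0.
Qed.

Lemma rho_csum m x : rho m x = \sum_(k < n) csum m k * x k.
Proof. by rewrite rhoE; apply: eq_bigr => k _; rewrite csumE. Qed.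

Lemma rho0 x : rho 0 x = \sum_(k < n) x k.
Proof. by rewrite /rho mul1mx; apply: eq_bigr => i _; rewrite mxE. Qed.

Lemma rhoS m x : rho m.+1 x = A m * rho m (psi m x).
Proof.
rewrite /rho /= -mulmxA Theta_psi -scalemxAr mulr_sumr.
by apply: eq_bigr => i _; rewrite mxE.
Qed.

Lemma rho_le m x y : (forall k, (k < n)%N -> x k <= y k) -> rho m x <= rho m y.
Proof.
move=> xy; rewrite !rhoE; apply: ler_sum => k _; rewrite ler_wpM2l ?xy //.
by apply: sumr_ge0 => i _; exact: thetaprod_ge0.
Qed.

Lemma unit_vec_ge0 k : nonneg (unit_vec k).
Proof. by move=> i _; exact: ler0n. Qed.

Lemma csum_ge0 m k : 0 <= csum m k.
Proof.
rewrite /csum rhoE; apply: sumr_ge0 => i _; rewrite mulr_ge0 ?ler0n //.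
by apply: sumr_ge0 => j _; exact: thetaprod_ge0.
Qed.

Lemma thetaprod_u j m d : E m *m vcol (u j m d) = pA m *: vcol (u j 0 (m + d)).
Proof.
elim: m d => [|m IH] d; first by rewrite mul1mx /pA big_ord0 scale1r.
rewrite /= -mulmxA Theta_psi -scalemxAr -[psi m _]/(u j m d.+1) IH scalerA.
by rewrite pAS mulrC addnS.
Qed.

Lemma csum_weight j m : csum m j * weight j m = pA m * \sum_(i < n) u j 0 m i.
Proof.
transitivity (rho m (u j m 0)).
  rewrite /csum !rhoE mulr_suml; apply: eq_bigr => k _ /=; ring.
rewrite /rho thetaprod_u addn0 mulr_sumr; apply: eq_bigr => i _.
by rewrite !mxE.
Qed.

Lemma csum_seed j m : (j < n)%N -> seed j -> csum m j * weight j m <= pA m * mass_bound j.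
Proof.
move=> jn js; rewrite csum_weight ler_wpM2l ?(ltW (pA0 m)) //.
have := u_mass 0 m jn js; rewrite /weight expr0.
by case: ifP => _; rewrite mulr1.
Qed.

Lemma W_unit_odd i : (i < H)%N -> W (unit_vec i.*2.+1) = 1.
Proof.
move=> iH; rewrite /W (bigD1 (Ordinal iH)) //= big1 ?addr0 /unit_vec.
  by rewrite eqxx (_ : (i.*2.+2 == i.*2.+1) = false) ?addr0 //; lia.
move=> k; rewrite -val_eqE /= => ki.
have f1 : (k.*2.+1 == i.*2.+1) = false by lia.
have f2 : (k.*2.+2 == i.*2.+1) = false by lia.
by rewrite f1 f2 addr0.
Qed.

Lemma W_unit_out k : (k == 0%N) || (k == n.-1) -> W (unit_vec k) = 0.
Proof.
move=> kk; rewrite /W big1 // => i _; have iH := ltn_ord i; rewrite /unit_vec.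
have f1 : (i.*2.+1 == k) = false by lia.
have f2 : (i.*2.+2 == k) = false by lia.
by rewrite f1 f2 addr0.
Qed.

(** Odd labels lie outside [seed], so [csum_seed] does not reach them. But a single matrix already
    sends [unit_vec i.*2.+1] below the image of [unit_vec i.*2.+2], coordinate by coordinate. *)
Lemma csum_odd m i : (i < H)%N -> csum m i.*2.+1 <= csum m i.*2.+2.
Proof.
move=> iH; case: m => [|m].
  rewrite /csum !rho0 !sum_WH W_unit // W_unit_odd // /h /unit_vec.
  have f1 : (n.-1 == i.*2.+1) = false by lia.
  have f2 : (n.-1 == i.*2.+2) = false by lia.
  by rewrite f1 f2.
rewrite /csum !rhoS ler_pM2l //; apply: rho_le.
have hh : h (unit_vec i.*2.+1) = h (unit_vec i.*2.+2).
  rewrite /h /unit_vec.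
  have f1 : (n.-1 == i.*2.+1) = false by lia.
  have f2 : (n.-1 == i.*2.+2) = false by lia.
  by rewrite f1 f2.
have pp k : unit_vec i.*2.+1 k.*2.+1 + unit_vec i.*2.+1 k.*2.+2
    = unit_vec i.*2.+2 k.*2.+1 + unit_vec i.*2.+2 k.*2.+2.
  rewrite /unit_vec !eqSS addrC (_ : (k.*2 == i.*2) = (k == i)); last by lia.
  have f1 : (k.*2.+1 == i.*2) = false by lia.
  have f2 : (k.*2 == i.*2.+1) = false by lia.
  by rewrite f1 f2.
apply: label_cases => [||k kH|k kH].
- by rewrite !psi_first W_unit // W_unit_odd // hh.
- by rewrite !psi_last W_unit // W_unit_odd // hh.
- by rewrite !psi_odd // W_unit // W_unit_odd // hh pp.
- rewrite !psi_even // pp lerD2l ler_wpM2l ?(ltW (e0 m)) // /unit_vec.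
  have f2 : (k.*2.+2 == i.*2.+1) = false by lia.
  by rewrite f2 ler0n.
Qed.

Lemma psi_unit0 m k : (k < n)%N -> A m * psi m (unit_vec 0) k = unit_vec 0 k + unit_vec n.-1 k.
Proof.
have h0 : h (unit_vec 0) = 0.
  by rewrite /h /unit_vec (_ : (n.-1 == 0)%N = false) //; lia.
have W0 : W (unit_vec 0) = 0 by apply: W_unit_out.
have n1 := last_first.
have n2 := first_last.
move: k; apply: label_cases => [||k kH|k kH].
- rewrite psi_first W0 h0 addr0 mulr0 addr0 /unit_vec eqxx n2 mulr1 Ae addr0 //.
- rewrite psi_last W0 h0 addr0 mulr0 addr0 /unit_vec eqxx n1 eqxx mulr1 Ae add0r //.
- rewrite psi_odd // W0 h0 /unit_vec.
  have f2 := odd_last kH.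
  by rewrite f2 !addr0 !mulr0.
- rewrite psi_even // /unit_vec.
  have f2 := even_last kH.
  by rewrite f2 !addr0 !mulr0 addr0 mulr0.
Qed.

(** Column 0 attains equality; in any other column the two end rows contain [c m] and [(c m).+1],
    which are at least 1. This drives the exponential growth of all column sums. *)
Lemma psi_unit_ge m k i : (k < n)%N -> (i < n)%N ->
  unit_vec 0 i + unit_vec n.-1 i <= A m * psi m (unit_vec k) i.
Proof.
have n1 := last_first.
have n2 := first_last.
have [->|k0] := eqVneq k 0%N; first by move=> _ kn; rewrite psi_unit0.
move=> kn; have u0 : unit_vec k 0 = 0 by rewrite /unit_vec eq_sym (negbTE k0).
have T1 : W (unit_vec k) + h (unit_vec k) = 1.
  have -> : W (unit_vec k) + h (unit_vec k) = \sum_(i < n) unit_vec k i.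
    by rewrite sum_WH u0 add0r.
  rewrite (bigD1 (Ordinal kn)) //= {1}/unit_vec eqxx big1 ?addr0 // => j.
  by rewrite -val_eqE /= /unit_vec => /negbTE ->.
have Ap : A m * P^-1 = (c m)%:R.
  by rewrite A_c mulrAC divff ?mul1r // gt_eqF.
have cm1 : 1 <= (c m)%:R :> R by rewrite ler1n.
have psi0 j : (j < n)%N -> 0 <= psi m (unit_vec k) j.
  by apply: psi_ge0; exact: unit_vec_ge0.
move: i; apply: label_cases => [||i iH|i iH].
- by rewrite psi_first T1 u0 mulr0 add0r mulr1 Ap {1 2}/unit_vec eqxx n2 addr0.
- rewrite psi_last T1 u0 mulr0 add0r mulr1 mulrDr Ap Ae {1 2}/unit_vec eqxx n1 add0r.
  by rewrite lerDr ler0n.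
- have f2 := odd_last iH.
  by rewrite {1 2}/unit_vec f2 addr0 mulr_ge0 ?(ltW (A0 m)) // psi0 // ?odd_lt ?even_lt.
- have f2 := even_last iH.
  by rewrite {1 2}/unit_vec f2 addr0 mulr_ge0 ?(ltW (A0 m)) // psi0 // ?odd_lt ?even_lt.
Qed.

Lemma rhoD m x y : rho m (fun k => x k + y k) = rho m x + rho m y.
Proof. by rewrite !rhoE -big_split; apply: eq_bigr => k _; rewrite mulrDr. Qed.

Lemma rhoZ m b x : rho m (fun k => b * x k) = b * rho m x.
Proof. by rewrite !rhoE mulr_sumr; apply: eq_bigr => k _; rewrite mulrCA. Qed.

Lemma csum_firstS m : csum m.+1 0 = csum m 0 + csum m n.-1.
Proof.
rewrite /csum rhoS -rhoZ -rhoD !rhoE; apply: eq_bigr => k _.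
by rewrite psi_unit0.
Qed.

Lemma csum_geS m k : (k < n)%N -> csum m 0 + csum m n.-1 <= csum m.+1 k.
Proof.
move=> kn; rewrite /csum rhoS -rhoZ -rhoD; apply: rho_le => i iH; exact: psi_unit_ge.
Qed.

Lemma csum_first m : csum m 0 <= csum m n.-1.
Proof.
case: m => [|m]; last by rewrite csum_firstS csum_geS //; lia.
have n1 := last_first.
have n2 := first_last.
rewrite /csum !rho0 !sum_WH !W_unit_out ?eqxx ?orbT // /h /unit_vec !eqxx n1 n2.
by rewrite !add0r addr0.
Qed.

Lemma csum_growth m k : (k < n)%N -> 2 ^+ m <= csum m k.
Proof.
elim: m k => [|m IH] k kn.
  rewrite /csum rho0 (bigD1 (Ordinal kn)) //= {1}/unit_vec eqxx expr0 lerDl.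
  by apply: sumr_ge0 => i _; exact: ler0n.
apply: le_trans (csum_geS m kn); rewrite exprS mulrDl mul1r.
by apply: lerD; apply: IH; lia.
Qed.

(** The mass bound for [j = n.-1] concerns the column multiplied by [P ^+ m]; removing this weight
    leaves the factor [z m]. *)
Lemma csum_last m : csum m n.-1 <= pA m * ((25 * P + 30) * z m).
Proof.
have zz := z0 m; have zz' : z m != 0 by rewrite gt_eqF.
have nn := last_lt.
have sn : seed n.-1 by rewrite /seed eqxx.
have := csum_seed m nn sn; rewrite -(ler_pM2r zz) -mulrA weight_last mulr1.
by rewrite /mass_bound eqxx mulrA.
Qed.

Lemma csum_mid m k : (0 < k < n.-1)%N -> csum m k <= pA m * 35.
Proof.
move=> kn; have ev i : (i < H)%N -> csum m i.*2.+2 <= pA m * 35.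
  move=> iH; have jn := even_lt iH.
  have js : seed i.*2.+2 by rewrite /seed; lia.
  have f := even_last iH.
  by have := csum_seed m jn js; rewrite /mass_bound /weight f mulr1.
have kn' : (k < n)%N by lia.
move: k kn' kn; apply: label_cases => [//||i iH|i iH] kn.
- by move: kn; rewrite ltnn andbF.
- exact: le_trans (csum_odd m iH) (ev i iH).
- exact: ev.
Qed.

(** The factor [z m.+1] comes from the coordinate when [k] is a middle label, and from the column
    sum when [k] is an end label and [j] a middle seed. *)
Lemma csum_ulim_decay j k : (j < n)%N -> seed j -> (k < n)%N -> k != j ->
  exists2 K : R, 0 <= K &
    forall m, csum m.+1 k * ulim j m.+1 k <= pA m.+1 * (K * z m.+1).
Proof.
move=> jn js kn kj; have p0 := P0.
have U0 m : 0 <= ulim j m k by exact: ulim_ge0.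
move: j jn js kj U0; apply: seed_cases => [|i iH] kj U0; last first.
  have [km|km] := boolP (0 < k < n.-1)%N.
    exists (35 * 35) => [|m]; first by lra.
    have zz := z0 m.+1; have zz1 := z1 m.+1.
    have UB := ulim_even_bound m.+1 iH kn kj; rewrite km in UB.
    have {}UB : ulim i.*2.+2 m.+1 k <= 35 * z m.+1.
      apply: (le_trans UB); rewrite ler_wpM2l // expr2 -[leRHS]mulr1 ler_wpM2l // ltW //.
    have := ler_pM (csum_ge0 m.+1 k) (U0 m.+1) (csum_mid m.+1 km) UB.
    by move/le_trans; apply; rewrite le_eqVlt; apply/orP; left; apply/eqP; ring.
  exists ((25 * P + 30) * 14) => [|m]; first by rewrite mulr_ge0 //; lra.
  have UB := ulim_even_bound m.+1 iH kn kj; rewrite (negbTE km) in UB.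
  have CB : csum m.+1 k <= pA m.+1 * ((25 * P + 30) * z m.+1).
    apply: le_trans (csum_last m.+1); have [->|k0] := eqVneq k 0%N; first exact: csum_first.
    by rewrite (end_label kn km k0).
  have := ler_pM (csum_ge0 m.+1 k) (U0 m.+1) CB UB.
  by move/le_trans; apply; rewrite le_eqVlt; apply/orP; left; apply/eqP; ring.
have kn1 : (k < n.-1)%N by lia.
have [km|km] := boolP (0 < k)%N.
  exists (35 * (25 * P)) => [|m]; first by rewrite mulr_ge0 //; lra.
  have UB := ulim_last_bound m.+1 kn1; rewrite km in UB.
  have km' : (0 < k < n.-1)%N by lia.
  have := ler_pM (csum_ge0 m.+1 k) (U0 m.+1) (csum_mid m.+1 km') UB.
  by move/le_trans; apply; rewrite le_eqVlt; apply/orP; left; apply/eqP; ring.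
have k0 : k = 0%N by lia.
exists (30 * (25 * P + 30) * P) => [|m]; first by rewrite !mulr_ge0 //; lra.
have UB := ulim_last_bound m.+1 kn1; rewrite (negbTE km) in UB.
(* For [j = n.-1] and [k = 0] the coordinate may have size [P ^+ m.+1], which cancels the smallness
   of the column. The gain is that column 0 at stage [m.+1] is a sum of two columns of stage [m], so
   it lacks the factor [A m] of [pA m.+1]; hence the statement at [m.+1]. *)
have CB : csum m.+1 k <= 2 * (pA m * ((25 * P + 30) * z m)).
  rewrite k0 csum_firstS; have := csum_first m; have := csum_last m.
  by set b := csum m 0; set b' := csum m n.-1; lra.
have := ler_pM (csum_ge0 m.+1 k) (U0 m.+1) CB UB.
move/le_trans; apply.
have wz : weight n.-1 m.+1 * z m = P.
  have zP : z m = z m.+1 * P by rewrite zS -mulrA mulVf ?mulr1 // gt_eqF.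
  by rewrite zP mulrA weight_last mul1r.
have -> : 2 * (pA m * ((25 * P + 30) * z m)) * (15 * weight n.-1 m.+1)
   = pA m * (30 * (25 * P + 30)) * P by rewrite -[X in _ = _ * X]wz; ring.
rewrite pAS zS; set z' := z m.
have -> : pA m * A m * (30 * (25 * P + 30) * P * (z' * P^-1)) =
  pA m * (30 * (25 * P + 30)) * (A m * z' * (P * P^-1)) by ring.
rewrite divff ?gt_eqF // mulr1 ler_wpM2l //.
  by apply: mulr_ge0; [exact/ltW/pA0|lra].
rewrite -(ler_pM2r (e0 m)) mulrAC Ae mul1r.
apply: (le_trans (Pe m)); rewrite expr2 -[leRHS]mulr1 ler_wpM2l //; exact/ltW/z0.
Qed.

Let T j : R := \sum_(i < n) ulim j 0 i.

Let T0 j : (j < n)%N -> seed j -> 0 < T j.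
Proof.
move=> jn js; apply: (@lt_le_trans _ _ (ulim j 0 j)).
  apply: lt_le_trans (@ulim_ge j 0 0 j jn js jn).
  by rewrite /= /unit_vec eqxx mulr1.
rewrite /T (bigD1 (Ordinal jn)) //= lerDl; apply: sumr_ge0 => i _.
exact: ulim_ge0.
Qed.

(** The preimage of the limit direction [L_j] under [E m]: dividing by [pA m] undoes the
    normalisation in [psi], and dividing by [T j] gives total mass 1 at stage 0. *)
Definition cone_vec j m : 'cV[R]_n := vcol (fun k => ulim j m k / (pA m * T j)).

Section ConeVec.
Variable j : 'I_n.
Hypothesis js : inS j.
Let jn : (j < n)%N := ltn_ord j.

Lemma cone_vec_step m : cone_vec j m = Theta R n (a m) (c m) *m cone_vec j m.+1.
Proof.
have Tj := T0 jn js.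
have -> : cone_vec j m.+1 = (pA m.+1 * T j)^-1 *: vcol (ulim j m.+1).
  by apply/matrixP => i k; rewrite !mxE mulrC.
rewrite -scalemxAr Theta_psi scalerA; apply/matrixP => i k; rewrite !mxE.
rewrite (ulim_psi m jn js (ltn_ord i)) pAS mulrC; congr (_ * _).
have A00 : A m != 0 by rewrite gt_eqF.
have p00 : pA m != 0 by rewrite gt_eqF.
have T00 : T j != 0 by rewrite gt_eqF.
by field; rewrite A00 p00 T00.
Qed.

Lemma cone_vec_ge0 m k : 0 <= cone_vec j m k 0.
Proof.
rewrite mxE; apply: divr_ge0; first exact: ulim_ge0.
by apply: mulr_ge0; [exact/ltW/pA0|exact/ltW/T0].
Qed.

Lemma cone_vec_sum : \sum_k cone_vec j 0 k 0 = 1.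
Proof.
under eq_bigr do rewrite mxE; rewrite -mulr_suml -/(T j) /pA big_ord0 mul1r divff //.
by rewrite gt_eqF ?T0.
Qed.

Lemma cone_vec_cvg : normv (E m *m delta_mx j 0) @[m --> \oo] --> cone_vec j 0.
Proof.
have -> : (fun m => normv (E m *m delta_mx j 0)) = (fun m => normv (vcol (u j 0 m))).
  apply/funext => m; have wj : weight j m != 0 by rewrite gt_eqF.
  have pj : pA m != 0 by rewrite gt_eqF.
  have dE : weight j m *: (delta_mx j 0 : 'cV[R]_n) = vcol (u j m 0).
    by apply/matrixP => i k; rewrite !mxE ord1 eqxx andbT.
  by rewrite -(normv_scale _ wj) scalemxAr dE thetaprod_u addn0 normv_scale.
apply: cvg_cV => i; rewrite mxE /pA big_ord0 mul1r mulrC.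
under eq_fun do rewrite /normv !mxE.
apply: cvgM; last exact: cvg_u.
apply: cvgV; first by rewrite gt_eqF ?T0.
rewrite /T; under eq_fun do under eq_bigr do rewrite mxE.
by apply: cvg_fin_sum => k; exact: cvg_u.
Qed.

(** The quantity is the share of the total mass 1 that column [k] of [E m] contributes to [L_j]. *)
Lemma cone_vec_decay (k : 'I_n) : k != j -> csum m k * cone_vec j m k 0 @[m --> \oo] --> 0.
Proof.
move=> kj; have Tj := T0 jn js.
have [K K0 HK] := csum_ulim_decay jn js (ltn_ord k) kj.
have zc : (K / T j * z m.+1) @[m --> \oo] --> 0.
  rewrite -[X in _ --> X](mulr0 (K / T j)); apply: cvg_scale.
  rewrite (cvg_shiftS z); apply: cvg_expr.
  by rewrite ger0_norm ?(ltW Pi0) // (le_lt_trans Pi5) //; lra.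
rewrite -(cvg_shiftS (fun m => csum m k * cone_vec j m k 0)).
apply: (squeeze_cvgr _ (cvg_cst _) zc); near=> m; apply/andP; split.
  by rewrite mulr_ge0 ?csum_ge0 ?cone_vec_ge0.
rewrite /= /cone_vec /vcol mxE mulrA ler_pdivrMr; last by rewrite mulr_gt0.
apply: (le_trans (HK m)); rewrite le_eqVlt; apply/orP; left; apply/eqP.
have T00 : T j != 0 by rewrite gt_eqF.
by field.
Unshelve. all: by end_near. Qed.

End ConeVec.

End Cone.

(** * Ergodic measures *)

Lemma perm_bot0 n : (2 <= n)%N -> ~~ odd n -> perm_eq (bot0 n) (iota 0 n).
Proof.
move=> n2 no; have hE : ((n - 2)./2.*2.+2 = n)%N by lia.
have botE : bot0 n = (n - 1)%N :: pairs 1 (n - 2)./2 ++ [:: 0%N] by [].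
have sP i j : size (pairs i j) = j.*2.
  by elim: j i => //= j IH i; rewrite /pairs /= -/(pairs _ _) IH.
have um i j : uniq (pairs i.+1 j).
  elim: j i => //= j IH i; rewrite /pairs /= -/(pairs i.+2 j) IH inE !mem_pairs.
  by lia.
apply: uniq_perm; last 1 first.
- move=> k; rewrite botE inE mem_cat (mem_pairs _ 0) inE mem_iota; lia.
- rewrite botE /= cat_uniq um /= mem_cat !inE !(mem_pairs _ 0); lia.
- exact: iota_uniq.
Qed.

Section Main.
Variables (R : realType) (n p c1 : nat) (lam : 'I_n -> R).
Hypotheses (n4 : (4 <= n)%N) (neven : ~~ odd n) (np : (n.+1 <= p)%N) (c10 : (0 < c1)%N).
Hypothesis lam0 : forall i, 0 < lam i.
Hypothesis lam1 : \sum_i lam i = 1.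
Hypothesis path : forall m, rauzy_types (size (Wpre n p c1 m)) (init_state lam)
  = Some (Wpre n p c1 m).

Local Notation s := (init_state lam).
Local Notation T := (iet lam).
Local Notation E := (thetaprod R n p c1).
Local Notation V := (cone_vec R n p c1).
Local Notation C := (csum R n p c1).
Local Notation col x := (vcol n x).
Let W := Wpre n p c1.

Let n2 : (2 <= n)%N. Proof. lia. Qed.

Let ws : wf n s.
Proof.
split=> //=; first exact: perm_bot0.
by move=> k kn; rewrite (insubT (fun i => (i < n)%N) kn) /=.
Qed.

Let gW m : good (W m) s. Proof. exact/rauzy_types_good/path. Qed.

Let W_prefix m m' : (m <= m')%N -> exists B, W m' = W m ++ B.
Proof.
move=> mm; rewrite /W /Wpre -(subnKC mm) iotaD map_cat flatten_cat.
by eexists.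
Qed.

Let W_S m : W m.+1 = W m ++ gamma n (aseq p c1 m) (cseq p c1 m).
Proof. by rewrite /W /Wpre -[m.+1]addn1 iotaD map_cat flatten_cat /= cats0. Qed.

Lemma run_W m f : exists g, run (W m) (RS (top0 n) (bot0 n) f) = RS (top0 n) (bot0 n) g /\
  col f = E m *m col g.
Proof.
elim: m f => [|m IH] f; first by exists f; rewrite mul1mx.
have [g [Eg fg]] := IH f.
have [g' [Eg' gg']] := run_gamma (aseq p c1 m) (cseq p c1 m) g n2 neven.
by exists g'; rewrite W_S run_cat Eg Eg' fg /= -mulmxA -gg'.
Qed.

Lemma vrun_W m v : col v = E m *m col (vrun (W m) s v).
Proof. by rewrite /vrun /with_lam; have [g [-> ->]] := run_W m v. Qed.

Lemma thetaprod_inj m (x y : 'cV[R]_n) : E m *m x = E m *m y -> x = y.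
Proof.
elim: m x y => [|m IH] x y; first by rewrite !mul1mx.
rewrite /= -!mulmxA => /IH xy; apply/eqP; rewrite -subr_eq0; apply/eqP.
pose f k := oapp (fun i => (x - y) i 0) 0 (insub k).
have fE : x - y = \col_(i < n) f i.
  by apply/matrixP => i j; rewrite ord1 [RHS]mxE /f valK.
have /(Theta_inj n4 neven) f0 :
    Theta R n (aseq p c1 m) (cseq p c1 m) *m \col_(i < n) f i = 0.
  by rewrite -fE mulmxBr xy subrr.
by rewrite fE; apply/matrixP => i j; rewrite !mxE f0.
Qed.

Lemma tot_run m (x : nat -> R) : tot (rtop (run (W m) s)) x = \sum_(i < n) x i.
Proof.
have [pt _ _] := wf_run ws (gW m); rewrite (tot_perm _ pt) /tot.
by rewrite (_ : iota 0 n = index_iota 0 n) ?big_mkord // /index_iota subn0.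
Qed.

Lemma sum_csum m (v : nat -> R) : \sum_(i < n) v i = \sum_(k < n) C m k * vrun (W m) s v k.
Proof.
rewrite -rho_csum /rho -vrun_W; apply: eq_bigr => i _; by rewrite mxE.
Qed.

(** The fixed total at stage 0 is the sum of the stage [m] coordinates weighted by column sums, each
    at least [2 ^+ m]. *)
Lemma small_mass (v : nat -> R) : (forall m k, (k < n)%N -> 0 <= vrun (W m) s v k) ->
  forall e : R, 0 < e -> exists m, tot (rtop (run (W m) s)) (vrun (W m) s v) <= e.
Proof.
move=> v0 e e0; set S := \sum_(i < n) v i.
have S0 : 0 <= S by apply: sumr_ge0 => i _; exact: (v0 0%N).
have Sm m : tot (rtop (run (W m) s)) (vrun (W m) s v) <= S / 2 ^+ m.
  rewrite tot_run ler_pdivlMr ?exprn_gt0 // /S (sum_csum m v) mulr_suml.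
  apply: ler_sum => k _; rewrite [leLHS]mulrC; apply: ler_wpM2r; first exact: v0.
  exact: csum_growth.
exists (Num.Def.truncn (S / e)).+1; apply: (le_trans (Sm _)).
rewrite ler_pdivrMr ?exprn_gt0 // mulrC -ler_pdivrMr //.
set N := Num.Def.truncn _; apply: (@le_trans _ _ N.+1%:R).
  by apply: ltW; rewrite /N truncnS_gt.
by rewrite -natrX ler_nat ltnW // ltn_expl.
Qed.

Section Seed.
Variable j : 'I_n.
Hypothesis js : inS j.
Let jn : (j < n)%N := ltn_ord j.
Let v k : R := oapp (fun i => V j 0 i 0) 0 (insub k).

Let vE (i : 'I_n) : v i = V j 0 i 0. Proof. by rewrite /v valK. Qed.

Lemma cone_vec_prod m : V j 0 = E m *m V j m.
Proof.
elim: m => [|m IH]; first by rewrite mul1mx.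
by rewrite IH (cone_vec_step R n4 neven np c10 js) /= mulmxA.
Qed.

Lemma vrun_cone m (k : 'I_n) : vrun (W m) s v k = V j m k 0.
Proof.
have -> : V j m = col (vrun (W m) s v).
  apply: (@thetaprod_inj m); rewrite -vrun_W -cone_vec_prod.
  by apply/matrixP => i l; rewrite ord1 [RHS]mxE vE.
by rewrite mxE.
Qed.

Let vrun0 m k : (k < n)%N -> 0 <= vrun (W m) s v k.
Proof.
move=> kn; rewrite -[k]/(nat_of_ord (Ordinal kn)) vrun_cone.
exact: (cone_vec_ge0 R n4 neven np c10 js).
Qed.

Lemma seed_measure : exists mu : probability R R, inv_prob T mu /\
  forall i : 'I_n, fun_vec s (lcdf mu) i = v i.
Proof.
have [F [F1 F2 F3 F4 [F5 F6]]] := inv_fun_exists ws gW W_prefix vrun0 (small_mass vrun0).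
have [pt _ _] := ws.
have F4' x : 1 <= x -> F x = 1.
  move=> x1; rewrite F4; last by rewrite (tot_init lam1 pt).
  have := tot_run 0 v; rewrite /= => ->.
  under eq_bigr do rewrite vE; exact: (cone_vec_sum R n4 neven np c10 js).
have [mu [mui muE]] := probability_of_inv_fun ws lam1 F1 F2 F3 F4' F5.
exists mu; split=> // i.
rewrite -(F6 i (ltn_ord i)) /fun_vec /row_vec.
by rewrite !muE.
Qed.

Lemma csum_decay_tail :
  \sum_(k < n | k != j) C m k * V j m k 0 @[m --> \oo] --> 0.
Proof.
rewrite -[X in _ --> X](_ : \sum_(k < n) 0 = 0 :> R); last by rewrite big1.
under eq_fun do rewrite big_mkcond /=.
apply: (@cvg_fin_sum R _ (fun k m => if k != j then C m k * V j m k 0 else 0) (fun=> 0)) => k.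
case: (boolP (k != j)) => kj; last exact: cvg_cst.
exact: (cone_vec_decay n4 neven np c10 js).
Qed.

(* Only the [j]-th column of the products carries mass asymptotically. *)
Lemma ray_extreme (w : nat -> R) :
  (forall m (k : 'I_n), 0 <= vrun (W m) s w k <= V j m k 0) ->
  forall i : 'I_n, w i = (\sum_(k < n) w k) * V j 0 i 0.
Proof.
move=> wV i; set a := \sum_(k < n) w k.
pose d m := \sum_(k < n | k != j) C m k * V j m k 0.
pose t m := normv (E m *m delta_mx j 0) i 0.
have C0 m : 0 < C m j by apply: lt_le_trans (csum_growth R n4 neven np c10 m jn); rewrite exprn_gt0.
have Cge m k : 0 <= C m k by exact: csum_ge0.
have Ege m (k l : 'I_n) : 0 <= E m k l by exact: thetaprod_ge0.
have EC m (k l : 'I_n) : E m k l <= C m l.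
  by rewrite csumE (bigD1 k) //= lerDl sumr_ge0.
have tE m : t m = E m i j / C m j.
  rewrite /t /normv mxE -colE mxE mulrC; congr (_ / _).
  by rewrite csumE; apply: eq_bigr => k _; rewrite mxE.
have wE m : w i = \sum_(k < n) E m i k * vrun (W m) s w k.
  have /(congr1 (fun M : 'cV[R]_n => M i 0)) := vrun_W m w; rewrite mxE => ->.
  by rewrite mxE; apply: eq_bigr => k _; rewrite mxE.
(* If column [j] alone carried mass, [w i] would equal [a * t m]. The other columns perturb [w i]
   and [a] by amounts in [[0, d m]], and [t m] lies in [[0, 1]]. *)
have bound m : `|w i - a * t m| <= d m.
  have r1 : 0 <= \sum_(k < n | k != j) E m i k * vrun (W m) s w k <= d m.
    apply/andP; split.
      by apply: sumr_ge0 => k _; rewrite mulr_ge0 //; have /andP[] := wV m k.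
    apply: ler_sum => k _; have /andP[h1 h2] := wV m k; exact: ler_pM.
  have r2 : 0 <= \sum_(k < n | k != j) C m k * vrun (W m) s w k <= d m.
    apply/andP; split.
      by apply: sumr_ge0 => k _; rewrite mulr_ge0 //; have /andP[] := wV m k.
    apply: ler_sum => k _; have /andP[h1 h2] := wV m k; exact: ler_pM.
  rewrite (wE m) /a (sum_csum m) (bigD1 j) //= [X in _ - X * _](bigD1 j) //=.
  move: r1 r2; set r := \sum_(k < n | k != j) _; set r' := \sum_(k < n | k != j) _ => r1 r2.
  have Ct : C m j * t m = E m i j by rewrite tE mulrCA divff ?mulr1 // gt_eqF.
  have t01 : 0 <= t m <= 1.
    by rewrite tE divr_ge0 //= ler_pdivrMr // mul1r.
  have -> : E m i j * vrun (W m) s w j + r - (C m j * vrun (W m) s w j + r') * t m = r - r' * t m.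
    by rewrite -Ct; ring.
  apply: norm_sub_range => //; have /andP[t0 t1] := t01; have /andP[r0 rd] := r2.
  by rewrite mulr_ge0 //= -[leRHS]mulr1 ler_pM.
have dc : d m @[m --> \oo] --> 0 by exact: csum_decay_tail.
have tc : t m @[m --> \oo] --> V j 0 i 0.
  have cV : normv (E m *m delta_mx j 0) @[m --> \oo] --> V j 0 by exact: cone_vec_cvg.
  exact: (cvg_comp _ _ cV (@coord_continuous R _ _ i 0 (V j 0))).
have ac : a * t m @[m --> \oo] --> a * V j 0 i 0 by exact: cvg_scale.
have ac' : a * t m @[m --> \oo] --> w i.
  have l1 : w i - d m @[m --> \oo] --> w i.
    by rewrite -[X in _ --> X]subr0; apply: cvgB => //; exact: cvg_cst.
  have l2 : w i + d m @[m --> \oo] --> w i.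
    by rewrite -[X in _ --> X]addr0; apply: cvgD => //; exact: cvg_cst.
  apply: (squeeze_cvgr _ l1 l2); near=> m.
  by have := bound m; rewrite ler_norml; lra.
exact: (cvg_unique _ ac' ac).
Unshelve. all: by end_near. Qed.

Lemma seed_ergodic (mu : probability R R) : inv_prob T mu ->
  (forall i, (i < n)%N -> fun_vec s (lcdf mu) i = v i) -> ergodic T mu.
Proof.
move=> [mu01 muI] muv A mA TA.
have muT : (mu setT < +oo)%E by rewrite probability_setT ltry.
have m01 : measurable (`[0:R, 1[%classic) by exact: measurable_itv.
have muo : mu (~` `[0, 1[%classic) = 0%E by rewrite probability_setC // mu01 subee.
pose nu : {measure set R -> \bar R} := mrestr mu mA.
have nuE B : nu B = mu (B `&` A) by [].
have nu_le B : measurable B -> (nu B <= mu B)%E.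
  by move=> mB; rewrite nuE; apply: le_meas => //; exact: measurableI.
have nuT : (nu setT < +oo)%E by apply: le_lt_trans muT; exact: nu_le.
have nuo : nu (~` `[0, 1[%classic) = 0%E.
  apply/eqP; rewrite eq_le measure_ge0 andbT -[leRHS]muo; apply: nu_le.
  exact: measurableC.
have mT : measurable_fun setT T by exact: measurable_iet.
have nuI B : measurable B -> nu (T @^-1` B) = nu B.
  move=> mB; rewrite !nuE -{1}TA -preimage_setI muI //; exact: measurableI.
have muinv : inv_fun s (lcdf mu) := inv_fun_of_measure ws lam1 muT muI.
have nuinv : inv_fun s (lcdf nu) := inv_fun_of_measure ws lam1 nuT nuI.
pose w := fun_vec s (lcdf nu).
have wsm m : wf n (run (W m) s) := wf_run ws (gW m).
(* Stage [m] vectors are measures of actual subintervals, so [nu <= mu] compares them coordinatewise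
   at every stage, as [ray_extreme] requires. *)
have vw m k : (k < n)%N -> 0 <= vrun (W m) s w k <= vrun (W m) s v k.
  move=> kn; rewrite -(fun_vec_run ws (gW m) nuinv (v := w)) //.
  rewrite -(fun_vec_run ws (gW m) muinv muv) // /fun_vec /row_vec.
  have kr : k \in rtop (run (W m) s) by rewrite (wf_mem_top (wsm m)) inE.
  have l0 := wf_top0 (wsm m) kr.
  set x := pos _ _ _; set y := rlam _ _ in l0 *.
  have xy : x <= x + y by rewrite lerDl ltW.
  apply/andP; split; first by rewrite subr_ge0 lcdf_mono.
  by rewrite -lee_fin -!lcdf_itv // nu_le.
have wray := ray_extreme (w := w) (fun m k => ltac:(rewrite -vrun_cone; exact: vw)).
set a := \sum_(k < n) w k in wray.
have a0 : 0 <= a by apply: sumr_ge0 => k _; have /andP[] := vw 0%N k (ltn_ord k).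
pose m2 : {measure set R -> \bar R} := mscale (NngNum a0) mu.
have m2E B : m2 B = (a%:E * mu B)%E by [].
have m2T : (m2 setT < +oo)%E by rewrite m2E probability_setT mule1 ltry.
have lm2 x : lcdf m2 x = a * lcdf mu x.
  by apply: EFin_inj; rewrite -lcdfE // m2E lcdfE // EFinM.
have key B : measurable B -> nu B = m2 B.
  apply: (measure_eq_of_vec ws lam1 gW) => //.
  - by rewrite m2E muo mule0.
  - by move=> k kr t tl; rewrite !lm2 -!mulrBr muinv.
  - move=> k kn; rewrite -[LHS]/(w k) -[k]/(nat_of_ord (Ordinal kn)) wray.
    rewrite /fun_vec /row_vec !lm2 -mulrBr; congr (_ * _).
    by rewrite -vE -muv.
  - by apply: small_mass => m k kn; have /andP[] := vw m k kn.
have kT := key setT measurableT; have kA := key A mA.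
rewrite nuE setTI m2E probability_setT mule1 in kT.
rewrite nuE setIid m2E kT in kA.
move: kA; rewrite kT -EFinM => -[/eqP]; rewrite -subr_eq0 -{1}[a]mulr1 -mulrBr mulf_eq0.
case/orP => [/eqP->|]; first by left.
by rewrite subr_eq0 => /eqP <-; right.
Qed.

End Seed.

(** Equal vectors would be equal at every stage by injectivity. Then the decay for [j] kills all
    contributions but the [j]-th, the decay for [k] kills that one, and yet their sum is always
    1. *)
Lemma seed_vec_inj (j k : 'I_n) : inS j -> inS k -> j != k -> V j 0 != V k 0.
Proof.
move=> js ks jk; apply/eqP => E0.
have EV m : V j m = V k m.
  by apply: (@thetaprod_inj m); rewrite -!cone_vec_prod.
have one m : \sum_(i < n) C m i * V j m i 0 = 1.
  have := cone_vec_sum R n4 neven np c10 js; rewrite (cone_vec_prod js m) => <-.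
  rewrite -[V j m](_ : col (fun i => oapp (fun i => V j m i 0) 0 (insub i)) = _).
    rewrite -/(rho n p c1 m _) rho_csum; apply: eq_bigr => i _.
    by rewrite mxE valK.
  by apply/matrixP => i l; rewrite ord1 mxE valK.
have c1' : \sum_(i < n) C m i * V j m i 0 @[m --> \oo] --> (0 : R).
  rewrite -[X in _ --> X](_ : \sum_(i < n) 0 = 0 :> R); last by rewrite big1.
  apply: (@cvg_fin_sum R _ (fun (i : 'I_n) m => C m i * V j m i 0) (fun=> 0)) => i.
  have [->|ij] := eqVneq i j.
    under eq_fun do rewrite EV.
    exact: (cone_vec_decay n4 neven np c10 ks).
  exact: (cone_vec_decay n4 neven np c10 js).
have one0 : (fun _ : nat => 1 : R) m @[m --> \oo] --> (0 : R).
  by move: c1'; under eq_fun do rewrite one.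
have one1 : (fun _ : nat => 1 : R) m @[m --> \oo] --> (1 : R) by exact: cvg_cst.
have e10 : 1 = 0 :> R := cvg_unique (@Rhausdorff R) one1 one0.
by move: (oner_neq0 R); rewrite e10 eqxx.
Qed.

Lemma seed_measures : exists mu : 'I_n -> probability R R, forall j, inS j ->
  [/\ inv_prob T (mu j), ergodic T (mu j) & forall i, mu j (Xint lam i) = (V j 0 i 0)%:E].
Proof.
have n1n : (n.-1 < n)%N by lia.
have sl : inS (Ordinal n1n) by rewrite /inS eqxx.
have ex (j : 'I_n) : inS j -> exists mu : probability R R,
    [/\ inv_prob T mu, ergodic T mu & forall i, mu (Xint lam i) = (V j 0 i 0)%:E].
  move=> js; have [mu [mui muv]] := seed_measure js.
  have muv' k : (k < n)%N -> fun_vec s (lcdf mu) k = oapp (fun i => V j 0 i 0) 0 (insub k).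
    by move=> kn; rewrite -[k]/(nat_of_ord (Ordinal kn)) muv.
  exists mu; split=> //; first exact: (seed_ergodic js mui muv').
  have muT : (mu setT < +oo)%E by rewrite probability_setT ltry.
  by move=> i; rewrite (measure_Xint ws) // muv valK.
have ch : forall j : 'I_n, exists mu : probability R R, inS j ->
    [/\ inv_prob T mu, ergodic T mu & forall i, mu (Xint lam i) = (V j 0 i 0)%:E].
  (* [choice] needs a total function, so labels outside [inS] receive the measure of the last label
     as a placeholder. *)
  move=> j; case js : (inS j); first by have [mu muP] := ex j js; exists mu.
  by have [mu _] := ex _ sl; exists mu.
by have [mu muP] := choice ch; exists mu.
Qed.

Lemma measurable_Xint i : measurable (Xint lam i).
Proof.
rewrite (_ : Xint lam i = `[left_top lam i, left_top lam i + lam i[%classic).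
  exact: measurable_itv.
by apply/seteqP; split=> x /=; rewrite /Xint /inX /= in_itv.
Qed.

Theorem iet_ergodic_measures :
  exists L : 'I_n -> 'cV[R]_n,
    (forall j, inS j ->
       normv (E m *m delta_mx j 0) @[m --> \oo] --> L j)
    /\ ~ uniquely_ergodic T
    /\ exists mu : 'I_n -> probability R R,
         (forall j, inS j ->
            [/\ inv_prob T (mu j), ergodic T (mu j)
              & forall i, mu j (Xint lam i) = (L j i 0)%:E])
         /\ (forall j k, inS j -> inS k -> j != k ->
               exists A : set R, measurable A /\ mu j A <> mu k A).
Proof.
have [mu muP] := seed_measures.
have dist (j k : 'I_n) : inS j -> inS k -> j != k ->
    exists A : set R, measurable A /\ mu j A <> mu k A.
  move=> js ks jk; have [i Vi] : exists i, V j 0 i 0 != V k 0 i 0.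
    apply/existsP; apply: contraNT (seed_vec_inj js ks jk).
    rewrite negb_exists => /forallP h; apply/eqP/matrixP => i l; rewrite ord1.
    by have := h i; rewrite negbK => /eqP.
  exists (Xint lam i); split; first exact: measurable_Xint.
  have [_ _ ->] := muP j js; have [_ _ ->] := muP k ks.
  by move=> e; move: Vi; rewrite (EFin_inj e) eqxx.
exists (fun j : 'I_n => V j 0); split; first by move=> j js; exact: cone_vec_cvg.
split; last by exists mu.
(* Unique ergodicity would identify the measures of the seeds [n.-1] and 2, which are different
   labels because [n >= 4]. *)
move=> [mu0 [_ U]].
have n1n : (n.-1 < n)%N by lia.
have n2n : (2 < n)%N by lia.
have s1 : inS (Ordinal n1n) by rewrite /inS eqxx.
have s2 : inS (Ordinal n2n) by rewrite /inS orbT.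
have s12 : Ordinal n1n != Ordinal n2n by rewrite -val_eqE /=; lia.
have [A [mA]] := dist _ _ s1 s2 s12; apply.
have [i1 _ _] := muP _ s1; have [i2 _ _] := muP _ s2.
by rewrite (U _ i1 A mA) (U _ i2 A mA).
Qed.

End Main.

Theorem theorem1 (R : realType) (n p c1 : nat) (lam : 'I_n -> R) :
  (4 <= n)%N -> ~~ odd n -> (n.+1 <= p)%N -> (0 < c1)%N ->
  (forall i, 0 < lam i) -> \sum_i lam i = 1 ->
  (forall m, rauzy_types (size (Wpre n p c1 m)) (init_state lam)
             = Some (Wpre n p c1 m)) ->
  exists L : 'I_n -> 'cV[R]_n,
    (forall j, inS j ->
       normv (thetaprod R n p c1 m *m delta_mx j 0) @[m --> \oo] --> L j)
    /\ ~ uniquely_ergodic (iet lam)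
    /\ exists mu : 'I_n -> probability R R,
         (forall j, inS j ->
            [/\ inv_prob (iet lam) (mu j), ergodic (iet lam) (mu j)
              & forall i, mu j (Xint lam i) = (L j i 0)%:E])
         /\ (forall j k, inS j -> inS k -> j != k ->
               exists A : set R, measurable A /\ mu j A <> mu k A).
Proof.
move=> n4 neven np c10 lam0 lam1 path.
exact: iet_ergodic_measures.
Qed.
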